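(* Let $X$ be a discrete random variable with finite support and $Y$ a continuous random variable (jointly distributed with $X$) that has a moment-generating function and satisfies $h(Y)>-\infty$. For $x\in\mathrm{supp}(X)$ let $Y^{(x)}$ denote $Y$ conditioned on $\{X=x\}$. Then $$I(X;Y)=\frac12\lim_{n\to\infty}\int_0^\infty\Big(\mathrm{pmmse}_n(Y,t)-\sum_{x\in\mathrm{supp}(X)}P(X=x)\,\mathrm{pmmse}_n(Y^{(x)},t)\Big)dt.$$
   Context: For a random variable $R$ with finite $2n$-th moment, $\mathrm{pmmse}_n(R,t):=\min_{\boldsymbol{c}\in\mathbb{R}^{n+1}}\mathbb{E}[(R-\boldsymbol{c}^T(1,Z,\dots,Z^n)^T)^2]$ with $Z=\sqrt{t}R+N$, $N\sim\mathcal{N}(0,1)$ independent of $R$. $I(X;Y)$ is mutual information and $h$ is differential entropy. *)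

(* Defs.v *)
From HB Require Import structures.
From mathcomp Require Import all_boot all_order all_algebra.
From mathcomp Require Import all_classical all_reals all_analysis.
Set Implicit Arguments. Unset Strict Implicit. Unset Printing Implicit Defensive.
Import Order.TTheory GRing.Theory Num.Theory.
Import numFieldNormedType.Exports.
Local Open Scope classical_set_scope.
Local Open Scope ring_scope.
Local Open Scope ereal_scope.

Section Defs.
Variable R : realType.
Notation leb := (@lebesgue_measure R).

Definition is_density (g : R -> R) : Prop :=
  measurable_fun setT g /\ (forall y, (0 <= g y)%R) /\
  \int[leb]_y (g y)%:E = 1.

Definition gauss (z : R) : R :=
  (expR (- (z ^+ 2) / 2) / Num.sqrt (2 * pi))%R.

(* E[(R - c^T (1,Z,...,Z^n))^2] with Z = sqrt t R + N, R with density g,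
   N ~ N(0,1) independent of R. *)
Definition poly_mse (g : R -> R) (t : R) (n : nat) (c : 'I_n.+1 -> R) : \bar R :=
  \int[leb]_r ((g r)%:E *
     \int[leb]_z ((gauss (z - Num.sqrt t * r) *
                   (r - \sum_(k < n.+1) c k * z ^+ k) ^+ 2)%R)%:E).

Definition pmmse (g : R -> R) (n : nat) (t : R) : \bar R :=
  ereal_inf [set poly_mse g t c | c in [set: 'I_n.+1 -> R]].

(* density of Y given the law p of X and the conditional densities f x *)
Definition mix_density (K : finType) (p : K -> R) (f : K -> R -> R) (y : R) : R :=
  (\sum_(x : K) p x * f x y)%R.

Definition kl_div (g q : R -> R) : \bar R :=
  \int[leb]_y ((g y * ln (g y / q y))%R)%:E.

Definition mutual_info (K : finType) (p : K -> R) (f : K -> R -> R) : \bar R :=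
  \sum_(x : K) (p x)%:E * kl_div (f x) (mix_density p f).

(* h(Y) = - int g ln g > -oo, i.e. the positive part of g ln g is integrable *)
Definition diff_entropy_gt_ninfty (g : R -> R) : Prop :=
  \int[leb]_y (Num.max (g y * ln (g y)) 0)%:E < +oo.

Definition has_mgf (g : R -> R) : Prop :=
  exists delta : R, (0 < delta)%R /\
    forall s : R, (`|s| < delta)%R ->
      \int[leb]_y ((expR (s * y) * g y)%R)%:E < +oo.

End Defs.

(* Main.v *)
(* Let Y_c = c Y + N, let J(c) be the relative entropy of its law with respect
   to that of N, and let M(c) be the second moment of E[Y | Y_c].  Jensen's
   inequality, applied to one additional Gaussian step of variance t - s, gives
     (t - s)/2 M(sqrt s) <= J(sqrt t) - J(sqrt s)
                         <= (t - s) M(sqrt t) - (t - s)/2 M(sqrt s).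
   Hence t |-> M(sqrt t) is nondecreasing and its integral over [s, t] is
   2 (J(sqrt t) - J(sqrt s)): the I-MMSE relation, without differentiation.

   As Y has exponential moments, so has Y_c; polynomials are then dense in the
   L2 space of its law, and pmmse_n decreases to the mmse.  The gap between
   pmmse_n of Y and the mean of the pmmse_n of the Y^(x) is at most E[Y^2] for
   t <= 1 and at most 1/t - sum_x p_x mmse(Y^(x), t) for t > 1, since Z/sqrt t
   is a linear estimator of error 1/t; h(Y) > -oo bounds the integral of the
   latter over [1, T] uniformly in T.  By dominated convergence the integrals
   of the gap tend to the integral of the mmse gap, which by I-MMSE is
   2 lim_c I(X; c Y + N).  This limit is I(X; Y): it is at most I(X; Y) by data
   processing, and at least I(X; Y) by the Donsker-Varadhan inequality with
   bounded continuous test functions. *)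
Require Import Defs.
From HB Require Import structures.
From mathcomp Require Import all_boot all_order all_algebra.
From mathcomp Require Import all_classical all_reals all_analysis.
From mathcomp Require Import measurable_realfun ring lra.
Import Order.TTheory GRing.Theory Num.Theory.
Import numFieldNormedType.Exports.
Local Open Scope classical_set_scope.
Local Open Scope ring_scope.

Set Implicit Arguments. Unset Strict Implicit. Unset Printing Implicit Defensive.

(** * Densities and Gaussian integrals *)

(** Output laws are represented by their densities [Lam] with respect to N(0,1), with the likelihood
    [kap] as channel kernel: averaging over Y and translating the noise both become integrations
    against [kap]. Each convexity argument is one tangent line, of the exponential, of x ln x or of
    ln [Lam], integrated at a well chosen point.

    The two bounds on the increment of J fix 2 (J(sqrt t) - J(sqrt s)) up to 2 (t - s) (M(sqrt t) -
    M(sqrt s)). Over n equal steps these errors telescope to a multiple of 1/n.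

    The obstacle is large t: 1/t is not integrable, and J of Y and of the Y^(x) grow linearly in t.
    Adding noise does not lower the entropy, so h(c Y + N) >= ln c + h(Y); this puts a term - ln c
    into an upper bound of J, which with c = sqrt T cancels the integral ln T of 1/t, and the linear
    terms cancel as well. What remains is E[Y^2], constants and I(X; Y), finite because the density
    of Y^(x) is at most 1/p_x times that of Y. *)

Section affine.
Variable R : realType.
Notation mu := (@lebesgue_measure R).
Local Open Scope ereal_scope.

(** By uniqueness of Lebesgue measure it is enough to compare both sides on half-open intervals. *)
Lemma lebesgue_measure_affine (a b : R) (A : set R) : (0 < a)%R ->
  measurable A ->
  mu A = a%:E * pushforward mu ((fun x : R => a * x + b)%R : measurableTypeR R -> measurableTypeR R) A.
Proof.
move=> a0 mA.
have mf : measurable_fun setT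
    ((fun x : R => a * x + b)%R : measurableTypeR R -> measurableTypeR R).
  by apply: measurable_funD => //; exact: measurable_funM.
pose f : {mfun measurableTypeR R >-> measurableTypeR R} := HB.pack (fun x : R => a * x + b)%R
  (isMeasurableFun.Build _ _ _ _ _ mf).
rewrite (@lebesgue_measure_unique _ (mscale (NngNum (ltW a0)) (pushforward mu f)))//.
move=> _ [[u v]] _ <-.
rewrite /= /mscale/= /pushforward.
have -> : f @^-1` `]u, v]%classic = `]((u - b) / a)%R, ((v - b) / a)%R]%classic :> set R.
  apply/seteqP; split => x /=; rewrite !in_itv/= ltr_pdivrMr// ler_pdivlMr//;
   rewrite mulrC; lra.
rewrite !lebesgue_measure_itv/= !lte_fin ltr_pM2r ?invr_gt0// ltrD2r.
case: ifPn => // _; last by rewrite mule0.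
by rewrite -!EFinB -EFinM; congr EFin; field; lra.
Qed.

Lemma ge0_integral_affine (a b : R) (f : R -> \bar R) : (0 < a)%R ->
  measurable_fun setT f -> (forall x, 0 <= f x) ->
  \int[mu]_x f x = a%:E * \int[mu]_x f (a * x + b)%R.
Proof.
move=> a0 mf f0.
have mg : measurable_fun setT
    ((fun x : R => a * x + b)%R : measurableTypeR R -> measurableTypeR R).
  by apply: measurable_funD => //; exact: measurable_funM.
pose g : {mfun measurableTypeR R >-> measurableTypeR R} := HB.pack (fun x : R => a * x + b)%R
  (isMeasurableFun.Build _ _ _ _ _ mg).
rewrite (@eq_measure_integral _ _ _ _ (mscale (NngNum (ltW a0)) (pushforward mu g))); last first.
  by move=> A mA _; exact: lebesgue_measure_affine.
rewrite ge0_integral_mscale//=; congr (_ * _).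
by rewrite (ge0_integral_pushforward mg).
Qed.

End affine.

Section dens.
Variable R : realType.
Notation mu := (@lebesgue_measure R).
Local Open Scope ereal_scope.

(** The proof [hg] is an argument so that the measure and probability structures below can be
    inferred from the term [dens hg] alone. *)
Definition dens (g : R -> R) (hg : is_density g) (A : set (measurableTypeR R)) : \bar R :=
  \int[mu]_(x in A) (g x)%:E.

Section dens_measure.
Variables (g : R -> R) (hg : is_density g).

Lemma density_integrable : mu.-integrable setT (EFin \o g).
Proof.
have [mg [g0 g1]] := hg; apply/integrableP; split; first exact/measurable_EFinP.
under eq_integral do rewrite /= ger0_norm//.
by rewrite g1 ltry.
Qed.

Let dens0 : dens hg set0 = 0. Proof. by rewrite /dens integral_set0. Qed.

Let dens_ge0 A : 0 <= dens hg A.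
Proof. by apply: integral_ge0 => x _; rewrite lee_fin; have [_ []] := hg. Qed.

Let dens_sigma_additive : semi_sigma_additive (dens hg).
Proof.
move=> /= A mA tA mUA; rewrite /dens/= integral_bigcup//=; last first.
  by apply: (integrableS _ _ (subsetT _)) => //; exact: density_integrable.
apply: is_cvg_ereal_nneg_natsum_cond => n _ _.
by apply: integral_ge0 => /= x ?; rewrite lee_fin; have [_ []] := hg.
Qed.

HB.instance Definition _ := isMeasure.Build _ _ _
  (dens hg) dens0 dens_ge0 dens_sigma_additive.

Let dens_setT : dens hg setT = 1.
Proof. by have [_ []] := hg. Qed.

HB.instance Definition _ :=
  @Measure_isProbability.Build _ _ R (dens hg) dens_setT.

Lemma dens_dominates : dens hg `<< mu.
Proof.
apply/null_content_dominatesP => A mA muA0; rewrite /dens.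
apply: null_set_integral => //=; apply: measurable_funTS => /=.
by apply/measurable_EFinP; case: (hg).
Qed.

(** The change of variables holds for the Radon-Nikodym derivative [h]; [h] and [g] have the same
    integral over every measurable set, hence agree almost everywhere. *)
Lemma ge0_integral_dens (f : R -> \bar R) : measurable_fun setT f ->
  (forall x, 0 <= f x) ->
  \int[dens hg]_x f x = \int[mu]_x (f x * (g x)%:E).
Proof.
move=> mf f0; rewrite -(Radon_Nikodym_SigmaFinite.change_of_variables dens_dominates)//.
have mg : measurable_fun setT g by have [] := hg.
have := Radon_Nikodym_SigmaFinite.f_integrable dens_dominates.
set h := Radon_Nikodym_SigmaFinite.f _ _ => ih.
have mh : measurable_fun setT h by exact: measurable_int ih.
apply: ae_eq_integral => //.
- exact: emeasurable_funM.
- by apply: emeasurable_funM => //; exact/measurable_EFinP.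
apply: ae_eqe_mul2l.
apply: integral_ae_eq => //; first exact/measurable_EFinP.
by move=> A _ mA; rewrite -(Radon_Nikodym_SigmaFinite.f_integral dens_dominates).
Qed.

Lemma integrable_dens (f : R -> R) : measurable_fun setT f ->
  (dens hg).-integrable setT (EFin \o f) <->
  mu.-integrable setT (fun x => (f x * g x)%:E).
Proof.
have [mg [g0 _]] := hg; move=> mf.
suff E : \int[dens hg]_x `|(EFin \o f) x| = \int[mu]_x `|(f x * g x)%:E|.
  split => /integrableP[_ fo]; apply/integrableP; split.
  - by apply/measurable_EFinP; exact: measurable_funM.
  - by rewrite -E.
  - exact/measurable_EFinP.
  - by rewrite E.
rewrite ge0_integral_dens//; last first.
  by apply: measurableT_comp => //; exact/measurable_EFinP.
by apply: eq_integral => x _ /=; rewrite normrM EFinM (ger0_norm (g0 x)).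
Qed.

Lemma Rintegral_dens (f : R -> R) : measurable_fun setT f ->
  (dens hg).-integrable setT (EFin \o f) ->
  (\int[dens hg]_x f x = \int[mu]_x (f x * g x))%R.
Proof.
have [mg [g0 _]] := hg; move=> mf fi; rewrite /Rintegral; congr fine.
rewrite integralE [RHS]integralE !ge0_integral_dens//.
- congr (_ - _); apply: eq_integral => x _.
    by rewrite !funeposE /= -!EFin_max -EFinM maxr_pMl// mul0r.
  by rewrite !funenegE /= -!EFin_max -EFinM maxr_pMl// mul0r mulNr.
- by apply: measurable_funeneg; exact/measurable_EFinP.
- by apply: measurable_funepos; exact/measurable_EFinP.
Qed.

End dens_measure.

End dens.

Ltac mfun := repeat first
  [ assumption | exact: measurable_id | exact: measurable_cst | exact: measurable_fst | exact: measurable_snd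
  | apply: measurable_funD | apply: measurable_funB | apply: measurable_funM
  | apply: measurable_funX | apply: measurable_funN
  | apply: (measurableT_comp (@measurable_expR _))
  | apply: (measurableT_comp (@measurable_ln _))
  | apply: (measurableT_comp (@normr_measurable _ _))
  | apply: (measurableT_comp (@oppr_measurable _ _)) ].

Section gaussian.
Variable R : realType.
Notation mu := (@lebesgue_measure R).
Implicit Types a v x : R.

Lemma gauss_ge0 x : 0 <= gauss x.
Proof. by rewrite /gauss divr_ge0// ?expR_ge0// sqrtr_ge0. Qed.

Lemma gauss_gt0 x : 0 < gauss x.
Proof. by rewrite /gauss divr_gt0// ?expR_gt0// sqrtr_gt0 mulr_gt0// pi_gt0. Qed.

Lemma measurable_gauss : measurable_fun setT (@gauss R).
Proof. by rewrite /gauss; mfun. Qed.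

Lemma gauss_normal_pdf : @gauss R = normal_pdf 0 1.
Proof.
apply/funext => x; rewrite normal_pdfE ?oner_eq0// /normal_fun /normal_peak.
by rewrite /gauss subr0 expr1n mul1r mulrC mulr_natl.
Qed.

Lemma gauss_density : is_density (@gauss R).
Proof.
split; first exact: measurable_gauss.
by split; [exact: gauss_ge0|rewrite gauss_normal_pdf integral_normal_pdf].
Qed.

Definition gam := dens gauss_density.
HB.instance Definition _ := Probability.on gam.

(* The likelihood ratio of N(a,1) with respect to N(0,1). *)
Definition kap a v := expR (a * v - a ^+ 2 / 2).

Lemma gauss_shift a v : gauss (v - a) = kap a v * gauss v.
Proof.
rewrite /gauss /kap mulrA -expRD; congr (expR _ / _); by field.
Qed.

Lemma kap_gt0 a v : 0 < kap a v. Proof. exact: expR_gt0. Qed.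

Lemma kap_ge0 a v : 0 <= kap a v. Proof. exact: expR_ge0. Qed.

Lemma measurable_kap a : measurable_fun setT (kap a).
Proof. by rewrite /kap; mfun. Qed.

(** The weight [kap a] turns N(0,1) into N(a,1), by [gauss_shift]. Through this formula every
    statement on the channel is transferred to the fixed law N(0,1). *)
Lemma ge0_integral_gam_shift a (F : R -> \bar R) : measurable_fun setT F ->
  (forall x, 0 <= F x)%E ->
  (\int[gam]_v ((kap a v)%:E * F v) = \int[gam]_v F (v + a)%R)%E.
Proof.
move=> mF F0.
have mFa : measurable_fun setT (fun v => F (v + a)).
  by apply: measurableT_comp => //; mfun.
rewrite !ge0_integral_dens//; first last.
- by move=> x; rewrite mule_ge0// lee_fin kap_ge0.
- by apply: emeasurable_funM => //; apply/measurable_EFinP; exact: measurable_kap.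
rewrite (@ge0_integral_affine _ 1 a (fun x => ((kap a x)%:E * F x * (gauss x)%:E)%E))//.
- rewrite mul1e; apply: eq_integral => x _.
  rewrite mul1r muleAC -EFinM -gauss_shift addrK; exact: muleC.
- apply: emeasurable_funM; last by apply/measurable_EFinP; exact: measurable_gauss.
  by apply: emeasurable_funM => //; apply/measurable_EFinP; exact: measurable_kap.
- by move=> x; rewrite !mule_ge0 ?lee_fin ?kap_ge0// gauss_ge0.
Qed.

Lemma integral_gauss_affine a b : 0 < a ->
  (\int[mu]_x (gauss (a * x + b))%:E = (a^-1)%:E)%E.
Proof.
move=> a0; have [mg [g0 g1]] := gauss_density.
have := @ge0_integral_affine _ a b (EFin \o @gauss R) a0.
rewrite /= g1 => /(_ _ _)/esym H.
have := H _ _; rewrite -/(_ = _) => {}H.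
have {}H : (a%:E * \int[mu]_x (gauss (a * x + b))%:E = 1)%E.
  by apply: H => //; exact/measurable_EFinP.
have [] := boolP (\int[mu]_x (gauss (a * x + b))%:E \is a fin_num)%E => [/fineK fK|].
  rewrite -fK -EFinM in H; rewrite -fK; congr EFin.
  by case: H => H; apply: (mulfI (lt0r_neq0 a0)); rewrite H divff ?gt_eqF.
rewrite ge0_fin_numE ?integral_ge0//; last by move=> x _; rewrite lee_fin gauss_ge0.
rewrite -leNgt leye_eq => /eqP E; move: H; rewrite E mulry gtr0_sg// mul1e.
by [].
Qed.

End gaussian.
Arguments gam : clear implicits.

Section curried_fubini.
Variable R : realType.
Notation RR := (measurableTypeR R).
Implicit Types m : {sigma_finite_measure set RR -> \bar R}.
Local Open Scope ereal_scope.

(* The library states joint measurability and Fubini over [measurableTypeR R], which is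
   convertible to [R] but does not unify with it; hence the curried versions below. *)
Definition mfun2 {d} {T : measurableType d} (f : R -> R -> T) :=
  measurable_fun (setT : set (RR * RR)) (fun p => f p.1 p.2).

Lemma measurable_tonelli m (f : R -> R -> \bar R) :
  mfun2 f -> (forall x y, 0 <= f x y) ->
  measurable_fun (setT : set R) (fun x => \int[m]_y f x y).
Proof.
move=> mf f0.
exact: (@measurable_fun_fubini_tonelli_F _ _ RR RR R m _ mf (fun=> f0 _ _)).
Qed.

Lemma tonelli m1 m2 (f : R -> R -> \bar R) :
  mfun2 f -> (forall x y, 0 <= f x y) ->
  \int[m1]_x \int[m2]_y f x y = \int[m2]_y \int[m1]_x f x y.
Proof.
move=> mf f0.
exact: (@fubini_tonelli _ _ RR RR R m1 m2 _ mf (fun=> f0 _ _)).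
Qed.

Lemma mfun2_swap d (T : measurableType d) (f : R -> R -> T) : mfun2 f -> mfun2 (fun x y => f y x).
Proof.
move=> mf.
apply: (measurableT_comp mf (f := fun p : RR * RR => f p.1 p.2) (g := fun p : RR * RR => (p.2, p.1))).
exact: measurable_fun_pair.
Qed.

Lemma mfun2_l d (T : measurableType d) (f : R -> R -> T) y : mfun2 f -> measurable_fun (setT : set R) (f ^~ y).
Proof.
move=> mf.
apply: (measurableT_comp mf (f := fun p : RR * RR => f p.1 p.2) (g := fun x : RR => (x, y))).
exact: measurable_fun_pair.
Qed.

Lemma mfun2_r d (T : measurableType d) (f : R -> R -> T) x : mfun2 f -> measurable_fun (setT : set R) (f x).
Proof. by move=> /mfun2_swap/(mfun2_l x). Qed.

Lemma mfun2_comp d (T : measurableType d) (f : R -> T) (g : R -> R -> R) :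
  measurable_fun setT f -> mfun2 g -> mfun2 (fun x y => f (g x y)).
Proof.
by move=> mf mg; exact: (measurableT_comp mf (g := fun p : RR * RR => g p.1 p.2)).
Qed.

Lemma mfun2_fst d (T : measurableType d) (f : R -> T) :
  measurable_fun setT f -> mfun2 (fun x _ => f x).
Proof. by move=> mf; apply: mfun2_comp => //; exact: measurable_fst. Qed.

Lemma mfun2_snd d (T : measurableType d) (f : R -> T) :
  measurable_fun setT f -> mfun2 (fun _ y => f y).
Proof. by move=> mf; apply: mfun2_comp => //; exact: measurable_snd. Qed.

End curried_fubini.

(** * Rotation invariance of the Gaussian law *)

Section rotation.
Variable R : realType.
Notation mu := (@lebesgue_measure R).

(** With x = a u + b v the left side is, up to a constant, the joint density of (x, u). Completing
    the square in u factors it into the law N(0, c^2) of x and the conditional law N(a x / c^2, b^2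
    / c^2) of u. *)
Lemma gauss_rotation (a b c x u : R) : (0 < b)%R -> (0 < c)%R ->
  (c ^+ 2 = a ^+ 2 + b ^+ 2)%R ->
  (gauss (b^-1 * x + - (a * u) / b) * gauss u =
   gauss (c^-1 * x) * gauss ((c / b) * u + - (a * x) / (c * b)))%R.
Proof.
move=> b0 c0 cab; rewrite /gauss.
set k := Num.sqrt _.
rewrite !(mulrACA _ k^-1) -!expRD; congr (expR _ * _)%R.
have -> : (c / b * u + - (a * x) / (c * b) = (c ^+ 2 * u - a * x) / (c * b))%R.
  by field; rewrite !gt_eqF.
have E : (c ^+ 2 * ((x - a * u)^+2 + b ^+ 2 * u ^+ 2)  = b ^+ 2 * x ^+ 2 + (c ^+ 2 * u - a * x) ^+ 2)%R.
  have -> : (b ^+ 2 = c ^+ 2 - a ^+ 2)%R by rewrite cab; ring.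
  by ring.
have -> : (b^-1 * x + - (a * u) / b = (x - a * u) / b)%R by field; rewrite gt_eqF.
apply: (@mulfI _ (2 * c ^+ 2 * b ^+ 2)%R); first by rewrite !mulf_neq0 ?expf_neq0 ?gt_eqF.
transitivity (- (c ^+ 2 * ((x - a * u)^+2 + b ^+ 2 * u ^+ 2)))%R.
  by field; rewrite gt_eqF.
rewrite E.
by field; rewrite !gt_eqF.
Qed.

Local Open Scope ereal_scope.

(** Substitute x = a u + b v in the inner integral, exchange the integrals and factor by
    [gauss_rotation]: the integral over u is then b / c, and the density of c times a standard
    Gaussian remains. *)
Lemma ge0_integral_gam_rotation (a b c : R) (F : R -> \bar R) :
  (0 < b)%R -> (0 < c)%R -> (c ^+ 2 = a ^+ 2 + b ^+ 2)%R ->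
  measurable_fun setT F -> (forall x, 0 <= F x) ->
  \int[gam R]_u \int[gam R]_v F (a * u + b * v)%R = \int[gam R]_z F (c * z)%R.
Proof.
move=> b0 c0 cab mF F0.
have mg := @measurable_gauss R.
have g0 := @gauss_ge0 R.
rewrite ge0_integral_dens//; first last.
- by move=> u; exact: integral_ge0.
- apply: (@measurable_tonelli R (gam R) (fun x v => F (a * x + b * v)%R)) => //.
  by apply: mfun2_comp => //; rewrite /mfun2; mfun.
pose K x y := F y * (b^-1 * (gauss (b^-1 * y + - (a * x) / b) * gauss x))%:E.
have mK : mfun2 K.
  apply: emeasurable_funM; first exact: mfun2_snd.
  apply/measurable_EFinP; mfun.
have K0 x y : 0 <= K x y.
  by rewrite mule_ge0// lee_fin !mulr_ge0// invr_ge0 ltW.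
transitivity (\int[mu]_u \int[mu]_x K u x).
  apply: eq_integral => u _.
  have mFu : measurable_fun setT (fun v => F (a * u + b * v)%R).
    by apply: measurableT_comp => //; mfun.
  rewrite ge0_integral_dens//.
  rewrite (@ge0_integral_affine _ (b^-1)%R (- (a * u) / b)%R _)//; last 3 first.
  - by rewrite invr_gt0.
  - by apply: emeasurable_funM => //; exact/measurable_EFinP.
  - by move=> x; rewrite mule_ge0// lee_fin.
  rewrite muleAC -EFinM -ge0_integralZl//; first last.
  - by rewrite lee_fin mulr_ge0// invr_ge0 ltW.
  - by move=> x _; rewrite mule_ge0// lee_fin.
  - apply: emeasurable_funM; first by apply: measurableT_comp => //; mfun.
    by apply/measurable_EFinP; apply: (measurableT_comp mg); mfun.
  apply: eq_integral => x _; rewrite /K/=.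
  rewrite (_ : (a * u + b * (b^-1 * x + - (a * u) / b) = x)%R); last by field; rewrite gt_eqF.
  by rewrite muleCA -EFinM; congr (_ * _%:E)%E; ring.
rewrite (tonelli mu mu mK)//.
transitivity (\int[mu]_x (F x * (c^-1 * gauss (c^-1 * x))%:E)).
  apply: eq_integral => x _.
  transitivity (\int[mu]_u ((F x * (b^-1 * gauss (c^-1 * x))%:E) *
      (gauss ((c / b) * u + - (a * x) / (c * b)))%:E)).
    apply: eq_integral => u _; rewrite /K -muleA -EFinM; congr (_ * _%:E)%E.
    by rewrite (gauss_rotation _ _ b0 c0 cab) mulrA.
  rewrite ge0_integralZl//; first last.
  - by rewrite mule_ge0// lee_fin mulr_ge0// invr_ge0 ltW.
  - by move=> u _; rewrite lee_fin.
  - by apply/measurable_EFinP; apply: (measurableT_comp mg); mfun.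
  rewrite integral_gauss_affine; last by rewrite divr_gt0.
  rewrite -muleA -EFinM; congr (_ * _%:E)%E; field; rewrite !gt_eqF//.
rewrite [RHS]ge0_integral_dens//; last by apply: measurableT_comp => //; mfun.
rewrite (@ge0_integral_affine _ c 0%R _)//; first last.
- by move=> x; rewrite mule_ge0// lee_fin mulr_ge0// invr_ge0 ltW.
- by apply: emeasurable_funM => //; apply/measurable_EFinP; mfun.
rewrite -ge0_integralZl//; first last.
- by rewrite lee_fin ltW.
- by move=> x _; rewrite mule_ge0// lee_fin mulr_ge0// invr_ge0 ltW.
- apply: emeasurable_funM; first by apply: measurableT_comp => //; mfun.
  by apply/measurable_EFinP; mfun.
apply: eq_integral => x _; rewrite addr0 mulKf ?gt_eqF// muleCA -EFinM.
by rewrite mulrA divff ?gt_eqF// mul1r.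
Qed.

End rotation.

Section curried_Fubini.
Variable R : realType.
Notation RR := (measurableTypeR R).
Implicit Types m : {sigma_finite_measure set RR -> \bar R}.

Definition intb m (f : R -> R) := m.-integrable (setT : set RR) (EFin \o f).

Definition int2 m1 m2 (f : R -> R -> R) :=
  (m1 \x m2)%E.-integrable (setT : set (RR * RR)) (fun p => (f p.1 p.2)%:E).

Lemma measurable_Rint m (f : R -> R -> R) : mfun2 f ->
  measurable_fun (setT : set R) (fun x => \int[m]_y f x y).
Proof.
move=> mf; apply: (measurableT_comp (@fine_measurable R setT measurableT)).
have mf' : mfun2 (fun x y => (f x y)%:E) by exact/measurable_EFinP.
rewrite (_ : (fun _ => _) = (fun x => \int[m]_y (EFin \o f x)^\+ y - \int[m]_y (EFin \o f x)^\- y)%E); last first.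
  by apply/funext => x; rewrite integralE.
apply: emeasurable_funB.
- apply: (@measurable_tonelli _ m (fun x y => (EFin \o f x)^\+ y)%E) => //.
  rewrite /mfun2; under eq_fun do rewrite funeposE.
  exact: measurable_maxe.
- apply: (@measurable_tonelli _ m (fun x y => (EFin \o f x)^\- y)%E) => //.
  rewrite /mfun2; under eq_fun do rewrite funenegE.
  by apply: measurable_maxe => //; exact: measurableT_comp.
Qed.

Lemma int2_swap m1 m2 (f : R -> R -> R) : int2 m1 m2 f ->
  int2 m2 m1 (fun x y => f y x).
Proof.
move=> fi.
have mf : mfun2 (fun x y => (f x y)%:E) by exact: (measurable_int _ fi).
apply/(@integrable12ltyP _ _ RR RR).
  exact: mfun2_swap mf.
by have /(@integrable21ltyP _ _ RR RR) := fi; exact.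
Qed.

(** Integrability of every section, not just of almost every one, identifies the real inner integral
    with the extended one at each point. The tilted integrands below all satisfy it. *)
Lemma int2_l m1 m2 (f : R -> R -> R) : int2 m1 m2 f ->
  (forall x, intb m2 (f x)) -> intb m1 (fun x => \int[m2]_y f x y).
Proof.
move=> fi fx; have := @integrable_fubini_F _ _ RR RR R m1 m2 _ fi.
apply: eq_integrable => // x _; rewrite /fubini_F/= /Rintegral fineK//.
by apply: integrable_fin_num => //; exact: fx.
Qed.

Lemma int2_r m1 m2 (f : R -> R -> R) : int2 m1 m2 f ->
  (forall y, intb m1 (f ^~ y)) -> intb m2 (fun y => \int[m1]_x f x y).
Proof. by move=> /int2_swap/int2_l; exact. Qed.

Lemma FubiniR m1 m2 (f : R -> R -> R) : int2 m1 m2 f ->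
  (forall x, intb m2 (f x)) -> (forall y, intb m1 (f ^~ y)) ->
  \int[m1]_x \int[m2]_y f x y = \int[m2]_y \int[m1]_x f x y.
Proof.
move=> fi fx fy; have := @Fubini _ _ RR RR R m1 m2 _ fi.
rewrite /Rintegral => E; congr fine.
transitivity (\int[m1]_x \int[m2]_y (f x y)%:E)%E.
  apply: eq_integral => x _; rewrite fineK//.
  by apply: integrable_fin_num => //; exact: fx.
rewrite E; apply: eq_integral => y _; rewrite fineK//.
by apply: integrable_fin_num => //; exact: fy.
Qed.

End curried_Fubini.

Section real_integral.
Variables (R : realType).
Notation RR := (measurableTypeR R).
Variable m : {sigma_finite_measure set RR -> \bar R}.
Implicit Types f g : R -> R.

Lemma intbD f g : intb m f -> intb m g -> intb m (fun x => f x + g x).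
Proof. by move=> fi gi; exact: (integrableD _ fi gi). Qed.

Lemma intbB f g : intb m f -> intb m g -> intb m (fun x => f x - g x).
Proof. by move=> fi gi; exact: (integrableB _ fi gi). Qed.

Lemma intbZ k f : intb m f -> intb m (fun x => k * f x).
Proof. by move=> fi; exact: (integrableZl _ _ fi). Qed.

Lemma intb_le f g : measurable_fun setT f -> (forall x, `|f x| <= g x) ->
  intb m g -> intb m f.
Proof.
move=> mf fg; apply: le_integrable => //.
  exact/measurable_EFinP.
by move=> x _; rewrite lee_fin/= (le_trans (fg x))// ler_norm.
Qed.

Lemma RintD f g : intb m f -> intb m g ->
  \int[m]_x (f x + g x) = \int[m]_x f x + \int[m]_x g x.
Proof. by move=> fi gi; rewrite RintegralD. Qed.

Lemma RintB f g : intb m f -> intb m g ->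
  \int[m]_x (f x - g x) = \int[m]_x f x - \int[m]_x g x.
Proof. by move=> fi gi; rewrite RintegralB. Qed.

Lemma RintZ k f : intb m f -> \int[m]_x (k * f x) = k * \int[m]_x f x.
Proof. by move=> fi; rewrite RintegralZl. Qed.

Lemma le_Rint f g : intb m f -> intb m g -> (forall x, f x <= g x) ->
  \int[m]_x f x <= \int[m]_x g x.
Proof. by move=> fi gi fg; apply: le_Rintegral. Qed.

Lemma EFin_Rint f : intb m f -> (\int[m]_x f x)%:E = (\int[m]_x (f x)%:E)%E.
Proof. by move=> fi; rewrite /Rintegral fineK// integrable_fin_num. Qed.

Lemma measurable_intb f : intb m f -> measurable_fun setT f.
Proof. by move=> /measurable_int/measurable_EFinP. Qed.

Lemma eq_Rint f g : f =1 g -> \int[m]_x f x = \int[m]_x g x.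
Proof. by move=> fg; apply: eq_Rintegral => x _; exact: fg. Qed.

Lemma eq_intb f g : f =1 g -> intb m f -> intb m g.
Proof. by move=> fg; rewrite (_ : g = f)//; apply/funext. Qed.

Lemma ge0_intb f : measurable_fun setT f -> (forall x, 0 <= f x) ->
  (\int[m]_x (f x)%:E < +oo)%E -> intb m f.
Proof.
move=> mf f0 foo; apply/integrableP; split; first exact/measurable_EFinP.
by under eq_integral do rewrite /= ger0_norm//.
Qed.

Lemma intb_ltoo f : (forall x, 0 <= f x) -> intb m f ->
  (\int[m]_x (f x)%:E < +oo)%E.
Proof.
move=> f0 /integrableP[_]; congr (_ < _)%E; apply: eq_integral => x _ /=.
by rewrite ger0_norm.
Qed.

End real_integral.

Section probability_integral.
Variables (R : realType).
Notation RR := (measurableTypeR R).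
Variable P : probability RR R.

Lemma intb_cst k : intb P (cst k).
Proof. exact: finite_measure_integrable_cst. Qed.

Lemma Rint_cst k : \int[P]_x k = k.
Proof.
rewrite Rintegral_cst//; have /= P1 := @probability_setT _ RR R P.
by rewrite [X in fine X]P1 mulr1.
Qed.

End probability_integral.

Section real_dominated_convergence.
Variable R : realType.
Notation RR := (measurableTypeR R).
Variable m : {sigma_finite_measure set RR -> \bar R}.

Lemma DCT_R (f_ : nat -> R -> R) (f g : R -> R) :
  (forall n, measurable_fun setT (f_ n)) ->
  (forall x, f_ n x @[n --> \oo] --> f x) -> intb m g ->
  (forall n x, `|f_ n x| <= g x) ->
  intb m f /\ \int[m]_x f_ n x @[n --> \oo] --> \int[m]_x f x.
Proof.
move=> mf_ cf ig fg.
have mf : measurable_fun setT f by exact: (measurable_fun_cvg (h := f_)).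
have h1 n : measurable_fun (setT : set RR) (EFin \o f_ n) by apply/measurable_EFinP; exact: mf_.
have h2 : measurable_fun (setT : set RR) (EFin \o f) by exact/measurable_EFinP.
have h3 : {ae m, forall x, (setT : set RR) x -> (EFin \o f_ n) x @[n --> \oo] --> (EFin \o f) x}.
  apply: aeW => x _; apply: cvg_EFin; first by near=> n.
  exact: cf.
have h4 : {ae m, forall x n, (setT : set RR) x -> (`|(EFin \o f_ n) x| <= (EFin \o g) x)%E}.
  by apply: aeW => x n _; rewrite /= lee_fin; exact: fg.
have [if_ _ h5] := dominated_convergence measurableT h1 h2 h3 ig h4.
split=> //; apply: fine_cvg; rewrite EFin_Rint//.
Unshelve. all: by end_near. Qed.

End real_dominated_convergence.

(** * Polynomial growth *)

Section polynomial_growth.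
Variable R : realType.

Definition wt (y : R) : R := 1 + `|y|.

(** A product, so that a bound by a power of [wt2] separates into a function of each variable. *)
Definition wt2 (q : R * R) : R := wt q.1 * wt q.2.

Lemma wt_ge1 y : 1 <= wt y. Proof. by rewrite /wt lerDl. Qed.

Lemma wt_ge0 y : 0 <= wt y. Proof. exact: le_trans (wt_ge1 y). Qed.

Lemma wt2_ge1 q : 1 <= wt2 q. Proof. by rewrite /wt2 mulr_ege1// wt_ge1. Qed.

(** With W >= 1, bounds of different degrees can be merged, so the class is stable under sums,
    products and substitution. Integrability under a law with all moments then follows from the
    shape of the integrand. *)
Definition pbound (T : Type) (W : T -> R) (F : T -> R) :=
  exists C d, 0 <= C /\ forall x, `|F x| <= C * W x ^+ d.

Section closure.
Variables (T : Type) (W : T -> R).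
Hypothesis W1 : forall x, 1 <= W x.
Implicit Types F G : T -> R.

Let W0 x : 0 <= W x. Proof. exact: le_trans (W1 x). Qed.

Lemma pbound_cst k : pbound W (fun=> k).
Proof.
exists `|k|, 0; split => // x; by rewrite expr0 mulr1.
Qed.

Lemma pbound_le F G : pbound W G -> (forall x, `|F x| <= `|G x|) -> pbound W F.
Proof. by move=> [C [d [C0 h]]] FG; exists C, d; split => // x; exact: le_trans (h x). Qed.

Lemma pboundN F : pbound W F -> pbound W (fun x => - F x).
Proof. by move=> h; apply: pbound_le h _ => x; rewrite normrN. Qed.

Lemma pbound_norm F : pbound W F -> pbound W (fun x => `|F x|).
Proof. by move=> h; apply: pbound_le h _ => x; rewrite normr_id. Qed.

Lemma pboundD F G : pbound W F -> pbound W G -> pbound W (fun x => F x + G x).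
Proof.
move=> [C [d [C0 hF]]] [D [e [D0 hG]]]; exists (C + D), (maxn d e); split.
  exact: addr_ge0.
move=> x; apply: (le_trans (ler_normD _ _)); rewrite mulrDl lerD//.
  apply: (le_trans (hF x)); rewrite ler_wpM2l// ler_weXn2l// leq_maxl//.
apply: (le_trans (hG x)); rewrite ler_wpM2l// ler_weXn2l// leq_maxr//.
Qed.

Lemma pboundB F G : pbound W F -> pbound W G -> pbound W (fun x => F x - G x).
Proof. by move=> hF hG; apply: pboundD => //; exact: pboundN. Qed.

Lemma pboundM F G : pbound W F -> pbound W G -> pbound W (fun x => F x * G x).
Proof.
move=> [C [d [C0 hF]]] [D [e [D0 hG]]]; exists (C * D), (d + e)%N; split.
  exact: mulr_ge0.
by move=> x; rewrite normrM exprD mulrACA ler_pM.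
Qed.

Lemma pboundX F n : pbound W F -> pbound W (fun x => F x ^+ n).
Proof.
move=> hF; elim: n => [|n IH]; first exact: pbound_cst.
by under eq_fun do rewrite exprS; exact: pboundM.
Qed.

Lemma pbound_comp F (f : R -> R) : pbound wt f -> pbound W F ->
  pbound W (fun x => f (F x)).
Proof.
move=> [C [d [C0 hf]]] [D [e [D0 hF]]].
exists (C * (1 + D) ^+ d), (e * d)%N; split.
  by rewrite mulr_ge0// exprn_ge0// addr_ge0.
move=> x; apply: (le_trans (hf _)); rewrite -mulrA ler_wpM2l// exprM -exprMn.
apply: lerXn2r; rewrite ?nnegrE ?wt_ge0//.
  by rewrite mulr_ge0// ?addr_ge0// exprn_ge0.
by rewrite /wt mulrDl mul1r lerD// exprn_ege1.
Qed.

End closure.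

Lemma pbound_id : pbound wt id.
Proof. by exists 1, 1; split => // x; rewrite mul1r expr1 /wt lerDr. Qed.

Lemma pbound_wt : pbound wt wt.
Proof. by exists 1, 1; split => // x; rewrite mul1r expr1 ger0_norm// wt_ge0. Qed.

Lemma pbound_fst (f : R -> R) : pbound wt f -> pbound wt2 (fun q => f q.1).
Proof.
move=> h; apply: (pbound_comp wt2_ge1 h).
exists 1, 1; split => // q; rewrite mul1r expr1 /wt2.
apply: (@le_trans _ _ (wt q.1 * 1)); first by rewrite mulr1 /wt lerDr.
by rewrite ler_wpM2l ?wt_ge0// wt_ge1.
Qed.

Lemma pbound_snd (f : R -> R) : pbound wt f -> pbound wt2 (fun q => f q.2).
Proof.
move=> h; apply: (pbound_comp wt2_ge1 h).
exists 1, 1; split => // q; rewrite mul1r expr1 /wt2.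
apply: (@le_trans _ _ (1 * wt q.2)); first by rewrite mul1r /wt lerDr.
by rewrite ler_wpM2r ?wt_ge0// wt_ge1.
Qed.

End polynomial_growth.

Ltac pbd := repeat first
  [ assumption | exact: wt_ge1 | exact: wt2_ge1
  | exact: pbound_cst | exact: pbound_id | exact: pbound_wt
  | exact: (pbound_fst (@pbound_id _)) | exact: (pbound_snd (@pbound_id _))
  | apply: pboundD | apply: pboundB | apply: pboundN | apply: pbound_norm | apply: pboundM | apply: pboundX
  | apply: pbound_fst | apply: pbound_snd ].

Section moments.
Variable R : realType.
Notation RR := (measurableTypeR R).

Definition moments (P : probability RR R) :=
  forall d, intb P (fun y => wt y ^+ d).

Definition exp_moment (P : probability RR R) :=
  exists2 eta : R, 0 < eta & (\int[P]_y (expR (eta * `|y|))%:E < +oo)%E.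

(** With [k] at most 1 and at most eta / (d + 1), 1 + x <= exp x gives k (1 + |y|) <= exp (eta |y| /
    (d + 1)), and the d-th power of the right side is at most exp (eta |y|). Dividing by d + 1
    rather than d covers d = 0. *)
Lemma wtX_le_expR d (eta : R) : 0 < eta ->
  exists2 C, 0 < C & forall y, wt y ^+ d <= C * expR (eta * `|y|).
Proof.
move=> eta0; pose k := Num.min 1 (eta / d.+1%:R).
have k0 : 0 < k by rewrite lt_min ltr01 divr_gt0.
exists (k ^- d); first by rewrite invr_gt0 exprn_gt0.
move=> y; rewrite ler_pdivlMl ?exprn_gt0// -exprMn.
apply: (@le_trans _ _ (expR (eta / d.+1%:R * `|y|) ^+ d)).
  apply: lerXn2r; rewrite ?nnegrE ?expR_ge0//.
    by rewrite mulr_ge0 ?wt_ge0// ltW.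
  apply: le_trans (expR_ge1Dx _); rewrite /wt mulrDr mulr1 lerD// ?ge_min ?lexx//.
  by rewrite ler_wpM2r// ge_min lexx orbT.
rewrite -expRM_natl ler_expR mulrA ler_wpM2r// mulrCA ler_piMr ?(ltW eta0)//.
by rewrite ler_pdivrMr// mul1r ler_nat.
Qed.

Lemma measurable_wtX d : measurable_fun setT (fun y : R => wt y ^+ d).
Proof. by rewrite /wt; mfun. Qed.

Lemma exp_moment_moments (P : probability RR R) : exp_moment P -> moments P.
Proof.
move=> [eta eta0 h] d; have [C C0 hC] := wtX_le_expR d eta0.
apply: (@intb_le _ _ _ (fun y => C * expR (eta * `|y|))).
- exact: measurable_wtX.
- by move=> y; rewrite ger0_norm// exprn_ge0 ?wt_ge0.
- apply: intbZ; apply: ge0_intb => //; by mfun.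
Qed.

Lemma integral_gam_kap (a : R) : (\int[gam R]_v (kap a v)%:E = 1)%E.
Proof.
transitivity (\int[gam R]_v ((kap a v)%:E * cst 1 v))%E.
  by apply: eq_integral => v _; rewrite mule1.
rewrite ge0_integral_gam_shift//= integral_cst// mul1e.
exact: (@probability_setT _ RR R (gam R)).
Qed.

(** The exponential of |v| is at most exp v + exp (- v), and these are exp (1/2) times the tilts
    [kap 1] and [kap (-1)], of integral 1. *)
Lemma gam_exp_lty : (\int[gam R]_v (expR (1 * `|v|))%:E < +oo)%E.
Proof.
apply: (@le_lt_trans _ _ (\int[gam R]_v ((expR (2^-1))%:E * ((kap 1 v)%:E + (kap (-1) v)%:E))))%E.
  apply: ge0_le_integral => //.
  - by apply/measurable_EFinP; mfun.
  - by apply/measurable_EFinP; rewrite /kap; mfun.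
  move=> v _; rewrite -EFinD -EFinM lee_fin mulrDr /kap -!expRD mul1r.
  rewrite (_ : 2^-1 + (1 * v - 1 ^+ 2 / 2) = v); last by field.
  rewrite (_ : 2^-1 + (-1 * v - (-1) ^+ 2 / 2) = - v); last by field.
  case: (ger0P v) => _; first by rewrite lerDl expR_ge0.
  by rewrite lerDr expR_ge0.
rewrite ge0_integralZl//; first last.
- by move=> x _; rewrite -EFinD lee_fin addr_ge0// kap_ge0.
- by apply/measurable_EFinP; rewrite /kap; mfun.
rewrite ge0_integralD//; first last.
- by apply/measurable_EFinP; exact: measurable_kap.
- by move=> x _; rewrite lee_fin kap_ge0.
- by apply/measurable_EFinP; exact: measurable_kap.
- by move=> x _; rewrite lee_fin kap_ge0.
by rewrite !integral_gam_kap -EFinD -EFinM ltry.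
Qed.

Lemma exp_moment_gam : exp_moment (gam R).
Proof. by exists 1 => //; exact: gam_exp_lty. Qed.

Lemma moments_gam : moments (gam R).
Proof. exact/exp_moment_moments/exp_moment_gam. Qed.

Lemma moments_intb (P : probability RR R) F : moments P -> measurable_fun setT F ->
  pbound (@wt R) F -> intb P F.
Proof.
move=> mP mF [C [d [C0 h]]]; apply: (intb_le mF h).
by apply: intbZ; exact: mP.
Qed.

End moments.

Section tilted_integrals.
Variable R : realType.
Notation RR := (measurableTypeR R).

Lemma wt_shift (v b : R) : wt (v + b) <= wt b * wt v.
Proof.
rewrite /wt mulrDl mul1r mulrDr mulr1.
have := ler_normD v b; have : 0 <= `|b| * `|v| by []; lra.
Qed.

(** Uniformity in [b] is the point: at a fixed output z the likelihood is a bounded function of the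
    input, hence integrable under any law. *)
Lemma kap_le (b z : R) : kap b z <= expR (z ^+ 2 / 2).
Proof. by rewrite ler_expR; have := sqr_ge0 (b - z); nra. Qed.

Lemma gam_tilt_int (b : R) F : measurable_fun setT F -> pbound (@wt R) F ->
  intb (gam R) (fun v => kap b v * F v).
Proof.
move=> mF [C [d [C0 h]]].
have mk := @measurable_kap R b.
apply: (@intb_le _ _ _ (fun v => C * (kap b v * wt v ^+ d))).
- exact: measurable_funM.
- move=> v; rewrite normrM ger0_norm ?kap_ge0// mulrCA ler_wpM2l ?kap_ge0//.
apply: intbZ; apply: ge0_intb.
- by apply: measurable_funM => //; exact: measurable_wtX.
- by move=> v; rewrite mulr_ge0 ?kap_ge0// exprn_ge0// wt_ge0.
under eq_integral do rewrite EFinM.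
rewrite (@ge0_integral_gam_shift R b (fun v => (wt v ^+ d)%:E))//; first last.
- by move=> v; rewrite lee_fin exprn_ge0// wt_ge0.
- by apply/measurable_EFinP; exact: measurable_wtX.
apply: intb_ltoo; first by move=> v; rewrite exprn_ge0// wt_ge0.
apply: (@intb_le _ _ _ (fun v => wt b ^+ d * wt v ^+ d)).
- by rewrite /wt; mfun.
- move=> v; rewrite ger0_norm ?exprn_ge0 ?wt_ge0// -exprMn.
  apply: lerXn2r; rewrite ?nnegrE ?mulr_ge0 ?wt_ge0//.
  exact: wt_shift.
- by apply: intbZ; exact: moments_gam.
Qed.

Lemma Rint_gam_shift (b : R) F : measurable_fun setT F -> pbound (@wt R) F ->
  \int[gam R]_v (kap b v * F v) = \int[gam R]_v F (v + b).
Proof.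
move=> mF pF.
have nn (G : R -> R) : measurable_fun setT G -> (forall v, 0 <= G v) ->
    \int[gam R]_v (kap b v * G v) = \int[gam R]_v G (v + b).
  move=> mG G0; rewrite /Rintegral; congr fine.
  under eq_integral do rewrite EFinM.
  rewrite (@ge0_integral_gam_shift R b (EFin \o G))//.
  exact/measurable_EFinP.
have [C [d [C0 h]]] := pF.
(* F is the difference of the nonnegative functions F + H and H, both of polynomial growth, so the
   formula for nonnegative integrands applies to each. *)
pose H v := C * wt v ^+ d.
have mH : measurable_fun setT H by rewrite /H/wt; mfun.
have pH : pbound (@wt R) H.
  by pbd.
have H0 v : 0 <= H v by rewrite mulr_ge0// exprn_ge0// wt_ge0.
have FH0 v : 0 <= F v + H v by have := h v; rewrite ler_norml /H; lra.
have mFH := measurable_funD mF mH.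
have pFH : pbound (@wt R) (F \+ H) by apply: pboundD; pbd.
have shint (G : R -> R) : measurable_fun setT G -> pbound (@wt R) G ->
    intb (gam R) (fun v => G (v + b)).
  move=> mG pG; apply: moments_intb; first exact: moments_gam.
  - by apply: measurableT_comp => //; mfun.
  - by apply: (pbound_comp _ pG); pbd.
transitivity (\int[gam R]_v (kap b v * (F v + H v) - kap b v * H v)).
  by apply: eq_Rint => v; ring.
transitivity (\int[gam R]_v ((F (v + b) + H (v + b)) - H (v + b))); last first.
  by apply: eq_Rint => v; ring.
rewrite !RintB; last 4 first.
- by apply: intbD; exact: shint.
- exact: shint.
- exact: (gam_tilt_int b mFH pFH).
- exact: gam_tilt_int.
by rewrite (nn _ mFH) ?nn.
Qed.

Variable P : probability RR R.
Hypothesis mP : moments P.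

Lemma P_tilt_int (a z : R) f : measurable_fun setT f -> pbound (@wt R) f ->
  intb P (fun y => kap (a * y) z * f y).
Proof.
move=> mf pf; have pf' : pbound (@wt R) (fun y => `|f y|).
  by apply: (pbound_le pf) => x; rewrite normr_id.
apply: (@intb_le _ _ _ (fun y => expR (z ^+ 2 / 2) * `|f y|)).
- by rewrite /kap; mfun.
- by move=> y; rewrite normrM ger0_norm ?kap_ge0// ler_wpM2r// kap_le.
- apply: intbZ; apply: moments_intb => //.
  exact: measurableT_comp.
Qed.

Lemma mfun2_kap (a : R) : mfun2 (fun y v => kap (a * y) v).
Proof. by rewrite /mfun2 /kap; mfun. Qed.

(** After translation by a y, the inner integral of wt v ^ d is at most wt (a y) ^ d times a
    Gaussian moment [M]. The bound [A] left for the outer integral has polynomial growth in y, so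
    the moments of [P] suffice. *)
Lemma tilt_int2 (a : R) F : mfun2 F -> pbound (@wt2 R) (fun q => F q.1 q.2) ->
  int2 P (gam R) (fun y v => kap (a * y) v * F y v).
Proof.
move=> mF [C [d [C0 h]]].
have mK : mfun2 (fun y v => kap (a * y) v * F y v).
  by apply: measurable_funM => //; exact: mfun2_kap.
have mK' : mfun2 (fun y v => (kap (a * y) v * F y v)%:E) by exact/measurable_EFinP.
apply/(@integrable12ltyP _ _ RR RR) => //.
have M0 : 0 <= \int[gam R]_v (wt v ^+ d).
  by apply: Rintegral_ge0 => v _; rewrite exprn_ge0// wt_ge0.
have wd0 (v : R) : 0 <= wt v ^+ d by rewrite exprn_ge0// wt_ge0.
set M := \int[gam R]_v (wt v ^+ d) in M0.
pose A (y : R) := C * M * (wt y ^+ d * wt (a * y) ^+ d).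
have mA : measurable_fun setT A by rewrite /A /wt; mfun.
have A0 y : 0 <= A y by rewrite !mulr_ge0.
apply: (@le_lt_trans _ _ (\int[P]_y (A y)%:E)%E); last first.
  apply: intb_ltoo => //; apply: moments_intb => //.
  have pw := @pbound_wt R.
  apply: pboundM; first by pbd.
  apply: pboundM; first by pbd.
  by apply: pboundX; apply: (pbound_comp _ pw); pbd.
apply: ge0_le_integral => //.
- by move=> y _; exact: integral_ge0.
- apply: (@measurable_tonelli _ (gam R) (fun y v => `|(kap (a * y) v * F y v)%:E|%E)) => //.
  exact: measurableT_comp.
- exact/measurable_EFinP.
move=> y _ /=.
apply: (@le_trans _ _ (\int[gam R]_v ((C * wt y ^+ d)%:E * ((kap (a * y) v)%:E * (wt v ^+ d)%:E)))%E).
  apply: ge0_le_integral => //.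
  - have mKy : measurable_fun (setT : set R) (fun v => kap (a * y) v * F y v) := mfun2_r y mK.
    by apply/measurable_EFinP; exact: (measurableT_comp (@normr_measurable _ _) mKy).
  - by apply/measurable_EFinP; rewrite /kap /wt; mfun.
  move=> v _; rewrite -!EFinM lee_fin normrM ger0_norm ?kap_ge0//.
  rewrite mulrCA ler_wpM2l ?kap_ge0//.
  by have := h (y, v); rewrite /wt2 /= exprMn mulrA.
rewrite ge0_integralZl//; first last.
- by rewrite lee_fin mulr_ge0.
- by move=> v _; rewrite -EFinM lee_fin mulr_ge0// kap_ge0.
- by apply/measurable_EFinP; rewrite /kap /wt; mfun.
rewrite (@ge0_integral_gam_shift R (a * y) (fun v => (wt v ^+ d)%:E))//; first last.
- by apply/measurable_EFinP; exact: measurable_wtX.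
rewrite (_ : A y = (C * wt y ^+ d) * (wt (a * y) ^+ d * M)); last by rewrite /A; ring.
rewrite [in leRHS]EFinM; apply: lee_wpmul2l; first by rewrite lee_fin mulr_ge0.
rewrite [in leRHS]EFinM /M EFin_Rint; last exact: moments_gam.
rewrite -ge0_integralZl//; first last.
- by rewrite lee_fin.
- by move=> v _; rewrite lee_fin.
- by apply/measurable_EFinP; exact: measurable_wtX.
apply: ge0_le_integral => //.
- by move=> v _; rewrite lee_fin exprn_ge0// wt_ge0.
- by apply/measurable_EFinP; rewrite /wt; mfun.
- by apply/measurable_EFinP; rewrite /wt; mfun.
move=> v _; rewrite -EFinM lee_fin -exprMn.
by apply: lerXn2r; rewrite ?nnegrE ?mulr_ge0 ?wt_ge0// wt_shift.
Qed.

End tilted_integrals.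

(** * Mean and variance of N(0,1) *)

Section gaussian_moments.
Variable R : realType.
Notation RR := (measurableTypeR R).
Notation mu := (@lebesgue_measure R).

Lemma gam_intb f : measurable_fun setT f -> pbound (@wt R) f -> intb (gam R) f.
Proof. by apply: moments_intb; exact: moments_gam. Qed.

Lemma gam_int_kap (k : R) : \int[gam R]_v kap k v = 1.
Proof. by rewrite /Rintegral integral_gam_kap. Qed.

Lemma gam_kap_intb (k : R) : intb (gam R) (kap k).
Proof.
have m1 : measurable_fun (setT : set R) (fun=> 1 : R) by [].
have h := gam_tilt_int k m1 (@pbound_cst _ _ (@wt R) 1).
by apply: eq_intb h => y /=; rewrite mulr1.
Qed.

(** Integrating 1 + b s v <= exp (b s v) gives 1 + b E <= exp (b^2 / 2) <= 1 / (1 - b^2 / 2), with E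
    the mean of s v. Hence E <= b, and b can be taken arbitrarily small. *)
Let mean_le (s : R) : `|s| = 1 -> \int[gam R]_v (s * v) <= 0.
Proof.
move=> s1; apply/ler_addgt0Pr => e e0; rewrite add0r.
pose b := Num.min 1 e.
have b0 : 0 < b by rewrite lt_min ltr01.
have b1 : b <= 1 by rewrite ge_min lexx.
have be : b <= e by rewrite ge_min lexx orbT.
have ii : intb (gam R) (fun v => s * v) by apply: gam_intb; [mfun|pbd].
have ik := gam_kap_intb (s * b).
have H : \int[gam R]_v (1 + b * (s * v)) <= \int[gam R]_v (expR (b ^+ 2 / 2) * kap (s * b) v).
  apply: le_Rint.
  - by apply: intbD; [exact: intb_cst|exact: intbZ].
  - exact: intbZ.
  - move=> v; rewrite /kap -expRD.
    have -> : (s * b) ^+ 2 = b ^+ 2.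
      by rewrite exprMn -(real_normK (num_real s)) s1 expr1n mul1r.
    apply: le_trans (expR_ge1Dx _) _; rewrite ler_expR; lra.
move: H; rewrite RintD//; [|exact: intb_cst|exact: intbZ].
rewrite Rint_cst (RintZ b ii) (RintZ _ ik) gam_int_kap mulr1; move: (\int[gam R]_v (s * v)) => E.
have x1 : b ^+ 2 / 2 <= 2^-1.
  by rewrite ler_pdivrMr// mulVf// expr_le1// ltW.
have h : expR (b ^+ 2 / 2) * (1 - b ^+ 2 / 2) <= 1.
  rewrite -ler_pdivlMl ?expR_gt0// mulr1 -expRN.
  by apply: le_trans (expR_ge1Dx _); lra.
move=> H; have : (1 + b * E) * (1 - b ^+ 2 / 2) <= 1.
  by apply: le_trans h; rewrite ler_wpM2r//; lra.
move=> {}H; apply: le_trans be; rewrite -(ler_pM2l b0).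
by nra.
Qed.

Lemma gam_mean : \int[gam R]_v v = 0.
Proof.
apply/eqP; rewrite eq_le; apply/andP; split.
  have := @mean_le 1; rewrite normr1 => /(_ erefl); congr (_ <= _).
  by apply: eq_Rint => v; rewrite mul1r.
have := @mean_le (-1); rewrite normrN1 => /(_ erefl).
rewrite RintZ ?mulN1r ?oppr_le0//.
by apply: gam_intb; [mfun|pbd].
Qed.

(* Tangent line at alpha = 1 of alpha |-> \int exp (- alpha^2 x^2 / 2) = sqrt (2 pi) / alpha. *)
Lemma gam_var_le : \int[gam R]_v (v ^+ 2) <= 1.
Proof.
set M := Rintegral _ _ _; rewrite leNgt; apply/negP => M1.
(* The tangent inequality at [al] < 1 is violated as soon as (1 + al) al M > 2. The midpoint of 1/M
   and 1 satisfies this: the condition becomes (3 M - 1) (M - 1) > 0. *)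
pose al := (1 + M) / (2 * M).
have al0 : 0 < al by rewrite divr_gt0//; lra.
have al1 : al < 1 by rewrite ltr_pdivrMr; lra.
have i2 : intb (gam R) (fun v => v ^+ 2) by apply: gam_intb; [mfun|pbd].
have i3 : intb (gam R) (fun v => 1 + (1 - al ^+ 2) / 2 * v ^+ 2).
  by apply: intbD; [exact: intb_cst|exact: intbZ].
have H : 1 + (1 - al ^+ 2) / 2 * M <= al^-1.
  have -> : 1 + (1 - al ^+ 2) / 2 * M = \int[gam R]_v (1 + (1 - al ^+ 2) / 2 * v ^+ 2).
    by rewrite RintD//; [rewrite Rint_cst RintZ|exact: intb_cst|exact: intbZ].
  rewrite -lee_fin EFin_Rint// ge0_integral_dens; first last.
  - move=> v; rewrite lee_fin addr_ge0// mulr_ge0 ?sqr_ge0// divr_ge0// subr_ge0.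
    by rewrite expr_le1// ltW.
  - by apply/measurable_EFinP; mfun.
  have := integral_gauss_affine 0 al0 => <-.
  apply: ge0_le_integral => //.
  - move=> v _; rewrite -EFinM lee_fin mulr_ge0 ?gauss_ge0// addr_ge0// mulr_ge0 ?sqr_ge0// divr_ge0// subr_ge0.
    by rewrite expr_le1// ltW.
  - by apply/measurable_EFinP; mfun.
  - by apply/measurable_EFinP; mfun.
  move=> v _; rewrite -EFinM lee_fin addr0 /gauss mulrA ler_wpM2r ?invr_ge0 ?sqrtr_ge0//.
  rewrite (_ : - ((al * v) ^+ 2) / 2 = (1 - al ^+ 2) / 2 * v ^+ 2 + - v ^+ 2 / 2); last by field.
  by rewrite expRD ler_wpM2r ?expR_ge0// expR_ge1Dx.
move: H; rewrite -(ler_pM2l al0) divff ?gt_eqF// leNgt => /negP; apply.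
have eM : al * (2 * M) = 1 + M by rewrite divfK// gt_eqF//; lra.
have : 0 < (1 - al) * ((1 + al) * al * M - 2).
  apply: mulr_gt0; first by lra.
  by nra.
by nra.
Qed.

Lemma gam_int_kapv (k : R) : \int[gam R]_v (kap k v * v) = k.
Proof.
rewrite Rint_gam_shift; [|mfun|pbd].
rewrite RintD; [|by apply: gam_intb; [mfun|pbd]|exact: intb_cst].
by rewrite gam_mean Rint_cst add0r.
Qed.

End gaussian_moments.

(** * The law of the channel output *)

Section likelihood.
Variable R : realType.
Notation RR := (measurableTypeR R).
Variable P : probability RR R.
Hypothesis mP : moments P.

(* [Lam c] is the density of c Y + N with respect to the law of N, and
   [Mn c z] is the conditional expectation of Y given c Y + N = z. *)
Definition Lam (c z : R) : R := \int[P]_y kap (c * y) z.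
Definition Lam1 (c z : R) : R := \int[P]_y (kap (c * y) z * y).
Definition Mn (c z : R) : R := Lam1 c z * expR (- ln (Lam c z)).

Lemma kap_int c z : intb P (fun y => kap (c * y) z).
Proof.
have m1 : measurable_fun (setT : set R) (fun=> 1 : R) by [].
have h := P_tilt_int mP c z m1 (@pbound_cst _ _ (@wt R) 1).
by apply: eq_intb h => y /=; rewrite mulr1.
Qed.

Lemma kapy_int c z : intb P (fun y => kap (c * y) z * y).
Proof. by apply: (P_tilt_int mP c z (@measurable_id _ _ setT)); pbd. Qed.

Lemma y_int : intb P id.
Proof. by apply: moments_intb => //; pbd. Qed.

Lemma ysqr_int : intb P (fun y => y ^+ 2).
Proof. by apply: moments_intb => //; pbd. Qed.

Definition mom1 := \int[P]_y y.
Definition mom2 := \int[P]_y y ^+ 2.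

(** Jensen's inequality for the exponential, from its tangent at the mean [b] of the exponent of
    [kap (c * y) z]. Together with [Lam_le] it puts ln [Lam] between two quadratic functions of
    z. *)
Lemma Lam_ge c z : expR (c * z * mom1 - c ^+ 2 / 2 * mom2) <= Lam c z.
Proof.
set b := _ - _.
have i1 := intbZ (c * z) y_int; have i2 := intbZ (c ^+ 2 / 2) ysqr_int.
have i3 := intbB i1 i2.
apply: (@le_trans _ _ (\int[P]_y (expR b * ((1 - b) + (c * z * y - c ^+ 2 / 2 * y ^+ 2))))).
  rewrite RintZ; last exact: intbD (intb_cst _ _) i3.
  rewrite RintD//; last exact: intb_cst.
  rewrite Rint_cst RintB// !RintZ//; [|exact: ysqr_int|exact: y_int].
  by rewrite -/mom1 -/mom2 -/b subrK mulr1.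
apply: le_Rint.
- exact: intbZ (intbD (intb_cst _ _) i3).
- exact: kap_int.
move=> y; rewrite /kap (_ : c * y * z - (c * y) ^+ 2 / 2 = b + (c * z * y - c ^+ 2 / 2 * y ^+ 2 - b)); last by ring.
rewrite (expRD b (_ - b)) ler_wpM2l ?expR_ge0//.
by apply: le_trans (expR_ge1Dx _); lra.
Qed.

Lemma Lam_gt0 c z : 0 < Lam c z.
Proof. by apply: lt_le_trans (Lam_ge c z); exact: expR_gt0. Qed.

Lemma Lam_le c z : Lam c z <= expR (z ^+ 2 / 2).
Proof.
rewrite -(Rint_cst P (expR _)); apply: le_Rint.
- exact: kap_int.
- exact: intb_cst.
- by move=> y; exact: kap_le.
Qed.

(** [Mn] divides through [expR (- ln _)], whose measurability is immediate by composition;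
    positivity of [Lam] makes this the ordinary quotient. *)
Lemma MnE c z : Mn c z = Lam1 c z / Lam c z.
Proof. by rewrite /Mn expRN lnK// posrE Lam_gt0. Qed.

Lemma Mn_Lam c z : Mn c z * Lam c z = Lam1 c z.
Proof. by rewrite MnE divfK// gt_eqF// Lam_gt0. Qed.

Lemma measurable_Lam c : measurable_fun setT (Lam c).
Proof.
apply: (@measurable_Rint _ P (fun z y => kap (c * y) z)).
by rewrite /mfun2/kap; mfun.
Qed.

Lemma measurable_Lam1 c : measurable_fun setT (Lam1 c).
Proof.
apply: (@measurable_Rint _ P (fun z y => kap (c * y) z * y)).
by rewrite /mfun2/kap; mfun.
Qed.

Lemma measurable_lnLam c : measurable_fun setT (fun z => ln (Lam c z)).
Proof. exact: measurableT_comp (measurable_Lam c). Qed.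

Lemma measurable_Mn c : measurable_fun setT (Mn c).
Proof.
have := measurable_Lam1 c; have := measurable_lnLam c => m1 m2.
by apply: measurable_funM => //; apply: measurableT_comp => //; apply: measurable_funN.
Qed.

Lemma pbound_lnLam c : pbound (@wt R) (fun z => ln (Lam c z)).
Proof.
have pa : pbound (@wt R) (fun z => `|z ^+ 2 / 2| + `|c * z * mom1 - c ^+ 2 / 2 * mom2|).
  by pbd.
apply: (pbound_le pa) => z.
have h1 : ln (Lam c z) <= z ^+ 2 / 2.
  by rewrite -[leRHS]expRK ler_ln ?posrE ?Lam_gt0 ?expR_gt0// Lam_le.
have h2 : c * z * mom1 - c ^+ 2 / 2 * mom2 <= ln (Lam c z).
  by rewrite -[leLHS]expRK ler_ln ?posrE ?Lam_gt0 ?expR_gt0// Lam_ge.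
rewrite [leRHS]ger0_norm; last by rewrite addr_ge0.
rewrite ler_norml; apply/andP; split.
  by have := ler_norm (- (c * z * mom1 - c ^+ 2 / 2 * mom2)); rewrite normrN; have := normr_ge0 (z ^+ 2 / 2); lra.
by have := ler_norm (z ^+ 2 / 2); have := normr_ge0 (c * z * mom1 - c ^+ 2 / 2 * mom2); lra.
Qed.

(* Convexity of [ln (Lam c)], whose derivative is [c * Mn c]. *)
Lemma lnLam_tangent c z z' :
  ln (Lam c z) + c * (z' - z) * Mn c z <= ln (Lam c z').
Proof.
set b := c * _ * _.
rewrite -[leLHS]expRK ler_ln ?posrE ?Lam_gt0 ?expR_gt0// expRD lnK ?posrE ?Lam_gt0//.
rewrite mulrC.
have i0 := kap_int c z; have i1 := kapy_int c z.
have -> : expR b * Lam c z = \int[P]_y (expR b * ((1 - b) * kap (c * y) z + c * (z' - z) * (kap (c * y) z * y))).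
  rewrite RintZ; last by apply: intbD; exact: intbZ.
  rewrite RintD; [|exact: intbZ..]; rewrite !RintZ//.
  rewrite -/(Lam c z) -/(Lam1 c z) -Mn_Lam mulrA -/b; congr (_ * _); ring.
apply: le_Rint.
- by apply: intbZ; apply: intbD; exact: intbZ.
- exact: kap_int.
move=> y.
have -> : kap (c * y) z' = kap (c * y) z * expR (c * (z' - z) * y).
  by rewrite /kap -expRD; congr expR; ring.
have -> : expR b * ((1 - b) * kap (c * y) z + c * (z' - z) * (kap (c * y) z * y)) =
  kap (c * y) z * (expR b * (1 + (c * (z' - z) * y - b))) by ring.
have -> : expR (c * (z' - z) * y) = expR b * expR (c * (z' - z) * y - b).
  by rewrite -(expRD b); congr expR; ring.
by rewrite ler_wpM2l ?kap_ge0// ler_wpM2l ?expR_ge0// expR_ge1Dx.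
Qed.

(** The slope c Mn(z) of the convex function ln [Lam] lies between its increments over [z - 1, z]
    and [z, z + 1], and ln [Lam] has polynomial growth. *)
Lemma pbound_Mn c : 0 < c -> pbound (@wt R) (Mn c).
Proof.
move=> c0; have pl := pbound_lnLam c.
pose F z := c^-1 * (`|ln (Lam c (z + 1))| + `|ln (Lam c (z - 1))| + `|ln (Lam c z)|).
have pF : pbound (@wt R) F.
  apply: pboundM; first by pbd.
  apply: pboundD; [pbd| |exact: pbound_norm].
  by apply: pboundD; [pbd| |]; apply: pbound_norm; apply: (pbound_comp _ pl); pbd.
apply: (pbound_le pF) => z.
rewrite [leRHS]ger0_norm; last by rewrite mulr_ge0 ?addr_ge0// invr_ge0 ltW.
rewrite ler_pdivlMl// -[X in X * _](gtr0_norm c0) -normrM.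
have := lnLam_tangent c z (z + 1); have := lnLam_tangent c z (z - 1).
rewrite (_ : z - 1 - z = -1); last by ring.
rewrite (_ : z + 1 - z = 1); last by ring.
move: (Mn c z) (ln (Lam c (z + 1))) (ln (Lam c (z - 1))) (ln (Lam c z)) => k l1 l2 l0.
have := ler_norm l1; have := ler_norm l2; have := ler_norm (- l0); rewrite normrN.
have := normr_ge0 l1; have := normr_ge0 l2.
by rewrite ler_norml => *; apply/andP; split; lra.
Qed.

End likelihood.

(** A convex function lies above its tangent at b. Integrated with a suitable b, this replaces
    Jensen's inequality in all the relative entropy estimates. *)
Lemma xlnx_tangent (R : realType) (x b : R) : 0 < x -> 0 < b ->
  x * ln b + x - b <= x * ln x.
Proof.
move=> x0 b0; have bx : 0 < b / x by rewrite divr_gt0.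
have : ln (b / x) <= b / x - 1.
  have := @le_ln1Dx R (b / x - 1); rewrite addrCA subrr addr0; apply; lra.
rewrite ln_div ?posrE// -(ler_pM2l x0) !mulrBr mulrCA divff ?gt_eqF// !mulr1.
by lra.
Qed.

(** * The I-MMSE relation *)

Section increment.
Variable R : realType.
Notation RR := (measurableTypeR R).
Variable P : probability RR R.
Hypothesis mP : moments P.
Variables (a b c : R).
Hypotheses (a0 : 0 < a) (b0 : 0 < b) (c0 : 0 < c) (abc : c ^+ 2 = a ^+ 2 + b ^+ 2).
Variable u : R.

Let zeta v := (a * u + b * v) / c.

(** Two independent observations a Y + N = u and b Y + N' = v carry the same information on Y as
    their combination [zeta v], which is again of the form c Y + Gaussian of variance 1. *)
Lemma kap_split y v : kap (a * y) u * kap (b * y) v = kap (c * y) (zeta v).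
Proof.
rewrite /kap -expRD /zeta; congr expR.
rewrite !exprMn abc; field; rewrite gt_eqF//.
Qed.

Lemma pbound_kap : pbound (@wt R) (fun y => kap (a * y) u).
Proof.
exists (expR (u ^+ 2 / 2)), 0; split; first exact: expR_ge0.
by move=> y; rewrite expr0 mulr1 ger0_norm ?kap_ge0// kap_le.
Qed.

Lemma measurable_kapl : measurable_fun setT (fun y : R => kap (a * y) u).
Proof. by rewrite /kap; mfun. Qed.

Lemma measurable_zeta : measurable_fun setT zeta.
Proof. by rewrite /zeta; mfun. Qed.

Lemma pbound_zeta : pbound (@wt R) zeta.
Proof. by rewrite /zeta; pbd. Qed.

Section one_function.
Variable F : R -> R -> R.
Hypotheses (mF : mfun2 F) (pF : pbound (@wt2 R) (fun q => F q.1 q.2)).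

Lemma step_int2 : int2 P (gam R) (fun y v => kap (c * y) (zeta v) * F y v).
Proof.
have mF' : mfun2 (fun y v => kap (a * y) u * F y v).
  by apply: measurable_funM => //; exact: (mfun2_fst measurable_kapl).
have pF' : pbound (@wt2 R) (fun q => kap (a * q.1) u * F q.1 q.2).
  by apply: pboundM => //; exact: (pbound_fst pbound_kap).
apply: eq_integrable (tilt_int2 mP b mF' pF') => // -[y v] _ /=.
by rewrite mulrA (mulrC (kap (b * y) v)) kap_split.
Qed.

Lemma pbound_sectl y : pbound (@wt R) (F y).
Proof.
have [C [d [C0 h]]] := pF; exists (C * wt y ^+ d), d; split.
  by rewrite mulr_ge0// exprn_ge0 ?wt_ge0.
by move=> v; have := h (y, v); rewrite /wt2/= exprMn mulrA.
Qed.

Lemma pbound_sectr v : pbound (@wt R) (F ^~ v).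
Proof.
have [C [d [C0 h]]] := pF; exists (C * wt v ^+ d), d; split.
  by rewrite mulr_ge0// exprn_ge0 ?wt_ge0.
by move=> y; rewrite mulrAC -mulrA -exprMn; exact: (h (y, v)).
Qed.

Lemma step_intl y : intb (gam R) (fun v => kap (c * y) (zeta v) * F y v).
Proof.
have h := gam_tilt_int (b * y) (mfun2_r y mF) (pbound_sectl y).
have := intbZ (kap (a * y) u) h; apply: eq_intb => v /=.
by rewrite mulrA kap_split.
Qed.

Lemma step_intr v : intb P (fun y => kap (c * y) (zeta v) * F y v).
Proof. exact: (P_tilt_int mP c (zeta v) (mfun2_l v mF) (pbound_sectr v)). Qed.

Lemma step_Fubini :
  \int[gam R]_v \int[P]_y (kap (c * y) (zeta v) * F y v) =
  \int[P]_y (kap (a * y) u * \int[gam R]_v (kap (b * y) v * F y v)).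
Proof.
rewrite -(FubiniR step_int2 step_intl step_intr).
apply: eq_Rint => y; rewrite -RintZ; last first.
  exact: (gam_tilt_int (b * y) (mfun2_r y mF) (pbound_sectl y)).
by apply: eq_Rint => v; rewrite mulrA kap_split.
Qed.

Lemma step_intl_P :
  intb P (fun y => kap (a * y) u * \int[gam R]_v (kap (b * y) v * F y v)).
Proof.
have := int2_l step_int2 step_intl; apply: eq_intb => y /=.
rewrite -RintZ; last first.
  exact: (gam_tilt_int (b * y) (mfun2_r y mF) (pbound_sectl y)).
by apply: eq_Rint => v; rewrite mulrA kap_split.
Qed.

Lemma step_intr_gam :
  intb (gam R) (fun v => \int[P]_y (kap (c * y) (zeta v) * F y v)).
Proof. exact: int2_r step_int2 step_intr. Qed.

End one_function.

(** Everything is conditioned on the first observation u: [A] is its likelihood, [m] the conditional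
    mean of Y and [N] = A m. [L] and [K] are the log-likelihood and the conditional mean once v is
    observed too. *)
Let A := Lam P a u.
Let N := Lam1 P a u.
Let m := Mn P a u.
Let L v := ln (Lam P c (zeta v)).
Let K v := Mn P c (zeta v).

Let A0 : 0 < A. Proof. exact: Lam_gt0. Qed.

Let mL : measurable_fun setT L.
Proof. exact: (measurableT_comp (measurable_lnLam P c) measurable_zeta). Qed.

Let pL : pbound (@wt R) L.
Proof. exact: (pbound_comp (@wt_ge1 R) (pbound_lnLam mP c) pbound_zeta). Qed.

Let mK : measurable_fun setT K.
Proof. exact: (measurableT_comp (measurable_Mn P c) measurable_zeta). Qed.

Let pK : pbound (@wt R) K.
Proof. exact: (pbound_comp (@wt_ge1 R) (pbound_Mn mP c0) pbound_zeta). Qed.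

Lemma step_Lam_int h : measurable_fun setT h -> pbound (@wt R) h ->
  intb (gam R) (fun v => Lam P c (zeta v) * h v).
Proof.
move=> mh ph; have := step_intr_gam (mfun2_snd mh) (pbound_snd ph).
apply: eq_intb => v; rewrite mulrC -RintZ; last exact: kap_int.
by apply: eq_Rint => y; rewrite mulrC.
Qed.

Lemma step_Lam1_int h : measurable_fun setT h -> pbound (@wt R) h ->
  intb (gam R) (fun v => Lam1 P c (zeta v) * h v).
Proof.
move=> mh ph.
have my : mfun2 (fun y v : R => y * h v).
  by apply: measurable_funM; [exact: measurable_fst|exact: (mfun2_snd mh)].
have py : pbound (@wt2 R) (fun q => q.1 * h q.2).
  by apply: pboundM; [pbd|exact: pbound_snd].
apply: eq_intb (step_intr_gam my py) => v.
by rewrite mulrC -RintZ; [apply: eq_Rint => y; ring|exact: kapy_int].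
Qed.

(** The factor [kap (b * y) v] has Gaussian mean 1 for each y, so averaging over the second
    observation leaves the likelihood of the first. *)
Lemma step_mean f : measurable_fun setT f -> pbound (@wt R) f ->
  \int[gam R]_v \int[P]_y (kap (c * y) (zeta v) * f y) =
  \int[P]_y (kap (a * y) u * f y).
Proof.
move=> mf pf; rewrite (step_Fubini (mfun2_fst mf) (pbound_fst pf)).
apply: eq_Rint => y; congr (_ * _).
rewrite -[RHS]mulr1 -(gam_int_kap (b * y)) -RintZ; last exact: gam_kap_intb.
by apply: eq_Rint => v; rewrite mulrC.
Qed.

Lemma step_Lam : \int[gam R]_v Lam P c (zeta v) = A.
Proof.
have m1 : measurable_fun (setT : set R) (fun=> 1 : R) by [].
have h := step_mean m1 (@pbound_cst _ _ (@wt R) 1).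
apply: (etrans _ (etrans h _)); apply: eq_Rint => v; last by rewrite mulr1.
by apply: eq_Rint => y; rewrite mulr1.
Qed.

Lemma step_Lam1 : \int[gam R]_v Lam1 P c (zeta v) = N.
Proof.
by rewrite (step_mean (@measurable_id _ _ setT) (@pbound_id R)).
Qed.

Lemma step_Lam_id : \int[gam R]_v (Lam P c (zeta v) * v) = b * N.
Proof.
have mi := @measurable_id _ R setT.
have := step_Fubini (mfun2_snd mi) (pbound_snd (@pbound_id R)).
transitivity (\int[gam R]_v \int[P]_y (kap (c * y) (zeta v) * v)).
  apply: eq_Rint => v; rewrite mulrC -RintZ; last exact: kap_int.
  by apply: eq_Rint => y; rewrite mulrC.
rewrite H /N /Lam1 -RintZ; last exact: kapy_int.
by apply: eq_Rint => y; rewrite gam_int_kapv; ring.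
Qed.

(** Given u, the second observation has density Lam / A. Its relative entropy with respect to N(b m,
    1), the Gaussian with the same mean, is nonnegative: this is the tangent of x ln x at A
    [kap (b * m) v]. Here N^2 / A = A m^2. *)
Lemma step_ge : A * ln A + b ^+ 2 / 2 * (N ^+ 2 / A) <=
  \int[gam R]_v (Lam P c (zeta v) * L v).
Proof.
have mi := @measurable_id _ R setT.
have m1 : measurable_fun (setT : set R) (fun=> 1 : R) by [].
have iL : intb (gam R) (fun v => Lam P c (zeta v)).
  have h := step_Lam_int m1 (@pbound_cst _ _ (@wt R) 1).
  by apply: eq_intb h => v /=; rewrite mulr1.
have iLv := step_Lam_int mi (@pbound_id R).
have ik := gam_kap_intb (b * m).
have E : \int[gam R]_v ((((ln A - (b * m) ^+ 2 / 2 + 1) * Lam P c (zeta v)) +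
      (b * m) * (Lam P c (zeta v) * v)) - A * kap (b * m) v) =
   A * ln A + b ^+ 2 / 2 * (N ^+ 2 / A).
  rewrite RintB; [|by apply: intbD; exact: intbZ|exact: intbZ].
  rewrite RintD; [|exact: intbZ..].
  rewrite (RintZ _ iL) (RintZ _ iLv) (RintZ _ ik) step_Lam step_Lam_id gam_int_kap.
  rewrite /m MnE// -/A -/N; field; by rewrite gt_eqF.
rewrite -E; apply: le_Rint.
- by apply: intbB; [apply: intbD; exact: intbZ|exact: intbZ].
- exact: step_Lam_int.
move=> v.
have k0 := kap_gt0 (b * m) v.
have := @xlnx_tangent R (Lam P c (zeta v)) (A * kap (b * m) v) (Lam_gt0 mP _ _) _.
rewrite lnM ?posrE// {2}/kap expRK => /(_ (mulr_gt0 A0 k0)).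
by rewrite /L; apply: le_trans; rewrite le_eqVlt; apply/orP; left; apply/eqP; ring.
Qed.

(** [Q y] is the mean of [L] when v has law N(b y, 1), so the left side is the integral of Q against
    the likelihood of u. Convexity compares Q y with Q m, Jensen bounds Q m by ln A + (b m)^2 / 2,
    and the remaining term (y - m) K averages to the integral of Lam1 K minus m N. *)
Lemma step_le : \int[gam R]_v (Lam P c (zeta v) * L v) <=
  A * ln A + b ^+ 2 * \int[gam R]_v (Lam1 P c (zeta v) * K v) - b ^+ 2 / 2 * (N ^+ 2 / A).
Proof.
have mLi : mfun2 (fun _ v : R => L v) by exact: mfun2_snd.
have pLi : pbound (@wt2 R) (fun q => L q.2) by exact: pbound_snd.
have shint G k : measurable_fun setT G -> pbound (@wt R) G ->
    intb (gam R) (fun v => G (v + k)).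
  move=> mG pG; apply: gam_intb.
  - by apply: measurableT_comp => //; mfun.
  - by apply: (pbound_comp _ pG); pbd.
pose Q y := \int[gam R]_v (kap (b * y) v * L v).
pose S y := \int[gam R]_v (kap (b * y) v * K v).
(* The tangent of ln [Lam] at [zeta (v + b * y)], evaluated at [zeta (v + b * m)] and averaged over
   v. *)
have Qle y : Q y <= Q m + b ^+ 2 * ((y - m) * S y).
  rewrite /Q /S !Rint_gam_shift// mulrA -RintZ; last exact: shint.
  rewrite -RintD; [|exact: shint|by apply: intbZ; exact: shint].
  apply: le_Rint.
  - exact: shint.
  - by apply: intbD; [exact: shint|apply: intbZ; exact: shint].
  move=> v; have := lnLam_tangent mP c (zeta (v + b * y)) (zeta (v + b * m)).
  rewrite (_ : c * (zeta (v + b * m) - zeta (v + b * y)) = b ^+ 2 * (m - y)); last first.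
    by rewrite /zeta; field; rewrite gt_eqF.
  rewrite -/(L _) -/(L _) -/(K _); move: (L _) (L _) (K _) => l1 l2 k.
  rewrite !mulrBr !mulrBl; lra.
have m1 : measurable_fun (setT : set R) (fun=> 1 : R) by [].
have iL : intb (gam R) (fun v => Lam P c (zeta v)).
  have h := step_Lam_int m1 (@pbound_cst _ _ (@wt R) 1).
  by apply: eq_intb h => v /=; rewrite mulr1.
(* Gibbs' inequality for N(b m, 1) against the conditional law of v given u; the roles are reversed
   with respect to [step_ge]. *)
have Qm : Q m <= ln A + (b * m) ^+ 2 / 2.
  have ik := gam_kap_intb (b * m).
  have ikv := gam_tilt_int (b * m) (@measurable_id _ _ setT) (@pbound_id R).
  have ikL := gam_tilt_int (b * m) mL pL.
  rewrite -(ler_pM2l A0) /Q -(RintZ A ikL).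
  have -> : A * (ln A + (b * m) ^+ 2 / 2) =
      \int[gam R]_v (A * (ln A - (b * m) ^+ 2 / 2 - 1) * kap (b * m) v +
        A * (b * m) * (kap (b * m) v * v) + Lam P c (zeta v)).
    rewrite RintD//; last by apply: intbD; exact: intbZ.
    rewrite RintD; [|exact: intbZ..].
    by rewrite (RintZ _ ik) (RintZ _ ikv) step_Lam gam_int_kap gam_int_kapv; field.
  apply: le_Rint.
  - exact: intbZ.
  - by apply: intbD => //; apply: intbD; exact: intbZ.
  move=> v; have k0 := kap_gt0 (b * m) v.
  have := @xlnx_tangent R (A * kap (b * m) v) (Lam P c (zeta v)) (mulr_gt0 A0 k0) (Lam_gt0 mP _ _).
  rewrite -/(L v) lnM ?posrE// {4}/kap expRK.
  by move: (L v) (Lam P c _) (ln A) (kap _ _) => l1 l2 l3 k; lra.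
rewrite /= (_ : \int[gam R]_v (Lam P c (zeta v) * L v) = \int[P]_y (kap (a * y) u * Q y)); last first.
  rewrite -(step_Fubini mLi pLi); apply: eq_Rint => v.
  rewrite mulrC -RintZ; last exact: kap_int.
  by apply: eq_Rint => y; rewrite mulrC.
have mKi : mfun2 (fun y v : R => (y - m) * K v).
  by apply: measurable_funM; [rewrite /mfun2; mfun|exact: (mfun2_snd mK)].
have pKi : pbound (@wt2 R) (fun q => (q.1 - m) * K q.2).
  by apply: pboundM; [pbd|exact: pbound_snd].
have Si := step_intl_P mKi pKi.
have SE y : \int[gam R]_v (kap (b * y) v * ((y - m) * K v)) = (y - m) * S y.
  rewrite -RintZ; last exact: gam_tilt_int.
  by apply: eq_Rint => v; ring.
have ika := kap_int mP a u.
apply: (@le_trans _ _ (\int[P]_y (Q m * kap (a * y) u + b ^+ 2 * (kap (a * y) u * ((y - m) * S y))))).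
  apply: le_Rint.
  - exact: (step_intl_P mLi pLi).
  - apply: intbD; first exact: intbZ.
    by apply: intbZ; apply: eq_intb Si => y; rewrite SE.
  move=> y; have := ler_wpM2l (kap_ge0 (a * y) u) (Qle y).
  by move: (Q y) (Q m) (S y) (kap _ _) => q1 q2 s k; lra.
rewrite RintD; [|exact: intbZ|]; last first.
  by apply: intbZ; apply: eq_intb Si => y; rewrite SE.
rewrite (RintZ _ ika) RintZ; last by apply: eq_intb Si => y; rewrite SE.
have -> : \int[P]_y (kap (a * y) u * ((y - m) * S y)) =
    \int[gam R]_v (Lam1 P c (zeta v) * K v) - m * N.
  transitivity (\int[P]_y (kap (a * y) u * \int[gam R]_v (kap (b * y) v * ((y - m) * K v)))).
    by apply: eq_Rint => y; rewrite SE.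
  rewrite -(step_Fubini mKi pKi) -step_Lam1.
  have iLv := step_Lam1_int mK pK.
  have iN := step_Lam1_int m1 (@pbound_cst _ _ (@wt R) 1).
  have {}iN : intb (gam R) (fun v => Lam1 P c (zeta v)).
    by apply: eq_intb iN => v /=; rewrite mulr1.
  rewrite -(RintZ _ iN) -RintB//; last exact: intbZ.
  apply: eq_Rint => v.
  have ic := kap_int mP c (zeta v); have icy := kapy_int mP c (zeta v).
  transitivity (\int[P]_y (K v * (kap (c * y) (zeta v) * y) - (m * K v) * kap (c * y) (zeta v))).
    by apply: eq_Rint => y; ring.
  rewrite RintB; [|exact: intbZ..]; rewrite (RintZ _ icy) (RintZ _ ic) -/(Lam1 _ _ _) -/(Lam _ _ _).
  have := Mn_Lam mP c (zeta v); rewrite -/(K v) => <-; ring.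
have mN : m * N = N ^+ 2 / A by rewrite /m MnE// mulrC expr2 mulrA.
have bm : A * (b * m) ^+ 2 = b ^+ 2 * (N ^+ 2 / A).
  by rewrite /m MnE// -/A -/N; field; rewrite gt_eqF.
have Qm' : A * Q m <= A * ln A + b ^+ 2 * (N ^+ 2 / A) / 2.
  apply: le_trans (ler_wpM2l (ltW A0) Qm) _.
  by rewrite mulrDr (mulrA A (_ ^+ 2)) bm.
rewrite -/(Lam P a u) -/A mN; set I1 := Rintegral (gam R) _ _; move: I1 (Q m) Qm' => I q.
move: (N ^+ 2 / A) (ln A) => x l h.
lra.
Qed.

End increment.

Section rotation_real.
Variable R : realType.
Notation RR := (measurableTypeR R).
Variables (a b c : R).
Hypotheses (b0 : 0 < b) (c0 : 0 < c) (abc : c ^+ 2 = a ^+ 2 + b ^+ 2).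

Let zeta u v := (a * u + b * v) / c.

Let ge0_rotation (G : R -> R) : measurable_fun setT G -> (forall x, 0 <= G x) ->
  (\int[gam R]_u \int[gam R]_v (G (zeta u v))%:E = \int[gam R]_z (G z)%:E)%E.
Proof.
move=> mG G0.
have mG' : measurable_fun setT (fun x : R => (G (x / c))%:E).
  by apply/measurable_EFinP; apply: (measurableT_comp mG); mfun.
rewrite (ge0_integral_gam_rotation b0 c0 abc mG').
  by apply: eq_integral => z _; rewrite mulrC mulKf// gt_eqF.
by move=> x; rewrite lee_fin.
Qed.

Let ge0_rotationR (G : R -> R) : (forall x, 0 <= G x) -> intb (gam R) G ->
  (forall u, intb (gam R) (fun v => G (zeta u v))) ->
  intb (gam R) (fun u => \int[gam R]_v G (zeta u v)) /\
  \int[gam R]_u \int[gam R]_v G (zeta u v) = \int[gam R]_z G z.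
Proof.
move=> G0 iG iGu; have mG := measurable_intb iG.
have E : (\int[gam R]_u (\int[gam R]_v G (zeta u v))%:E = \int[gam R]_z (G z)%:E)%E.
  rewrite -ge0_rotation//; apply: eq_integral => u _.
  exact: (EFin_Rint (iGu u)).
split; last by rewrite /Rintegral; congr fine.
apply: ge0_intb.
- apply: (@measurable_Rint _ (gam R) (fun u v => G (zeta u v))).
  by apply: (mfun2_comp mG); rewrite /mfun2/zeta; mfun.
- by move=> u; apply: Rintegral_ge0.
- by rewrite E; exact: intb_ltoo.
Qed.

(** G will contain the factor [Lam], known only to be at most exp (z^2 / 2), so integrability is
    assumed instead of polynomial growth. G is split into G + |G| and |G|. *)
Lemma rotationR (G : R -> R) : intb (gam R) G ->
  (forall u, intb (gam R) (fun v => G (zeta u v))) ->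
  intb (gam R) (fun u => \int[gam R]_v G (zeta u v)) /\
  \int[gam R]_u \int[gam R]_v G (zeta u v) = \int[gam R]_z G z.
Proof.
move=> iG iGu.
have nrm (m : {sigma_finite_measure set RR -> \bar R}) (H : R -> R) : intb m H -> intb m (fun x => `|H x|).
  by move=> iH; apply: (integrable_norm iH).
pose G1 x := G x + `|G x|; pose G2 x := `|G x|.
have [] := @ge0_rotationR G1.
- by move=> x; rewrite /G1 -lerBlDl sub0r -normrN ler_norm.
- by apply: intbD => //; exact: nrm.
- by move=> u; apply: intbD => //; exact: (nrm _ _ (iGu u)).
move=> i1 e1.
have [] := @ge0_rotationR G2.
- by move=> x; exact: normr_ge0.
- exact: nrm.
- by move=> u; exact: (nrm _ _ (iGu u)).
move=> i2 e2.
have E u : \int[gam R]_v G (zeta u v) =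
   \int[gam R]_v G1 (zeta u v) - \int[gam R]_v G2 (zeta u v).
  rewrite -RintB.
  - by apply: eq_Rint => v; rewrite /G1 /G2 addrK.
  - by apply: intbD => //; exact: (nrm _ _ (iGu u)).
  - exact: (nrm _ _ (iGu u)).
split.
  by apply: eq_intb (intbB i1 i2) => u; rewrite E.
rewrite (eq_Rint _ E) RintB// e1 e2 /G1 RintD//; last exact: nrm.
by rewrite addrK.
Qed.

End rotation_real.

Section information.
Variable R : realType.
Notation RR := (measurableTypeR R).
Variable P : probability RR R.
Hypothesis mP : moments P.

Section one_channel.
Variable F : R -> R -> R.
Hypotheses (mF : mfun2 F) (pF : pbound (@wt2 R) (fun q => F q.1 q.2)).
Variable c : R.

Lemma channel_intl y : intb (gam R) (fun v => kap (c * y) v * F y v).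
Proof. exact: (gam_tilt_int (c * y) (mfun2_r y mF) (pbound_sectl pF y)). Qed.

Lemma channel_intr v : intb P (fun y => kap (c * y) v * F y v).
Proof. exact: (P_tilt_int mP c v (mfun2_l v mF) (pbound_sectr pF v)). Qed.

Lemma channel_Fubini : \int[gam R]_v \int[P]_y (kap (c * y) v * F y v) =
  \int[P]_y \int[gam R]_v (kap (c * y) v * F y v).
Proof.
by rewrite -(FubiniR (tilt_int2 mP c mF pF) channel_intl channel_intr).
Qed.

Lemma channel_int : intb (gam R) (fun v => \int[P]_y (kap (c * y) v * F y v)).
Proof. exact: int2_r (tilt_int2 mP c mF pF) channel_intr. Qed.

Lemma channel_int_P : intb P (fun y => \int[gam R]_v (kap (c * y) v * F y v)).
Proof. exact: int2_l (tilt_int2 mP c mF pF) channel_intl. Qed.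

End one_channel.

Lemma Lam_int c h : measurable_fun setT h -> pbound (@wt R) h ->
  intb (gam R) (fun v => Lam P c v * h v).
Proof.
move=> mh ph; have := channel_int (mfun2_snd mh) (pbound_snd ph) c.
apply: eq_intb => v; rewrite mulrC -RintZ; last exact: kap_int.
by apply: eq_Rint => y; rewrite mulrC.
Qed.

Lemma Lam1_int c h : measurable_fun setT h -> pbound (@wt R) h ->
  intb (gam R) (fun v => Lam1 P c v * h v).
Proof.
move=> mh ph.
have my : mfun2 (fun y v : R => y * h v).
  by apply: measurable_funM; [exact: measurable_fst|exact: (mfun2_snd mh)].
have py : pbound (@wt2 R) (fun q => q.1 * h q.2).
  by apply: pboundM; [pbd|exact: pbound_snd].
apply: eq_intb (channel_int my py c) => v.
by rewrite mulrC -RintZ; [apply: eq_Rint => y; ring|exact: kapy_int].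
Qed.

Lemma Lam_mean c f : measurable_fun setT f -> pbound (@wt R) f ->
  \int[gam R]_v \int[P]_y (kap (c * y) v * f y) = \int[P]_y f y.
Proof.
move=> mf pf; rewrite (channel_Fubini (mfun2_fst mf) (pbound_fst pf)).
apply: eq_Rint => y.
rewrite -[RHS]mulr1 -(gam_int_kap (c * y)) -RintZ; last exact: gam_kap_intb.
by apply: eq_Rint => v; rewrite mulrC.
Qed.

Lemma Lam_int1 c : intb (gam R) (Lam P c).
Proof.
have m1 : measurable_fun (setT : set R) (fun=> 1 : R) by [].
have h := Lam_int c m1 (@pbound_cst _ _ (@wt R) 1).
by apply: eq_intb h => v /=; rewrite mulr1.
Qed.

Lemma Rint_Lam c : \int[gam R]_v Lam P c v = 1.
Proof.
have m1 : measurable_fun (setT : set R) (fun=> 1 : R) by [].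
have := Lam_mean c m1 (@pbound_cst _ _ (@wt R) 1).
rewrite Rint_cst => <-.
by apply: eq_Rint => v; apply: eq_Rint => y; rewrite mulr1.
Qed.

(* The relative entropy of the law of c Y + N with respect to that of N, and
   the second moment of the conditional expectation of Y given c Y + N. *)
Definition J c := \int[gam R]_z (Lam P c z * ln (Lam P c z)).
Definition Mn2 c := \int[gam R]_z (Lam1 P c z * Mn P c z).

Lemma J_int c : intb (gam R) (fun z => Lam P c z * ln (Lam P c z)).
Proof. by apply: Lam_int; [exact: measurable_lnLam|exact: pbound_lnLam]. Qed.

Lemma Mn2_int c : 0 < c -> intb (gam R) (fun z => Lam1 P c z * Mn P c z).
Proof. by move=> c0; apply: Lam1_int; [exact: measurable_Mn|exact: pbound_Mn]. Qed.

(** The tangent of x ln x at 1 is x - 1, and the mean of [Lam] is 1. *)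
Lemma J_ge0 c : 0 <= J c.
Proof.
have : \int[gam R]_z (Lam P c z - 1) <= J c.
  apply: le_Rint; [|exact: J_int|].
  - by apply: intbB; [exact: Lam_int1|exact: intb_cst].
  move=> z; have := xlnx_tangent (Lam_gt0 mP c z) (@ltr01 R).
  by rewrite ln1 mulr0 add0r.
by rewrite RintB; [|exact: Lam_int1|exact: intb_cst]; rewrite Rint_Lam Rint_cst subrr.
Qed.

(** Relative entropy is convex in the law, so J is at most the mean over y of the relative entropy
    of N(c y, 1) with respect to N(0,1), which is (c y)^2 / 2. Convexity is the tangent of x ln x at
    [Lam P c z]. *)
Lemma J_le c : J c <= c ^+ 2 / 2 * mom2 P.
Proof.
pose F y z := c * y * z - (c * y) ^+ 2 / 2.
have mF : mfun2 F by rewrite /mfun2/F; mfun.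
have pF : pbound (@wt2 R) (fun q => F q.1 q.2) by rewrite /F; pbd.
apply: (@le_trans _ _ (\int[gam R]_z \int[P]_y (kap (c * y) z * F y z))).
  apply: le_Rint; [exact: J_int|exact: channel_int|] => z.
  have i1 := kap_int mP c z.
  have -> : Lam P c z * ln (Lam P c z) =
    \int[P]_y ((ln (Lam P c z) + 1) * kap (c * y) z - Lam P c z).
    rewrite RintB; [|exact: intbZ|exact: intb_cst].
    by rewrite (RintZ _ i1) Rint_cst -/(Lam P c z); ring.
  apply: le_Rint.
  - by apply: intbB; [exact: intbZ|exact: intb_cst].
  - exact: channel_intr.
  move=> y; have := xlnx_tangent (kap_gt0 (c * y) z) (Lam_gt0 mP c z).
  by rewrite {4}/kap expRK -/(F y z); move: (ln (Lam P c z)) (Lam P c z) (F y z) (kap (c * y) z) => *; lra.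
rewrite channel_Fubini// -RintZ; last exact: ysqr_int.
rewrite le_eqVlt; apply/orP; left; apply/eqP; apply: eq_Rint => y.
have i1 := gam_kap_intb (c * y).
have i2 : intb (gam R) (fun v => kap (c * y) v * v).
  by apply: gam_tilt_int; [mfun|pbd].
transitivity (\int[gam R]_v (c * y * (kap (c * y) v * v) - (c * y) ^+ 2 / 2 * kap (c * y) v)).
  by apply: eq_Rint => v; rewrite /F; ring.
rewrite RintB; [|exact: intbZ..]; rewrite (RintZ _ i1) (RintZ _ i2).
by rewrite gam_int_kap gam_int_kapv; field.
Qed.

Section increments.
Variables (a b c : R).
Hypotheses (a0 : 0 < a) (b0 : 0 < b) (c0 : 0 < c) (abc : c ^+ 2 = a ^+ 2 + b ^+ 2).

Let Mn2E u : Lam1 P a u ^+ 2 / Lam P a u = Lam1 P a u * Mn P a u.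
Proof. by rewrite MnE// mulrA -expr2. Qed.

(** The step inequalities hold for each u. Their mean over u contains double integrals of functions
    of [zeta], and rotation invariance turns these into the single integrals that define J c and Mn2
    c. *)
Let rotJ := rotationR b0 c0 abc (J_int c)
  (fun u => step_Lam_int mP c0 abc u
     (measurableT_comp (measurable_lnLam P c) (@measurable_zeta R a b c u))
     (pbound_comp (@wt_ge1 R) (pbound_lnLam mP c) (@pbound_zeta R a b c u))).

Let rotM := rotationR b0 c0 abc (Mn2_int c0)
  (fun u => step_Lam1_int mP c0 abc u
     (measurableT_comp (measurable_Mn P c) (@measurable_zeta R a b c u))
     (pbound_comp (@wt_ge1 R) (pbound_Mn mP c0) (@pbound_zeta R a b c u))).

Let JE : J c = _ := esym rotJ.2.
Let Mn2cE : Mn2 c = _ := esym rotM.2.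

Lemma J_increment_ge : b ^+ 2 / 2 * Mn2 a <= J c - J a.
Proof.
rewrite lerBrDl JE.
have i1 := J_int a; have i2 := Mn2_int a0.
rewrite /J /Mn2 -(RintZ _ i2) -RintD//; last exact: intbZ.
apply: le_Rint; [by apply: intbD => //; exact: intbZ|exact: rotJ.1|].
by move=> u; have := step_ge mP c0 abc u; rewrite Mn2E.
Qed.

Lemma J_increment_le : J c - J a <= b ^+ 2 * Mn2 c - b ^+ 2 / 2 * Mn2 a.
Proof.
have i1 := J_int a; have i2 := Mn2_int a0.
rewrite lerBlDl addrA JE Mn2cE /J /Mn2.
rewrite -(RintZ _ i2) -(RintZ _ rotM.1) -RintD//; last by apply: intbZ; exact: rotM.1.
rewrite -RintB; [|by apply: intbD => //; apply: intbZ; exact: rotM.1|exact: intbZ].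
apply: le_Rint; [exact: rotJ.1| |].
  by apply: intbB; [by apply: intbD => //; apply: intbZ; exact: rotM.1|exact: intbZ].
by move=> u; have := step_le mP c0 abc u; rewrite Mn2E.
Qed.

End increments.

End information.

(** * An integral recovered from two-sided bounds on increments *)

Section integral_of_increments.
Variable R : realType.
Notation mu := (@lebesgue_measure R).
Variables (j e : R -> R) (al be : R).
Hypothesis al_be : al < be.
Hypothesis incr_ge : forall s t, al <= s -> s < t -> (t - s) / 2 * e s <= j t - j s.
Hypothesis incr_le : forall s t, al <= s -> s < t ->
  j t - j s <= (t - s) * e t - (t - s) / 2 * e s.

(** Chaining the two increment bounds gives (t - s) (e t - e s) >= 0. *)
Let e_mono s t : al <= s -> s <= t -> e s <= e t.
Proof.
move=> s0; rewrite le_eqVlt => /predU1P[->//|st].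
have := incr_ge s0 st; have := incr_le s0 st; have : 0 < t - s by rewrite subr_gt0.
move: (t - s) (j t - j s) (e s) (e t) => d x es et d0 h1 h2.
by rewrite -(ler_pM2l d0); lra.
Qed.

(** Extending e by a constant to the left of [al] makes it monotone on the whole line, hence
    measurable, and bounded on bounded intervals. *)
Let e' x := e (Num.max al x).

Let e'E x : al <= x -> e' x = e x.
Proof. by move=> h; rewrite /e' max_r. Qed.

Let e'_nd : nondecreasing_fun e'.
Proof.
move=> x y xy; apply: e_mono; first by rewrite le_max lexx.
by rewrite ge_max !le_max lexx xy orbT.
Qed.

Let me' : measurable_fun setT e'.
Proof. exact: nondecreasing_measurable. Qed.

Let ie' x y : mu.-integrable `[x, y] (EFin \o e').
Proof.
apply: measurable_bounded_integrable => //.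
- by rewrite /= lebesgue_measure_itv/=; case: ifPn => _; rewrite -?EFinB ltry.
- exact: measurable_funTS.
exists (`|e' x| + `|e' y|); split; first exact: num_real.
move=> M hM z /=; rewrite in_itv/= => /andP[xz zy].
apply: le_trans (ltW hM).
have := e'_nd xz; have := e'_nd zy; rewrite ler_norml.
have := ler_norm (e' y); have := ler_norm (- e' x); rewrite normrN.
have := normr_ge0 (e' y); have := normr_ge0 (e' x).
by move: (`|e' x|) (`|e' y|) (e' x) (e' y) (e' z) => *; apply/andP; split; lra.
Qed.

Let ie'oc x y : mu.-integrable `]x, y] (EFin \o e').
Proof. by apply: integrableS (ie' x y) => //; apply: subset_itvr; rewrite bnd_simp. Qed.

Let Phi x := \int[mu]_(t in `[al, x]) e' t.

Let PhiB s t : al <= s -> s <= t -> Phi t - Phi s = \int[mu]_(x in `]s, t]) e' x.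
Proof. by move=> als st; rewrite /Phi Rintegral_itvB. Qed.

Let mu_oc (s t : R) : s <= t -> fine (mu `]s, t]) = t - s.
Proof.
rewrite /= lebesgue_measure_itv/= lte_fin le_eqVlt => /predU1P[->|st].
  by rewrite ltxx subrr.
by rewrite st.
Qed.

Let Phi_ge s t : al <= s -> s <= t -> (t - s) * e s <= Phi t - Phi s.
Proof.
move=> als st; rewrite PhiB// -(mu_oc st) mulrC -Rintegral_cst//.
apply: le_Rintegral => //.
  by apply: measurable_bounded_integrable => //;
    [rewrite /= lebesgue_measure_itv/=; case: ifPn => _; rewrite -?EFinB ltry|exists `|e s|; split => // M hM x _ /=; exact: ltW].
by move=> x /=; rewrite in_itv/= => /andP[sx _]; rewrite -(e'E als) e'_nd// ltW.
Qed.

Let Phi_le s t : al <= s -> s <= t -> Phi t - Phi s <= (t - s) * e t.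
Proof.
move=> als st; rewrite PhiB// -(mu_oc st) mulrC -Rintegral_cst//.
apply: le_Rintegral => //.
  by apply: measurable_bounded_integrable => //;
    [rewrite /= lebesgue_measure_itv/=; case: ifPn => _; rewrite -?EFinB ltry|exists `|e t|; split => // M hM x _ /=; exact: ltW].
by move=> x /=; rewrite in_itv/= => /andP[_ xt]; rewrite -(e'E (le_trans als st)) e'_nd.
Qed.

Let G x := 2 * j x - Phi x.

(** With d = t - s, the increment of 2 j lies between d (e s) and 2 d (e t) - d (e s), and that of
    Phi between d (e s) and d (e t). *)
Let G_incr s t : al <= s -> s < t -> `|G t - G s| <= 2 * ((t - s) * (e t - e s)).
Proof.
move=> als st; have st' := ltW st.
have := incr_ge als st; have := incr_le als st.
have := Phi_ge als st'; have := Phi_le als st'; have := e_mono als st'.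
have : 0 < t - s by rewrite subr_gt0.
rewrite /G (_ : 2 * j t - Phi t - _ = 2 * (j t - j s) - (Phi t - Phi s)); last by ring.
move: (t - s) (j t - j s) (Phi t - Phi s) (e s) (e t) => d x y es et d0 h1 h2 h3 h4 h5.
have : 0 <= d * (et - es) by rewrite mulr_ge0 ?subr_ge0// ltW.
by rewrite ler_norml => h6; apply/andP; split; lra.
Qed.

(** G = 2 j - Phi is constant: over n + 1 equal steps the bounds [G_incr] telescope to 2 (be - al)
    (e be - e al) / (n + 1), which is arbitrarily small. *)
Lemma integral_of_increments : \int[mu]_(x in `[al, be]) e x = 2 * (j be - j al).
Proof.
have Gpart n i : let d := (be - al) / n.+1%:R in (i <= n.+1)%N ->
    `|G (al + i%:R * d) - G al| <= 2 * (d * (e (al + i%:R * d) - e al)).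
  move=> d; have d0 : 0 < d by rewrite divr_gt0// subr_gt0.
  elim: i => [_|i IH hi]; first by rewrite mul0r addr0 !subrr mulr0 normr0 mulr0.
  have h1 : al <= al + i%:R * d by rewrite lerDl mulr_ge0// ltW.
  have h2 : al + i%:R * d < al + i.+1%:R * d by rewrite ltrD2l ltr_pM2r// ltr_nat.
  have e1 : al + i.+1%:R * d - (al + i%:R * d) = d.
    by rewrite -[in LHS]addn1 natrD; ring.
  have {h1 h2} := G_incr h1 h2; rewrite e1.
  have {IH} := IH (ltnW hi).
  move: (G (al + i%:R * d)) (G (al + i.+1%:R * d)) (e (al + i%:R * d)) (e _) (e al) (G al) => g1 g2 e1' e2 e0 g0 h1 h2.
  rewrite (_ : g2 - g0 = (g2 - g1) + (g1 - g0)); last by ring.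
  by apply: (le_trans (ler_normD _ _)); lra.
have GE : G be = G al.
  apply/eqP; rewrite -subr_eq0 -normr_le0; apply/ler_addgt0Pr => eps eps0; rewrite add0r.
  pose C := 2 * ((be - al) * (e be - e al)).
  have C0 : 0 <= C by rewrite /C !mulr_ge0// subr_ge0 ?(ltW al_be)// e_mono// ltW.
  pose n := Num.truncn (C / eps).
  have hn : C / eps < n.+1%:R by exact: truncnS_gt.
  have := Gpart n n.+1 (leqnn _); rewrite /= mulrC divfK ?pnatr_eq0//.
  rewrite (addrC al) subrK => /le_trans; apply.
  rewrite mulrAC (_ : 2 * (_ / _) = C / n.+1%:R); last by rewrite /C; ring.
  by rewrite ler_pdivrMr// -ler_pdivrMl// mulrC ltW.
have Phial : Phi al = 0 by rewrite /Phi set_itv1 Rintegral_set1.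
have : Phi be = 2 * (j be - j al).
  by move: GE; rewrite /G Phial subr0 => h; move: (Phi be) h => x h; lra.
by move=> <-; apply: eq_Rintegral => x; rewrite inE/= in_itv/= => /andP[alx _]; rewrite e'E.
Qed.

Lemma integrable_of_increments : mu.-integrable `[al, be] (EFin \o e).
Proof.
apply: eq_integrable (ie' al be) => // x; rewrite inE/= in_itv/= => /andP[alx _].
by rewrite /= e'E.
Qed.

End integral_of_increments.

Section I_MMSE.
Variable R : realType.
Notation RR := (measurableTypeR R).
Notation mu := (@lebesgue_measure R).
Variable P : probability RR R.
Hypothesis mP : moments P.

(** The additional Gaussian step has amplitude sqrt (t - s). The bound of [Mn] contains 1/c, whence
    s > 0. *)
Let incr (s t : R) : 0 < s -> s < t ->
  (t - s) / 2 * Mn2 P (Num.sqrt s) <= J P (Num.sqrt t) - J P (Num.sqrt s) <=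
  (t - s) * Mn2 P (Num.sqrt t) - (t - s) / 2 * Mn2 P (Num.sqrt s).
Proof.
move=> s0 st; have t0 : 0 < t by exact: lt_trans st.
have a0 : 0 < Num.sqrt s by rewrite sqrtr_gt0.
have b0 : 0 < Num.sqrt (t - s) by rewrite sqrtr_gt0 subr_gt0.
have c0 : 0 < Num.sqrt t by rewrite sqrtr_gt0.
have abc : Num.sqrt t ^+ 2 = Num.sqrt s ^+ 2 + Num.sqrt (t - s) ^+ 2.
  by rewrite !sqr_sqrtr ?subr_ge0 ?ltW//; ring.
have := J_increment_ge mP a0 b0 c0 abc; have := J_increment_le mP a0 b0 c0 abc.
have ts : 0 <= t - s by rewrite subr_ge0 ltW.
by rewrite sqr_sqrtr// => -> ->.
Qed.

Lemma integral_Mn2 (al be : R) : 0 < al -> al < be ->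
  \int[mu]_(t in `[al, be]) Mn2 P (Num.sqrt t) =
  2 * (J P (Num.sqrt be) - J P (Num.sqrt al)).
Proof.
move=> a0 ab.
apply: (@integral_of_increments R (fun t => J P (Num.sqrt t)) (fun t => Mn2 P (Num.sqrt t))) => // s t s0 st.
  by have /andP[] := incr (lt_le_trans a0 s0) st.
by have /andP[] := incr (lt_le_trans a0 s0) st.
Qed.

Lemma integrable_Mn2 (al be : R) : 0 < al -> al < be ->
  mu.-integrable `[al, be] (fun t => (Mn2 P (Num.sqrt t))%:E).
Proof.
move=> a0 ab.
apply: (@integrable_of_increments R (fun t => J P (Num.sqrt t)) (fun t => Mn2 P (Num.sqrt t))) => // s t s0 st.
  by have /andP[] := incr (lt_le_trans a0 s0) st.
by have /andP[] := incr (lt_le_trans a0 s0) st.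
Qed.

End I_MMSE.

(** * Density of the polynomials in L2 *)

Section L2_closure.
Variable R : realType.
Notation RR := (measurableTypeR R).
Variable P : probability RR R.
Variable A : (R -> R) -> Prop.
Hypothesis mA : forall f, A f -> measurable_fun setT f.
Hypothesis A_D : forall f g, A f -> A g -> A (fun x => f x + g x).
Hypothesis A_Z : forall k f, A f -> A (fun x => k * f x).
Hypothesis A_1 : A (fun=> 1).

Definition dist2 (f g : R -> R) : \bar R := (\int[P]_x ((f x - g x) ^+ 2)%:E)%E.

(** [dist2] takes extended real values, so membership makes sense before f or its approximants are
    known to be square integrable. *)
Definition L2cl (f : R -> R) := measurable_fun setT f /\
  forall e, 0 < e -> exists2 g, A g & (dist2 f g < e%:E)%E.

(** From (a + b)^2 <= 2 a^2 + 2 b^2, which suffices for closure arguments in place of Minkowski's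
    inequality; it is the reason for the quarters of e below. *)
Lemma dist2_triangle f g h : measurable_fun setT f -> measurable_fun setT g ->
  measurable_fun setT h ->
  (dist2 f h <= 2%:E * dist2 f g + 2%:E * dist2 g h)%E.
Proof.
move=> mf mg mh; rewrite /dist2 -!ge0_integralZl//; first last.
- by move=> x _; rewrite lee_fin sqr_ge0.
- by apply/measurable_EFinP; mfun.
- by move=> x _; rewrite lee_fin sqr_ge0.
- by apply/measurable_EFinP; mfun.
rewrite -ge0_integralD//; first last.
- by apply/measurable_EFinP; mfun.
- by move=> x _; rewrite -EFinM lee_fin mulr_ge0// sqr_ge0.
- by apply/measurable_EFinP; mfun.
- by move=> x _; rewrite -EFinM lee_fin mulr_ge0// sqr_ge0.
apply: ge0_le_integral => //.
- by move=> x _; rewrite lee_fin sqr_ge0.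
- by apply/measurable_EFinP; mfun.
- by apply/measurable_EFinP; mfun.
move=> x _; rewrite -!EFinM -EFinD lee_fin.
by have := sqr_ge0 ((f x - g x) - (g x - h x)); move: (f x) (g x) (h x) => a b c; nra.
Qed.

Lemma L2cl_sub f : A f -> L2cl f.
Proof.
move=> Af; split; first exact: mA.
move=> e e0; exists f => //; rewrite /dist2.
by under eq_integral do rewrite subrr expr0n/=; rewrite integral0 lte_fin.
Qed.

Lemma L2cl_closed f : measurable_fun setT f ->
  (forall e, 0 < e -> exists2 g, L2cl g & (dist2 f g < e%:E)%E) -> L2cl f.
Proof.
move=> mf H; split => // e e0.
have e4 : 0 < e / 4 by rewrite divr_gt0.
have [g [mg clg] fg] := H _ e4; have [h Ah gh] := clg _ e4.
exists h => //; apply: (le_lt_trans (dist2_triangle mf mg (mA Ah))).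
rewrite (_ : e%:E = (2%:E * (e / 4)%:E + 2%:E * (e / 4)%:E)%E); last first.
  by rewrite -!EFinM -EFinD; congr EFin; field.
by apply: lteD; rewrite lte_pmul2l.
Qed.

Lemma L2clZ k f : L2cl f -> L2cl (fun x => k * f x).
Proof.
move=> [mf H]; split; first by mfun.
move=> e e0; have e1 : 0 < e / (k ^+ 2 + 1) by rewrite divr_gt0// ltr_wpDl// sqr_ge0.
have [g Ag fg] := H _ e1; exists (fun x => k * g x); first exact: A_Z.
have mg := mA Ag.
rewrite (_ : dist2 _ _ = (k ^+ 2)%:E * dist2 f g)%E; last first.
  rewrite /dist2 -ge0_integralZl//; first last.
  - by rewrite lee_fin sqr_ge0.
  - by move=> x _; rewrite lee_fin sqr_ge0.
  - by apply/measurable_EFinP; mfun.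
  by apply: eq_integral => x _; rewrite -EFinM; congr EFin; ring.
have d0 : (0 <= dist2 f g)%E by apply: integral_ge0 => x _; rewrite lee_fin sqr_ge0.
apply: (@le_lt_trans _ _ ((k ^+ 2 + 1)%:E * dist2 f g)%E).
  by apply: lee_wpmul2r => //; rewrite lee_fin lerDl.
rewrite (_ : e%:E = (k ^+ 2 + 1)%:E * (e / (k ^+ 2 + 1))%:E)%E; last first.
  by rewrite -EFinM mulrC divfK// gt_eqF// ltr_wpDl// sqr_ge0.
by rewrite lte_pmul2l// lte_fin ltr_wpDl// sqr_ge0.
Qed.

Lemma L2clD f g : L2cl f -> L2cl g -> L2cl (fun x => f x + g x).
Proof.
move=> [mf Hf] [mg Hg]; split; first by mfun.
move=> e e0; have e4 : 0 < e / 4 by rewrite divr_gt0.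
have [f' Af ff] := Hf _ e4; have [g' Ag gg] := Hg _ e4.
have mf' := mA Af; have mg' := mA Ag.
exists (fun x => f' x + g' x); first exact: A_D.
apply: (le_lt_trans (@dist2_triangle _ (fun x => f' x + g x) _ _ _ _)); [by mfun..|].
rewrite (_ : e%:E = (2%:E * (e / 4)%:E + 2%:E * (e / 4)%:E)%E); last first.
  by rewrite -!EFinM -EFinD; congr EFin; field.
by apply: lteD; rewrite lte_pmul2l//; [move: ff|move: gg]; congr (_ < _)%E;
  apply: eq_integral => x _; congr (EFin (_ ^+ 2)); ring.
Qed.

Lemma L2clB f g : L2cl f -> L2cl g -> L2cl (fun x => f x - g x).
Proof.
move=> hf hg; have := L2clD hf (L2clZ (-1) hg).
by under eq_fun do rewrite mulN1r.
Qed.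

Lemma L2cl_cst k : L2cl (fun=> k).
Proof.
by have := L2clZ k (L2cl_sub A_1); under eq_fun do rewrite mulr1.
Qed.

Lemma L2cl_sum (I : eqType) (s : seq I) (F : I -> R -> R) :
  (forall i, i \in s -> L2cl (F i)) -> L2cl (fun x => \sum_(i <- s) F i x).
Proof.
elim: s => [_|i s IH H]; first by under eq_fun do rewrite big_nil; exact: L2cl_cst.
under eq_fun do rewrite big_cons; apply: L2clD; first by apply: H; rewrite mem_head.
by apply: IH => k ks; apply: H; rewrite in_cons ks orbT.
Qed.

Lemma L2cl_dominated (f_ : nat -> R -> R) f g : (forall n, L2cl (f_ n)) ->
  (forall x, (f_ n x) @[n --> \oo] --> f x) -> intb P g ->
  (forall n x, (f x - f_ n x) ^+ 2 <= g x) -> L2cl f.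
Proof.
move=> Hf cf ig fg.
have mf : measurable_fun setT f.
  apply: (measurable_fun_cvg (h := f_)) => //; first by move=> n; case: (Hf n).
have mfn n : measurable_fun setT (f_ n) by case: (Hf n).
have msq n : measurable_fun setT (fun x => (f x - f_ n x) ^+ 2).
  by have := mfn n => mn; mfun.
have csq x : (f x - f_ n x) ^+ 2 @[n --> \oo] --> (0 : R).
  rewrite [X in _ --> X](_ : _ = (f x - f x) * (f x - f x)); last by rewrite subrr mulr0.
  under eq_fun do rewrite expr2.
  by apply: cvgM; apply: cvgB => //; exact: cvg_cst.
have bsq n x : `|(f x - f_ n x) ^+ 2| <= g x by rewrite ger0_norm ?sqr_ge0.
have [_ H] := DCT_R msq csq ig bsq.
apply: L2cl_closed => // e e0.
move: H; rewrite Rint_cst => /cvgrPdist_lt/(_ _ e0)[n _ /(_ n (leqnn _)) /= hn].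
exists (f_ n) => //; rewrite /dist2 -EFin_Rint; last first.
  by apply: (intb_le (msq n) _ ig) => x; rewrite ger0_norm ?sqr_ge0.
move: hn; rewrite sub0r normrN lte_fin; apply: le_lt_trans; exact: ler_norm.
Qed.

End L2_closure.

Import HBNNSimple.

Section L2_total.
Variable R : realType.
Notation RR := (measurableTypeR R).
Variable P : probability RR R.
Variable A : (R -> R) -> Prop.
Hypothesis mA : forall f, A f -> measurable_fun setT f.
Hypothesis A_D : forall f g, A f -> A g -> A (fun x => f x + g x).
Hypothesis A_Z : forall k f, A f -> A (fun x => k * f x).
Hypothesis A_1 : A (fun=> 1).
Hypothesis A_ray : forall a : R, L2cl P A (fun x : R => (a < x)%R%:R).

Lemma indic_bigcup_sum (F : nat -> set R) n x : trivIset setT F ->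
  \sum_(k < n) (\1_(F k) x : R) = \1_(\bigcup_(k < n) F k) x.
Proof.
move=> tF; elim: n => [|n IH].
  by rewrite big_ord0 bigcup_mkord big_ord0 indic0.
rewrite big_ord_recr/= IH !bigcup_mkord big_ord_recr/= -bigcup_mkord !indicE in_setU.
have [xn|] := boolP (x \in F n); last by rewrite orbF addr0.
rewrite orbT (_ : x \in \bigcup_(k < n) F k = false) ?add0r//.
apply/negbTE/negP; rewrite inE => -[k /= kn Fk]; rewrite inE in xn.
have kE : k = n by apply: tF => //; exists x.
by rewrite kE ltnn in kn.
Qed.

(** Open rays form a pi-system that generates the Borel sets, and the sets whose indicator lies in
    the closure form a Dynkin system: complements by linearity, disjoint unions by dominated
    convergence. *)
Lemma L2cl_indic (S : set R) : measurable S -> L2cl P A (\1_S : R -> R).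
Proof.
rewrite [X in X S -> _](RGenOInfty.measurableE R).
apply: (@dynkin_induction _ RR (@RGenOInfty.G R) (fun S => L2cl P A (\1_S : R -> R))).
- exact: RGenOInfty.measurableE.
- move=> _ _ [x ->] [y ->]; exists (Num.max x y).
  by apply/seteqP; split => z /=; rewrite !in_itv/= !andbT gt_max; [move=> [-> ->]|move=> /andP[]].
- by rewrite indicT; exact: L2cl_cst.
- move=> _ [x ->]; rewrite (_ : \1_ _ = (fun z : R => (x < z)%R%:R)); first exact: A_ray.
  by apply/funext => z; rewrite indicE mem_setE in_itv/= andbT.
- move=> S' mS H; rewrite (_ : \1_ _ = (fun x => 1 - \1_S' x : R)).
    by apply: L2clB => //; exact: L2cl_cst.
  by apply/funext => x; rewrite indicC indicE; case: (x \in S'); rewrite ?subrr ?subr0.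
- move=> F mF tF H.
  apply: (@L2cl_dominated _ _ _ mA (fun n x => \sum_(k < n) \1_(F k) x) _ (fun=> 1)).
  + by move=> n; apply: L2cl_sum => // i _; exact: H.
  + move=> x; under eq_fun do rewrite indic_bigcup_sum//.
    have [|xF] := boolP (x \in \bigcup_k F k).
      rewrite inE => -[k _ Fk]; apply: cvg_near_cst; exists k.+1 => // n /= kn.
      rewrite !indicE mem_set; last by exists k.
      by rewrite mem_set//; exists k.
    apply: cvg_near_cst; exists 0%N => // n _ /=.
    rewrite !indicE (negbTE xF) memNset// => -[k _ Fk]; move/negP: xF; apply.
    by rewrite inE; exists k.
  + exact: intb_cst.
  + by move=> n x; rewrite indic_bigcup_sum// -(real_normK (num_real _)) expr_le1//.
Qed.

(** Simple functions h increasing to f satisfy (f - h)^2 <= f^2, which dominates. *)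
Lemma L2cl_ge0 (f : R -> R) : measurable_fun setT f -> (forall x, 0 <= f x) ->
  intb P (fun x => f x ^+ 2) -> L2cl P A f.
Proof.
move=> mf f0 if2.
have mf' : measurable_fun (setT : set RR) (EFin \o f) by exact/measurable_EFinP.
pose h := nnsfun_approx measurableT mf'.
have ch x : (h n x) @[n --> \oo] --> f x.
  have : (EFin \o (h ^~ x)) n @[n --> \oo] --> (f x)%:E.
    by apply: (cvg_nnsfun_approx measurableT mf') => // y _; rewrite lee_fin.
  by move/fine_cvg.
have hf n x : 0 <= h n x <= f x.
  apply/andP; split; first exact: fun_ge0.
  rewrite -(cvg_lim _ (ch x))//; apply: nondecreasing_cvgn_le; last by apply/cvg_ex; exists (f x).
  by move=> p q pq; have /lefP := nd_nnsfun_approx measurableT mf' pq; exact.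
apply: (L2cl_dominated mA (f_ := h) _ ch if2).
- move=> n; rewrite (_ : (h n : R -> R) =
     (fun x => \sum_(y <- finmap.enum_fset (fset_set (range (h n)))) y * \1_(h n @^-1` [set y]) x)).
    apply: L2cl_sum => // y _; apply: L2clZ => //; apply: L2cl_indic.
    have mh : measurable_fun setT (h n) by exact: measurable_funPT.
    by rewrite -[X in measurable X]setTI; apply: mh => //; exact: measurable_set1.
  by apply/funext => x; rewrite fimfunE fsbig_finite.
- move=> n x; have /andP[h0 h1] := hf n x.
  by apply: lerXn2r; rewrite ?nnegrE ?subr_ge0// gerBl.
Qed.

Lemma L2cl_total (f : R -> R) : measurable_fun setT f -> intb P (fun x => f x ^+ 2) -> L2cl P A f.
Proof.
move=> mf if2.
have absE (x : R) : (`|x|) ^+ 2 = x ^+ 2 by exact: real_normK (num_real x).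
have mn : measurable_fun setT (fun x => `|f x|) by mfun.
have i1 : L2cl P A (fun x => `|f x|).
  by apply: L2cl_ge0 => //; apply: eq_intb if2 => x; rewrite absE.
have i2 : L2cl P A (fun x => `|f x| + f x).
  apply: L2cl_ge0.
  - by mfun.
  - by move=> x; rewrite -lerBlDr sub0r -normrN ler_norm.
  - apply: (@intb_le _ _ _ (fun x => 4 * f x ^+ 2)).
    + by mfun.
    + move=> x; rewrite ger0_norm ?sqr_ge0// -(absE (f x)).
      have := ler_norm (f x); have := ler_norm (- f x); rewrite normrN.
      by move: (f x) (`|f x|) => a b h1 h2; nra.
    + exact: intbZ.
have := L2clB mA A_D A_Z i2 i1.
by congr L2cl; apply/funext => x; rewrite addrC addKr.
Qed.

End L2_total.

(** * Polynomials approximating a step *)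

Section step_polynomial.
Variable R : realType.

(* (1 - u^n)^(n 2^n) with u = (1 - x) / 2 tends to the indicator of x > 0 on [-1, 1]. *)
Definition step_poly n : {poly R} :=
  (1 - ((2^-1)%:P * (1 - 'X)) ^+ n) ^+ (n * 2 ^ n).

Lemma step_polyE n x : (step_poly n).[x] = (1 - ((1 - x) / 2) ^+ n) ^+ (n * 2 ^ n).
Proof. by rewrite /step_poly !hornerE/= mulrC. Qed.

Lemma step_poly01 n x : `|x| <= 1 -> 0 <= (step_poly n).[x] <= 1.
Proof.
rewrite ler_norml => /andP[x1 x2]; rewrite step_polyE.
have u0 : 0 <= (1 - x) / 2 by lra.
have u1 : (1 - x) / 2 <= 1 by lra.
have : 0 <= ((1 - x) / 2) ^+ n <= 1 by rewrite exprn_ge0//= exprn_ile1.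
move=> /andP[v0 v1].
by rewrite exprn_ge0 ?exprn_ile1//; lra.
Qed.

(** Write r = q^2 with q < 1. Bernoulli's inequality bounds n q^n by a constant, and the other
    factor q^n tends to 0. *)
Lemma cvg_natmul_expr (r : R) : 0 <= r < 1 -> n%:R * r ^+ n @[n --> \oo] --> 0.
Proof.
move=> /andP[]; rewrite le_eqVlt => /predU1P[<-|r0] r1.
  apply: cvg_near_cst; exists 1%N => // n /= n1.
  by rewrite expr0n; case: n n1 => //= n _; rewrite mulr0.
pose q := Num.sqrt r.
have q0 : 0 < q by rewrite sqrtr_gt0.
have q1 : q < 1 by rewrite -(sqrtr1 R) ltr_sqrt.
pose h := q^-1 - 1.
have h0 : 0 < h by rewrite subr_gt0 invf_gt1.
have bern n : n%:R * h <= q ^- n.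
  have : 1 + n%:R * h <= (1 + h) ^+ n.
    elim: n => [|n IH]; first by rewrite mul0r addr0 expr0.
    rewrite exprS -[n.+1]add1n natrD.
    apply: (@le_trans _ _ ((1 + h) * (1 + n%:R * h))).
      have : 0 <= h * (n%:R * h) by rewrite !mulr_ge0// ltW.
      lra.
    by rewrite ler_wpM2l//; lra.
  by rewrite /h [1 + (_ - _)]addrC subrK exprVn; lra.
have bnd n : n%:R * r ^+ n <= h^-1 * q ^+ n.
  have -> : r ^+ n = q ^+ n * q ^+ n by rewrite -exprMn -expr2 sqr_sqrtr// ltW.
  rewrite mulrA ler_wpM2r ?exprn_ge0 ?(ltW q0)// -(ler_pM2l h0) divff ?gt_eqF//.
  by rewrite mulrA [h * _]mulrC -ler_pdivlMr ?exprn_gt0// mul1r.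
apply: (@squeeze_cvgr _ _ _ _ (fun=> 0) (fun n => h^-1 * q ^+ n)).
- by apply: nearW => n; rewrite bnd andbT mulr_ge0// exprn_ge0// ltW.
- exact: cvg_cst.
- rewrite -(mulr0 h^-1); apply: cvgMr; apply: cvg_expr.
  by rewrite ger0_norm// ltW.
Qed.

(** If x > 0, then 2 u < 1 and Bernoulli's inequality gives the lower bound 1 - n (2 u)^n. If x <=
    0, then u^n >= 2^-n and the value is at most exp (- n). The factor n in the exponent settles the
    case x = 0, where 2 u = 1. *)
Lemma cvg_step_poly x : `|x| <= 1 -> (step_poly n).[x] @[n --> \oo] --> ((0 < x)%R%:R : R).
Proof.
move=> x1; have b01 n := step_poly01 n x1; move: x1.
rewrite ler_norml => /andP[x1 x2].
pose u := (1 - x) / 2.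
have u0 : 0 <= u by rewrite /u; lra.
have u1 : u <= 1 by rewrite /u; lra.
have bern (v : R) N : 0 <= v <= 1 -> 1 - N%:R * v <= (1 - v) ^+ N.
  move=> /andP[v0 v1]; elim: N => [|N IH]; first by rewrite mul0r subr0 expr0.
  rewrite exprS -[N.+1]add1n natrD.
  apply: (@le_trans _ _ ((1 - v) * (1 - N%:R * v))).
    have : 0 <= v * (N%:R * v) by rewrite !mulr_ge0//.
    lra.
  by rewrite ler_wpM2l// subr_ge0.
have [x0|x0] := ltP 0 x.
- apply: (@squeeze_cvgr _ _ _ _ (fun n => 1 - n%:R * (2 * u) ^+ n) (fun=> 1)).
  + apply: nearW => n; have /andP[_ ->] := b01 n; rewrite andbT step_polyE -/u.
    apply: le_trans (bern (u ^+ n) _ _); last by rewrite exprn_ge0//= exprn_ile1.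
    by rewrite exprMn natrM natrX mulrA.
  + rewrite -[X in _ --> X]subr0; apply: cvgB; first exact: cvg_cst.
    by apply: cvg_natmul_expr; rewrite /u; apply/andP; split; lra.
  + exact: cvg_cst.
- apply: (@squeeze_cvgr _ _ _ _ (fun=> 0) (fun n => expR (- n%:R))).
  + apply: nearW => n; have /andP[-> _] := b01 n; rewrite /= step_polyE -/u.
    have un : 2 ^- n <= u ^+ n.
      rewrite -exprVn; apply: lerXn2r; rewrite ?nnegrE// /u; lra.
    have un1 : u ^+ n <= 1 by rewrite exprn_ile1.
    have -> : - n%:R = - (2 ^- n) * (n * 2 ^ n)%:R :> R.
      by rewrite natrM natrX mulNr mulrCA mulVf ?mulr1// expf_neq0.
    rewrite expRM_natr; apply: lerXn2r; rewrite ?nnegrE ?expR_ge0 ?subr_ge0//.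
    by apply: le_trans (expR_ge1Dx _); rewrite lerD2l lerN2.
  + exact: cvg_cst.
  + exact: cvgn_expR.
Qed.

End step_polynomial.

Section polynomial_density.
Variable R : realType.
Notation RR := (measurableTypeR R).
Variable P : probability RR R.

Definition is_polyfun (f : R -> R) := exists p : {poly R}, f = horner p.

Let A := is_polyfun.

Lemma pbound_horner (p : {poly R}) : pbound (@wt R) (horner p).
Proof.
elim/poly_ind: p => [|p c IH].
  by rewrite (_ : horner _ = fun=> 0); [pbd|apply/funext => z; rewrite horner0].
rewrite (_ : horner _ = fun z => p.[z] * z + c); first by pbd.
by apply/funext => z; rewrite hornerMXaddC.
Qed.

Lemma measurable_horner (p : {poly R}) : measurable_fun (setT : set R) (horner p).
Proof. by apply: continuous_measurable_fun; exact: continuous_horner. Qed.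

Let mA (f : R -> R) : A f -> measurable_fun setT f.
Proof. by move=> [p ->]; exact: measurable_horner. Qed.

Let A_D (f g : R -> R) : A f -> A g -> A (fun x => f x + g x).
Proof. by move=> [p ->] [q ->]; exists (p + q); apply/funext => x; rewrite hornerD. Qed.

Let A_Z k (f : R -> R) : A f -> A (fun x => k * f x).
Proof. by move=> [p ->]; exists (k *: p); apply/funext => x; rewrite hornerZ. Qed.

Let A_1 : A (fun=> 1).
Proof. by exists 1; apply/funext => x; rewrite hornerC. Qed.

Lemma series_sin_coeff_le (x : R) N : `|series (sin_coeff x) N| <= expR `|x|.
Proof.
apply: (@le_trans _ _ (series (exp_coeff `|x|) N)).
  apply: (le_trans (ler_norm_sum _ _ _)); apply: ler_sum => i _.
  rewrite /sin_coeff /exp_coeff/= !normrM normfV normr_nat normrX normrN1 expr1n mulr1.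
  rewrite normrX [`|i`!%:R|]ger0_norm// ler_wpM2r ?invr_ge0//.
  by rewrite ler_piMl// lern1 leq_b1.
rewrite /expR; apply: nondecreasing_cvgn_le; last exact: is_cvg_series_exp_coeff.
by apply: nondecreasing_series => i _ _; exact: exp_coeff_ge0.
Qed.

Variable eta : R.
Hypothesis eta0 : 0 < eta.
Hypothesis Peta : intb P (fun y => expR (eta * `|y|)).

(** Half of [eta] absorbs exp (2 s |z|), the other half absorbs the polynomial. *)
Lemma horner_exp_int (q : {poly R}) C s : 0 <= C -> 4 * s <= eta ->
  intb P (fun z => C * (q.[z] ^+ 2 * expR (2 * s * `|z|))).
Proof.
move=> C0 seta; apply: intbZ.
have [D [d [D0 hq]]] := pboundX 2 (pbound_horner q).
have e2 : 0 < eta / 2 by rewrite divr_gt0.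
have [E E0 hE] := wtX_le_expR d e2.
have mq := measurable_horner q.
apply: (@intb_le _ _ _ (fun z => D * E * expR (eta * `|z|))).
- by mfun.
- move=> z; rewrite ger0_norm; last by rewrite mulr_ge0 ?sqr_ge0 ?expR_ge0.
  have -> : expR (eta * `|z|) = expR (eta / 2 * `|z|) * expR (eta / 2 * `|z|).
    by rewrite -expRD; congr expR; field.
  rewrite mulrA; apply: ler_pM; rewrite ?sqr_ge0 ?expR_ge0//.
    apply: le_trans (ler_norm _) _; apply: le_trans (hq z) _.
    by rewrite -mulrA ler_wpM2l.
  by rewrite ler_expR ler_wpM2r//; lra.
- exact: intbZ.
Qed.

(* For s small, the power series of sin (s (z - a)) converges to it boundedly enough for
   multiplication by this sine to preserve [multiplier]; the polynomials [step_poly] of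
   the sine then produce the indicators of the sets where it is positive. *)
Definition multiplier (psi : R -> R) := [/\ measurable_fun setT psi,
  exists M, forall z, `|psi z| <= M &
  forall q : {poly R}, L2cl P A (fun z => q.[z] * psi z)].

Lemma multiplier1 : multiplier (fun=> 1).
Proof.
split => //; first by exists 1 => z; rewrite normr1.
by move=> q; apply: L2cl_sub; [exact: mA|]; exists q; apply/funext => z; rewrite mulr1.
Qed.

Lemma multiplierZ k psi : multiplier psi -> multiplier (fun z => k * psi z).
Proof.
move=> [mp [M hM] H]; split; first by mfun.
- by exists (`|k| * M) => z; rewrite normrM ler_wpM2l.
- move=> q; under eq_fun do rewrite mulrCA.
  exact: (L2clZ mA A_Z).
Qed.

Lemma multiplierD psi phi : multiplier psi -> multiplier phi ->
  multiplier (fun z => psi z + phi z).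
Proof.
move=> [mp [M hM] H] [mp' [M' hM'] H']; split; first by mfun.
- by exists (M + M') => z; rewrite (le_trans (ler_normD _ _))// lerD.
- move=> q; under eq_fun do rewrite mulrDr.
  exact: (L2clD mA A_D).
Qed.

Lemma multiplier_sin s a psi : 0 < s -> 4 * s <= eta -> multiplier psi ->
  multiplier (fun z => psi z * sin (s * (z - a))).
Proof.
move=> s0 seta [mp [M hM] H].
have msin : measurable_fun setT (fun z : R => sin (s * (z - a))).
  apply: measurableT_comp; last by mfun.
  by apply: continuous_measurable_fun; exact: continuous_sin.
split; first exact: measurable_funM.
- exists M => z; rewrite normrM -[M]mulr1; apply: ler_pM => //.
  by rewrite ler_norml sin_geN1 sin_le1.
move=> q.
pose pN N : {poly R} := \sum_(0 <= i < N)
  (((odd i)%:R * (-1) ^+ i.-1./2 / i`!%:R)%:P * (s%:P * ('X - a%:P)) ^+ i).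
have pNE N z : (pN N).[z] = series (sin_coeff (s * (z - a))) N.
  rewrite horner_sum; apply: eq_bigr => i _.
  rewrite /sin_coeff hornerM hornerC horner_exp !hornerE/= mulrAC//.
pose M' := Num.max M 0.
have M0 : 0 <= M' by rewrite le_max lexx orbT.
have hM' z : `|psi z| <= M' by rewrite le_max hM.
(* The sine and its partial sums are both at most exp |x|, with |x| <= s |a| + s |z|. This [g] is
   the square of 2 exp (s |a| + s |z|) M' q(z), and is integrable because 4 s <= eta. *)
pose g z := (4 * M' ^+ 2 * expR (2 * s * `|a|)) * (q.[z] ^+ 2 * expR (2 * s * `|z|)).
apply: (L2cl_dominated mA (f_ := fun N z => q.[z] * (psi z * (pN N).[z])) (g := g)).
- move=> N; have := H (q * pN N); congr L2cl; apply/funext => z.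
  by rewrite hornerM; ring.
- move=> z; under eq_fun do rewrite pNE.
  apply: cvgMr; apply: cvgMr; rewrite sin.unlock.
  exact: is_cvg_series_sin_coeff.
- by apply: horner_exp_int => //; rewrite !mulr_ge0 ?expR_ge0 ?sqr_ge0.
- move=> N z; rewrite pNE.
  set x := s * (z - a); set S := series _ _.
  have hx : `|x| <= s * `|a| + s * `|z|.
    rewrite /x normrM gtr0_norm// -mulrDr ler_wpM2l ?(ltW s0)//.
    by rewrite [leRHS]addrC ler_normB.
  have hs : `|sin x - S| <= 2 * expR `|x|.
    apply: (le_trans (ler_normB _ _)); rewrite mulr_natl mulr2n lerD//.
      apply: (@le_trans _ _ 1); first by rewrite ler_norml sin_geN1 sin_le1.
      by rewrite -expR0 ler_expR.
    exact: series_sin_coeff_le.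
  have -> : g z = (2 * expR (s * `|a| + s * `|z|) * M' * q.[z]) ^+ 2.
    rewrite /g !exprMn -expRM_natl (_ : 2%:R * (s * `|a| + s * `|z|) = 2 * s * `|a| + 2 * s * `|z|); last by ring.
    by rewrite expRD; ring.
  have -> : q.[z] * (psi z * sin x) - q.[z] * (psi z * S) = (sin x - S) * psi z * q.[z] by ring.
  rewrite [leLHS]exprMn [leRHS]exprMn ler_wpM2r ?sqr_ge0//.
  rewrite -(real_normK (num_real (_ * psi z))) normrM; apply: lerXn2r; rewrite ?nnegrE ?mulr_ge0 ?expR_ge0//.
  apply: ler_pM => //; apply: (le_trans hs).
  by rewrite ler_wpM2l// ler_expR.
Qed.

(** Horner's scheme: each stage multiplies by the sine and adds a constant, and both operations
    preserve [multiplier]. *)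
Lemma multiplier_sin_poly s a (Q : {poly R}) : 0 < s -> 4 * s <= eta ->
  multiplier (fun z => Q.[sin (s * (z - a))]).
Proof.
move=> s0 seta; elim/poly_ind: Q => [|Q c IH].
  have := multiplierZ 0 multiplier1; congr multiplier; apply/funext => z.
  by rewrite horner0 mul0r.
have := multiplierD (multiplier_sin a s0 seta IH) (multiplierZ c multiplier1).
by congr multiplier; apply/funext => z; rewrite hornerMXaddC mulr1.
Qed.

Lemma L2cl_sin_pos s a : 0 < s -> 4 * s <= eta ->
  L2cl P A (fun z => (0 < sin (s * (z - a)))%R%:R).
Proof.
move=> s0 seta.
have s1 z : `|sin (s * (z - a))| <= 1 by rewrite ler_norml sin_geN1 sin_le1.
apply: (L2cl_dominated mA (f_ := fun n z => (step_poly R n).[sin (s * (z - a))]) (g := fun=> 1)).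
- move=> n; have [_ _ /(_ 1)] := multiplier_sin_poly a (step_poly R n) s0 seta.
  by congr L2cl; apply/funext => z; rewrite hornerC mul1r.
- by move=> z; exact: cvg_step_poly.
- exact: intb_cst.
- move=> n z; have /andP[h0 h1] := step_poly01 n (s1 z).
  rewrite -(real_normK (num_real _)) expr_le1// ler_norml.
  by case: (0 < sin _) => /=; apply/andP; split; lra.
Qed.

(** The sign of sin (s (z - a)) is that of z - a once s |z - a| < pi. Letting s tend to 0 makes this
    hold eventually at every z. *)
Lemma L2cl_ray a : L2cl P A (fun z => (a < z)%R%:R).
Proof.
pose s j := eta / 4 / j.+1%:R.
have s0 j : 0 < s j by rewrite !divr_gt0.
have s4 j : 4 * s j <= eta.
  have -> : 4 * s j = eta / j.+1%:R by rewrite /s; move: (j.+1%:R^-1) => k; field.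
  rewrite ler_pdivrMr// ler_peMr ?(ltW eta0)//.
  by rewrite ler1n.
apply: (L2cl_dominated mA (f_ := fun j z => (0 < sin (s j * (z - a)))%R%:R) (g := fun=> 1)).
- by move=> j; exact: L2cl_sin_pos.
- move=> z; apply: cvg_near_cst.
  have : \forall j \near \oo, s j * `|z - a| < pi.
    have : s j * `|z - a| @[j --> \oo] --> (0 : R).
      rewrite -(mul0r `|z - a|); apply: cvgMl; rewrite /s -(mulr0 (eta / 4)).
      apply: cvgMr; exact: cvg_harmonic.
    by move/cvgr_lt; apply; exact: pi_gt0.
  apply: filterS => j hj.
  have [az|za] := ltP a z.
    rewrite sin_gt0_pi// mulr_gt0 ?subr_gt0//=.
    by move: hj; rewrite gtr0_norm// subr_gt0.
  apply/eqP; rewrite pnatr_eq0 eqb0 -leNgt -oppr_ge0 -sinN sin_ge0_pi//.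
  rewrite -mulrN opprB mulr_ge0 ?subr_ge0 ?(ltW (s0 _))//=.
  by move: hj; rewrite ler0_norm ?subr_le0// opprB => /ltW.
- exact: intb_cst.
- by move=> j z; case: (a < z); case: (0 < sin _); rewrite /= ?subrr ?subr0 ?sub0r ?sqrrN ?expr1n ?expr0n.
Qed.

Lemma polynomial_density (f : R -> R) e : measurable_fun setT f ->
  intb P (fun x => f x ^+ 2) -> 0 < e ->
  exists p : {poly R}, (\int[P]_x ((f x - p.[x]) ^+ 2)%:E < e%:E)%E.
Proof.
move=> mf if2 e0; have [_ /(_ _ e0)] := L2cl_total mA A_D A_Z A_1 L2cl_ray mf if2.
by move=> [_ [p ->] h]; exists p.
Qed.

End polynomial_density.

(** * Polynomial estimators *)

Section mean_square_error.
Variable R : realType.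
Notation RR := (measurableTypeR R).
Variable P : probability RR R.
Hypothesis eP : exp_moment P.

Let mP : moments P. Proof. exact: exp_moment_moments. Qed.

(** E[(Y - phi(c Y + N))^2], with the law of c y + N written as a tilt of N(0,1). *)
Definition mse (c : R) (phi : R -> R) :=
  \int[P]_y \int[gam R]_z (kap (c * y) z * (y - phi z) ^+ 2).

(** E[(Y - E[Y | Z])^2] with Z = c Y + N, by orthogonality of Y - E[Y | Z] and E[Y | Z]. *)
Definition mmse c := mom2 P - Mn2 P c.

Section pythagoras.
Variables (c : R) (phi : R -> R).
Hypotheses (c0 : 0 < c) (mphi : measurable_fun setT phi) (pphi : pbound (@wt R) phi).

Lemma mfun2_sqerr : mfun2 (fun y z => (y - phi z) ^+ 2).
Proof.
apply: measurable_funX; apply: measurable_funB; first exact: measurable_fst.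
exact: mfun2_snd mphi.
Qed.

Lemma pbound_sqerr : pbound (@wt2 R) (fun q => (q.1 - phi q.2) ^+ 2).
Proof. by apply: pboundX; apply: pboundB; [pbd|pbd|exact: pbound_snd]. Qed.

Lemma Lam_sqerr_int : intb (gam R) (fun z => Lam P c z * (Mn P c z - phi z) ^+ 2).
Proof.
apply: Lam_int => //.
- by apply: measurable_funX; apply: measurable_funB => //; exact: measurable_Mn.
- by apply: pboundX; apply: pboundB => //; [pbd|exact: pbound_Mn].
Qed.

(** Pythagoras, pointwise in z: the square is expanded under the integral over y, and [Mn_Lam]
    replaces the mean of y in the cross term. *)
Lemma mseE : mse c phi =
  mmse c + \int[gam R]_z (Lam P c z * (Mn P c z - phi z) ^+ 2).
Proof.
rewrite /mse -(channel_Fubini mP mfun2_sqerr pbound_sqerr).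
have my2 : measurable_fun (setT : set R) (fun y => y ^+ 2) by mfun.
have py2 : pbound (@wt R) (fun y => y ^+ 2) by pbd.
have i1 := channel_int mP (mfun2_fst my2) (pbound_fst py2) c.
have i2 := Mn2_int mP c0.
have i3 := Lam_sqerr_int.
rewrite /mmse /mom2 -(Lam_mean mP c my2 py2) /Mn2 -RintB// -RintD//; last exact: intbB.
apply: eq_Rint => z.
have j1 := kap_int mP c z; have j2 := kapy_int mP c z.
have j3 := P_tilt_int mP c z my2 py2.
have E y : kap (c * y) z * (y - phi z) ^+ 2 =
    (kap (c * y) z * y ^+ 2 - 2 * phi z * (kap (c * y) z * y)) + phi z ^+ 2 * kap (c * y) z by ring.
rewrite (eq_Rint _ E) RintD; [|by apply: intbB => //; exact: intbZ|exact: intbZ].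
rewrite RintB//; last exact: intbZ.
rewrite (RintZ _ j1) (RintZ _ j2) -/(Lam P c z) -/(Lam1 P c z).
by have <- := Mn_Lam mP c z; ring.
Qed.

Lemma mse_ge : mmse c <= mse c phi.
Proof.
rewrite mseE lerDl; apply: Rintegral_ge0 => z _.
by rewrite mulr_ge0 ?sqr_ge0// ltW// Lam_gt0.
Qed.

Lemma mse_EFin : (\int[P]_y \int[gam R]_z (kap (c * y) z * (y - phi z) ^+ 2)%:E =
  (mse c phi)%:E)%E.
Proof.
rewrite EFin_Rint; last exact: (channel_int_P mP mfun2_sqerr pbound_sqerr).
apply: eq_integral => y _; rewrite EFin_Rint//.
exact: (channel_intl mfun2_sqerr pbound_sqerr c y).
Qed.

End pythagoras.

Section output_law.
Variable c : R.
Hypothesis c0 : 0 < c.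

Lemma output_density : is_density (fun z => Lam P c z * gauss z).
Proof.
have mL := measurable_Lam P c; have mg := @measurable_gauss R.
split; first exact: measurable_funM.
split; first by move=> z; rewrite mulr_ge0 ?gauss_ge0// ltW// Lam_gt0.
under eq_integral do rewrite EFinM.
rewrite -(ge0_integral_dens (gauss_density R) (f := fun z => (Lam P c z)%:E)).
- have := Rint_Lam mP c; have := EFin_Rint (Lam_int1 mP c) => <- ->; done.
- exact/measurable_EFinP.
- by move=> z; rewrite lee_fin ltW// Lam_gt0.
Qed.

Let PZ : probability RR R := dens output_density.

Lemma integral_output (f : R -> R) : measurable_fun setT f -> (forall z, 0 <= f z) ->
  (\int[PZ]_z (f z)%:E = \int[gam R]_z (Lam P c z * f z)%:E)%E.
Proof.
move=> mf f0; have mL := measurable_Lam P c.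
rewrite !ge0_integral_dens//.
- by apply: eq_integral => z _; rewrite -!EFinM; congr EFin; ring.
- by apply/measurable_EFinP; exact: measurable_funM.
- by move=> z; rewrite lee_fin mulr_ge0// ltW// Lam_gt0.
- exact/measurable_EFinP.
Qed.

(** After translation z = v + c y, the choice of [th] gives th |z| <= |v| + eta |y|, so the double
    integral is bounded by a product. *)
Lemma exp_moment_output : exp_moment PZ.
Proof.
have [eta eta0 h] := eP.
pose th := Num.min 1 (eta / c).
have th0 : 0 < th by rewrite lt_min ltr01 divr_gt0.
have th1 : th <= 1 by rewrite ge_min lexx.
have thc : th * c <= eta by rewrite -ler_pdivlMr// ge_min lexx orbT.
exists th => //.
rewrite integral_output//; last by mfun.
have me : mfun2 (fun y z : R => (kap (c * y) z * expR (th * `|z|))%:E).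
  apply/measurable_EFinP; apply: measurable_funM; last by mfun.
  exact: mfun2_kap.
have k0 y z : (0 <= (kap (c * y) z * expR (th * `|z|))%:E)%E.
  by rewrite lee_fin; apply: mulr_ge0; [exact: kap_ge0|exact: expR_ge0].
rewrite (_ : (\int[gam R]_z _ = \int[gam R]_z \int[P]_y (kap (c * y) z * expR (th * `|z|))%:E)%E); last first.
  apply: eq_integral => z _; rewrite mulrC -RintZ; last exact: kap_int.
  rewrite EFin_Rint; last by apply: intbZ; exact: kap_int.
  by apply: eq_integral => y _; rewrite mulrC.
rewrite -(tonelli P (gam R) me k0).
pose M := \int[gam R]_z expR (1 * `|z|).
have ig : intb (gam R) (fun z => expR (1 * `|z|)).
  by apply: ge0_intb (@gam_exp_lty R); [mfun|move=> z; exact: expR_ge0].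
apply: (@le_lt_trans _ _ (\int[P]_y (M%:E * (expR (eta * `|y|))%:E))%E).
  apply: ge0_le_integral => //.
  - by move=> y _; apply: integral_ge0 => z _; exact: k0.
  - exact: (measurable_tonelli (gam R) me k0).
  - by apply/measurable_EFinP; mfun.
  move=> y _.
  under eq_integral do rewrite EFinM.
  rewrite (@ge0_integral_gam_shift R (c * y) (fun z => (expR (th * `|z|))%:E))//; last first.
    by apply/measurable_EFinP; mfun.
  rewrite /M EFin_Rint// muleC -ge0_integralZl//; last by apply/measurable_EFinP; mfun.
  apply: ge0_le_integral => //.
  - by apply/measurable_EFinP; mfun.
  - by apply/measurable_EFinP; mfun.
  move=> z _; rewrite -EFinM lee_fin -expRD ler_expR.
  apply: (@le_trans _ _ (th * (`|z| + `|c * y|))); first by rewrite ler_wpM2l ?ler_normD// ltW.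
  rewrite mulrDr addrC lerD//; last by rewrite ler_wpM2r.
  by rewrite normrM gtr0_norm// mulrA ler_wpM2r.
rewrite ge0_integralZl//; last 2 first.
- by apply/measurable_EFinP; mfun.
- by rewrite lee_fin; apply: Rintegral_ge0 => z _; exact: expR_ge0.
by rewrite lte_mul_pinfty// lee_fin; apply: Rintegral_ge0 => z _; exact: expR_ge0.
Qed.

(** The excess of [mse] over [mmse] is the squared L2 distance of [phi] to [Mn] under the law of the
    output, where polynomials are dense. *)
Lemma mse_approx e : 0 < e -> exists p : {poly R}, mse c (horner p) <= mmse c + e.
Proof.
move=> e0; have [eta eta0 h] := exp_moment_output.
have mM := measurable_Mn P c; have pM := pbound_Mn mP c0.
have ih : intb PZ (fun y => expR (eta * `|y|)) by apply: ge0_intb => //; mfun.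
have iM : intb PZ (fun z => Mn P c z ^+ 2).
  apply: moments_intb; first exact/exp_moment_moments/exp_moment_output.
  - exact: measurable_funX.
  - exact: pboundX.
have [p hp] := polynomial_density eta0 ih mM iM e0.
have mp := measurable_horner p; have pp := pbound_horner p.
exists p; rewrite mseE// lerD2l -lee_fin EFin_Rint; last exact: Lam_sqerr_int.
rewrite -integral_output; first exact: ltW.
- by apply: measurable_funX; exact: measurable_funB.
- by move=> z; exact: sqr_ge0.
Qed.

End output_law.

Lemma mmse_le_inv c : 0 < c -> mse c (fun z => z / c) <= c ^- 2.
Proof.
move=> c0.
have mphi : measurable_fun (setT : set R) (fun z => z / c) by mfun.
have pphi : pbound (@wt R) (fun z => z / c) by pbd.
rewrite /mse -(Rint_cst P (c ^- 2)); apply: le_Rint.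
- exact: (channel_int_P mP (mfun2_sqerr mphi) (pbound_sqerr pphi)).
- exact: intb_cst.
move=> y; rewrite Rint_gam_shift; last 2 first.
- by mfun.
- by pbd.
rewrite (_ : \int[gam R]_v _ = \int[gam R]_v (c ^- 2 * v ^+ 2)).
  rewrite RintZ; last by apply: gam_intb; [mfun|pbd].
  by rewrite -[leRHS]mulr1 ler_wpM2l ?gam_var_le// invr_ge0 exprn_ge0// ltW.
by apply: eq_Rint => v; field; rewrite gt_eqF.
Qed.

Lemma mse0 c : mse c (fun=> 0) = mom2 P.
Proof.
rewrite /mse; apply: eq_Rint => y.
rewrite -[RHS]mulr1 -(gam_int_kap (c * y)) -RintZ; last exact: gam_kap_intb.
by apply: eq_Rint => v; rewrite subr0 mulrC.
Qed.

End mean_square_error.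

(** * Bounds, limit and measurability of [pmmse] *)

Section pmmse.
Variable R : realType.
Notation RR := (measurableTypeR R).
Notation mu := (@lebesgue_measure R).
Variables (g : R -> R) (hg : is_density g).

Let P : probability RR R := dens hg.
Hypothesis eP : exp_moment P.

Let mP : moments P. Proof. exact: exp_moment_moments. Qed.

Definition coef_fun n (c : 'I_n.+1 -> R) (z : R) : R := \sum_(k < n.+1) c k * z ^+ k.

Lemma coef_funE n (c : 'I_n.+1 -> R) :
  coef_fun c = horner (\sum_(k < n.+1) c k *: 'X^k).
Proof.
apply/funext => z; rewrite horner_sum; apply: eq_bigr => k _.
by rewrite hornerZ hornerXn.
Qed.

Lemma measurable_coef_fun n (c : 'I_n.+1 -> R) : measurable_fun setT (coef_fun c).
Proof. by rewrite coef_funE; exact: measurable_horner. Qed.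

Lemma pbound_coef_fun n (c : 'I_n.+1 -> R) : pbound (@wt R) (coef_fun c).
Proof. by rewrite coef_funE; exact: pbound_horner. Qed.

Lemma poly_mse_dens t n (c : 'I_n.+1 -> R) : poly_mse g t c =
  (\int[P]_r \int[gam R]_z (kap (Num.sqrt t * r) z * (r - coef_fun c z) ^+ 2)%:E)%E.
Proof.
have mc := measurable_coef_fun c; have mg : measurable_fun setT g by have [] := hg.
have m3 : mfun2 (fun r z => (kap (Num.sqrt t * r) z * (r - coef_fun c z) ^+ 2)%:E).
  apply/measurable_EFinP; apply: measurable_funM; first exact: mfun2_kap.
  exact: mfun2_sqerr.
have p3 r z : (0 <= (kap (Num.sqrt t * r) z * (r - coef_fun c z) ^+ 2)%:E)%E.
  by rewrite lee_fin mulr_ge0 ?kap_ge0 ?sqr_ge0.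
rewrite ge0_integral_dens; first last.
- by move=> r; exact: integral_ge0.
- exact: (measurable_tonelli (gam R) m3).
rewrite /poly_mse; apply: eq_integral => r _; rewrite muleC; congr (_ * _)%E.
rewrite ge0_integral_dens//; last exact: (mfun2_r r m3).
apply: eq_integral => z _; rewrite -EFinM gauss_shift; congr EFin.
by rewrite -/(coef_fun c z); ring.
Qed.

Lemma poly_mseE t n (c : 'I_n.+1 -> R) : 0 < t ->
  poly_mse g t c = (mse P (Num.sqrt t) (coef_fun c))%:E.
Proof.
move=> t0; rewrite poly_mse_dens mse_EFin//.
- exact: measurable_coef_fun.
- exact: pbound_coef_fun.
Qed.

Lemma pmmse_ge n t : 0 < t -> ((mmse P (Num.sqrt t))%:E <= pmmse g n t)%E.
Proof.
move=> t0; apply: le_ereal_inf_tmp => _ [c _ <-].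
rewrite poly_mseE// lee_fin mse_ge// ?sqrtr_gt0//.
- exact: measurable_coef_fun.
- exact: pbound_coef_fun.
Qed.

Lemma pmmse_le_horner n t (p : {poly R}) : 0 < t -> (size p <= n.+1)%N ->
  (pmmse g n t <= (mse P (Num.sqrt t) (horner p))%:E)%E.
Proof.
move=> t0 pn.
have E : coef_fun (fun k : 'I_n.+1 => p`_k) = horner p.
  by apply/funext => z; rewrite /coef_fun (horner_coef_wide z pn).
apply: ereal_inf_lbound; exists (fun k : 'I_n.+1 => p`_k); first by [].
by rewrite (poly_mseE _ t0) E.
Qed.

Lemma pmmse_le_mom2 n t : 0 < t -> (pmmse g n t <= (mom2 P)%:E)%E.
Proof.
move=> t0; apply: (@le_trans _ _ (mse P (Num.sqrt t) (horner 0))%:E).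
  by apply: pmmse_le_horner => //; rewrite size_poly0.
rewrite (_ : horner 0 = fun=> 0) ?mse0//.
by apply/funext => z; rewrite horner0.
Qed.

(** The estimator z / sqrt t has degree 1, hence the index n + 1. *)
Lemma pmmse_le_inv n t : 0 < t -> (pmmse g n.+1 t <= (t^-1)%:E)%E.
Proof.
move=> t0; apply: (@le_trans _ _ (mse P (Num.sqrt t) (horner ((Num.sqrt t)^-1 *: 'X)))%:E).
  apply: pmmse_le_horner => //; apply: (leq_trans (size_scale_leq _ _)).
  by rewrite size_polyX.
have -> : t^-1 = Num.sqrt t ^- 2 by rewrite sqr_sqrtr// ltW.
rewrite lee_fin (_ : horner _ = fun z => z / Num.sqrt t); last first.
  by apply/funext => z; rewrite hornerZ hornerX mulrC.
by apply: mmse_le_inv => //; rewrite sqrtr_gt0.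
Qed.

Lemma pmmse_fin n t : 0 < t -> pmmse g n t \is a fin_num.
Proof.
move=> t0; rewrite fin_real//; apply/andP; split.
  exact: lt_le_trans (ltNyr _) (pmmse_ge n t0).
exact: le_lt_trans (pmmse_le_mom2 n t0) (ltry _).
Qed.

Lemma cvg_pmmse t : 0 < t ->
  fine (pmmse g n t) @[n --> \oo] --> mmse P (Num.sqrt t).
Proof.
move=> t0; apply/cvgrPdist_le => e e0.
have c0 : 0 < Num.sqrt t by rewrite sqrtr_gt0.
have [p hp] := mse_approx eP c0 e0.
exists (size p) => // n /= pn.
have h1 := pmmse_ge n t0; have h2 := pmmse_le_horner t0 (leqW pn).
have := pmmse_fin n t0; move: h1 h2; case: (pmmse g n t) => //= r.
rewrite !lee_fin => h1 h2 _; rewrite distrC ger0_norm ?subr_ge0//.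
by rewrite lerBlDl; exact: le_trans hp.
Qed.

Section measurability.
Variable n : nat.

(** The infimum in [pmmse] runs over an uncountable set. This enumeration of the rational
    coefficient vectors replaces it by a countable infimum, which is measurable in t. *)
Let decode (j : nat) : 'I_n.+1 -> R :=
  if unpickle j is Some c then (fun k => ratr ((c : {ffun 'I_n.+1 -> rat}) k)) else (fun=> 0).

Lemma measurable_poly_mse (c : 'I_n.+1 -> R) :
  measurable_fun (setT : set R) (fun t => poly_mse g t c).
Proof.
under eq_fun do rewrite poly_mse_dens.
pose F (q : (RR * RR) * RR) : \bar R :=
  (kap (Num.sqrt q.1.1 * q.1.2) q.2 * (q.1.2 - coef_fun c q.2) ^+ 2)%:E.
have mc := measurable_coef_fun c.
have ms : measurable_fun setT (@Num.sqrt R).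
  by apply: continuous_measurable_fun; exact: sqrt_continuous.
have mF : measurable_fun setT F.
  apply/measurable_EFinP; rewrite /kap.
  have m11 : measurable_fun setT (fun q : (RR * RR) * RR => q.1.1 : R).
    exact: (measurableT_comp (@measurable_fst _ _ RR RR) (@measurable_fst _ _ (RR * RR)%type RR)).
  have m12 : measurable_fun setT (fun q : (RR * RR) * RR => q.1.2 : R).
    exact: (measurableT_comp (@measurable_snd _ _ RR RR) (@measurable_fst _ _ (RR * RR)%type RR)).
  have m2 : measurable_fun setT (fun q : (RR * RR) * RR => q.2 : R) by exact: measurable_snd.
  have m3 : measurable_fun setT (fun q : (RR * RR) * RR => Num.sqrt (q.1.1 : R)).
    exact: measurableT_comp.
  have m4 : measurable_fun setT (fun q : (RR * RR) * RR => coef_fun c q.2).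
    exact: (measurableT_comp mc).
  by mfun.
have F0 q : (0 <= F q)%E by rewrite lee_fin mulr_ge0 ?kap_ge0 ?sqr_ge0.
have := @measurable_fun_fubini_tonelli_F _ _ (RR * RR)%type RR R (gam R) F mF F0.
move=> mG.
have mG2 : mfun2 (fun t r => \int[gam R]_z F ((t, r), z))%E.
  by apply: eq_measurable_fun mG => -[t r] _.
have G0 t r : (0 <= \int[gam R]_z F ((t, r), z))%E by apply: integral_ge0 => z _; exact: F0.
exact: (measurable_tonelli P mG2 G0).
Qed.

(** Uses (a + b)^2 <= (1 + th) a^2 + (1 + 1/th) b^2, with a the distance of [c] to [Mn] and b the
    effect of rounding the coefficients, at most dl times the sum of the |z|^k. [D] and [K] are the
    corresponding integrals. *)
Lemma poly_mse_rat t (c : 'I_n.+1 -> R) e : 0 < t -> 0 < e ->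
  exists j, (poly_mse g t (decode j) <= poly_mse g t c + e%:E)%E.
Proof.
move=> t0 e0; have cc0 : 0 < Num.sqrt t by rewrite sqrtr_gt0.
set cc := Num.sqrt t in cc0.
pose S (z : R) : R := (\sum_(k < n.+1) `|z| ^+ k) ^+ 2.
have mS : measurable_fun setT S.
  apply: measurable_funX; apply: measurable_sum => k _; by mfun.
have pS : pbound (@wt R) S.
  apply: pboundX; rewrite (_ : (fun _ => _) = (fun z => (\sum_(k < n.+1) 'X^k).[`|z|])).
    by apply: (pbound_comp _ (pbound_horner _)); pbd.
  by apply/funext => z; rewrite horner_sum; apply: eq_bigr => k _; rewrite hornerXn.
have S0 z : 0 <= S z by exact: sqr_ge0.
have iS := Lam_int mP cc mS pS.
have mc := measurable_coef_fun c; have pc := pbound_coef_fun c.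
have iD := Lam_sqerr_int eP cc0 mc pc.
set K := \int[gam R]_z (Lam P cc z * S z) in iS.
set D := \int[gam R]_z (Lam P cc z * (Mn P cc z - coef_fun c z) ^+ 2) in iD.
have L0 z := ltW (Lam_gt0 mP cc z).
have K0 : 0 <= K by apply: Rintegral_ge0 => z _; rewrite mulr_ge0.
have D0 : 0 <= D by apply: Rintegral_ge0 => z _; rewrite mulr_ge0// sqr_ge0.
(* Chosen so that th D <= e / 2. Likewise [dl] makes (1 + 1/th) dl^2 K <= B dl <= e / 2, where dl <=
   1 is used. The added 1 covers the cases D = 0 and K = 0. *)
pose th := e / (2 * (D + 1)).
have th0 : 0 < th by rewrite divr_gt0// mulr_gt0// ltr_wpDl.
pose B := (1 + th^-1) * (K + 1).
have B0 : 0 < B by rewrite mulr_gt0// ltr_wpDl// invr_gt0.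
pose dl := Num.min 1 (e / (2 * B)).
have dl0 : 0 < dl by rewrite lt_min ltr01 divr_gt0// mulr_gt0.
have dl1 : dl <= 1 by rewrite ge_min lexx.
have dle : dl <= e / (2 * B) by rewrite ge_min lexx orbT.
have ex k : exists q : rat, `|c k - ratr q| <= dl.
  have lt_c : c k - dl < c k + dl by lra.
  have [q] := rat_in_itvoo lt_c.
  rewrite in_itv/= => /andP[h1 h2]; exists q; rewrite ler_norml; apply/andP; split; lra.
pose q := [ffun k => projT1 (cid (ex k))].
have hq k : `|c k - ratr (q k)| <= dl by rewrite ffunE; exact: projT2 (cid (ex k)).
exists (pickle q); rewrite !poly_mseE// -EFinD lee_fin.
have -> : decode (pickle q) = (fun k => ratr (q k)) by rewrite /decode pickleK.
set c' := fun k => ratr (q k).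
have mc' := measurable_coef_fun c'; have pc' := pbound_coef_fun c'.
rewrite (mseE eP cc0 mc' pc') (mseE eP cc0 mc pc) -[leRHS]addrA lerD2l -/D.
have iD' := Lam_sqerr_int eP cc0 mc' pc'.
apply: (@le_trans _ _ ((1 + th) * D + ((1 + th^-1) * dl ^+ 2) * K)).
  rewrite -(RintZ _ iD) -(RintZ _ iS) -RintD//; [|exact: intbZ..].
  apply: le_Rint => //; first by apply: intbD; exact: intbZ.
  move=> z; set a := Mn P cc z - coef_fun c z; set b := coef_fun c z - coef_fun c' z.
  have -> : Mn P cc z - coef_fun c' z = a + b by rewrite /a /b; ring.
  have hb : b ^+ 2 <= dl ^+ 2 * S z.
    rewrite -(real_normK (num_real b)) /S -exprMn; apply: lerXn2r; rewrite ?nnegrE//.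
      by rewrite mulr_ge0 ?sumr_ge0// ?ltW.
    rewrite /b /coef_fun -sumrB mulr_sumr; apply: (le_trans (ler_norm_sum _ _ _)).
    by apply: ler_sum => k _; rewrite -mulrBl normrM normrX ler_wpM2r// exprn_ge0.
  have h : (a + b) ^+ 2 <= (1 + th) * a ^+ 2 + (1 + th^-1) * (dl ^+ 2 * S z).
    apply: (@le_trans _ _ ((1 + th) * a ^+ 2 + (1 + th^-1) * b ^+ 2)).
      have := sqr_ge0 (Num.sqrt th * a - (Num.sqrt th)^-1 * b).
      have s0 : 0 < Num.sqrt th by rewrite sqrtr_gt0.
      have -> : (Num.sqrt th * a - (Num.sqrt th)^-1 * b) ^+ 2 =
          Num.sqrt th ^+ 2 * a ^+ 2 - 2 * a * b + (Num.sqrt th ^+ 2)^-1 * b ^+ 2.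
        by field; rewrite gt_eqF.
      rewrite sqr_sqrtr ?(ltW th0)//.
      by move: (th^-1) => ti; lra.
    by rewrite lerD2l ler_wpM2l// addr_ge0// invr_ge0 ltW.
  have := ler_wpM2l (L0 z) h.
  by move: (Lam P cc z) (S z) (th^-1) => l s ti; lra.
have h1 : th * D <= e / 2.
  rewrite /th mulrAC ler_pdivrMr ?mulr_gt0 ?ltr_wpDl//.
  rewrite mulrA divfK// ler_wpM2l ?(ltW e0)// lerDl//.
have h2 : (1 + th^-1) * dl ^+ 2 * K <= e / 2.
  apply: (@le_trans _ _ (B * dl)).
    rewrite /B mulrAC -mulrA [_ * dl]mulrAC -[leRHS]mulrA ler_wpM2l ?addr_ge0 ?invr_ge0 ?(ltW th0)//.
    apply: (@le_trans _ _ (K * dl)).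
      by rewrite ler_wpM2l// expr2 ler_piMr// ltW.
    by rewrite mulrC ler_wpM2l ?(ltW dl0)// lerDl.
  apply: (le_trans (ler_wpM2l (ltW B0) dle)).
  by rewrite le_eqVlt; apply/orP; left; apply/eqP; field; rewrite gt_eqF.
by rewrite mulrDl mul1r; lra.
Qed.

Lemma measurable_pmmse : measurable_fun (`]0, +oo[%classic : set R) (pmmse g n).
Proof.
have mE := @measurable_fun_einfs _ RR R `]0, +oo[%classic
  (fun j t => poly_mse g t (decode j)) (fun j => measurable_funTS (measurable_poly_mse (decode j))) 0%N.
apply: eq_measurable_fun mE => t; rewrite inE/= in_itv/= andbT => t0.
rewrite /einfs /sdrop; apply/eqP; rewrite eq_le; apply/andP; split.
  apply: le_ereal_inf_tmp => _ [c _ <-]; apply/lee_addgt0Pr => e e0.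
  have [j hj] := poly_mse_rat c t0 e0; apply: le_trans hj.
  by apply: ereal_inf_lbound; exists j.
apply: le_ereal_inf => _ [j _ <-]; by exists (decode j).
Qed.

End measurability.

End pmmse.

(** The convention 0 ln 0 = 0 extends the tangent inequality to densities that vanish. *)
Lemma xlnx_tangent0 (R : realType) (x b : R) : 0 <= x -> 0 < b ->
  x * ln b + x - b <= x * ln x.
Proof.
rewrite le_eqVlt => /predU1P[<-|x0] b0; last exact: xlnx_tangent.
by rewrite !mul0r add0r sub0r oppr_le0 ltW.
Qed.

(** * Relative entropy of the outputs *)

Section relative_entropy.
Variable R : realType.
Notation RR := (measurableTypeR R).
Variables (P0 P1 : probability RR R) (r : R -> R) (C : R).
Hypothesis mP0 : moments P0.
Hypothesis mr : measurable_fun setT r.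
Hypothesis rC : forall y, 0 <= r y <= C.
Hypothesis P1E : forall F : R -> \bar R, measurable_fun setT F ->
  (forall y, (0 <= F y)%E) ->
  (\int[P1]_y F y = \int[P0]_y ((r y)%:E * F y))%E.

Let r0 y : 0 <= r y. Proof. by have /andP[] := rC y. Qed.

Let C0 : 0 <= C. Proof. by have /andP[] := rC 0; exact: le_trans. Qed.

Lemma rF_int F : intb P0 F -> intb P0 (fun y => r y * F y).
Proof.
move=> iF; have mF := measurable_intb iF.
have iN : intb P0 (fun y => `|F y|) by exact: (integrable_norm iF).
apply: (@intb_le _ _ _ (fun y => C * `|F y|)).
- exact: measurable_funM.
- by move=> y; rewrite normrM ler_wpM2r// ger0_norm//; have /andP[] := rC y.
- exact: intbZ.
Qed.

Let ge0_change F : intb P0 F -> (forall y, 0 <= F y) ->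
  intb P1 F /\ \int[P1]_y F y = \int[P0]_y (r y * F y).
Proof.
move=> iF F0; have mF := measurable_intb iF.
have E : (\int[P1]_y (F y)%:E = (\int[P0]_y (r y * F y))%:E)%E.
  rewrite (EFin_Rint (rF_int iF)) P1E.
  - by apply: eq_integral => y _; rewrite -EFinM.
  - exact/measurable_EFinP.
  - by move=> y; rewrite lee_fin.
split; last by rewrite {1}/Rintegral E.
by apply: ge0_intb => //; rewrite E ltry.
Qed.

(** F = (F + |F|) - |F| carries the formula [P1E] over to signed integrands; the bound on r keeps r
    F integrable. *)
Lemma change_of_law F : intb P0 F ->
  intb P1 F /\ \int[P1]_y F y = \int[P0]_y (r y * F y).
Proof.
move=> iF; have iN : intb P0 (fun y => `|F y|) by exact: (integrable_norm iF).
have [j1 e1] := ge0_change iN (fun y => normr_ge0 (F y)).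
have iS := intbD iF iN.
have [|j2 e2] := ge0_change iS.
  by move=> y; rewrite addrC -lerBlDr sub0r -normrN ler_norm.
have E y : F y = (F y + `|F y|) - `|F y| by rewrite addrK.
split; first by apply: eq_intb (intbB j2 j1) => y; rewrite -E.
rewrite (eq_Rint _ E) RintB// e1 e2 -RintB; [|exact: rF_int..].
by apply: eq_Rint => y; ring.
Qed.

Lemma moments_P1 : moments P1.
Proof. by move=> d; have [] := change_of_law (mP0 d). Qed.

Let mP1 := moments_P1.

Definition relent := \int[P0]_y (r y * ln (r y)).

(** From x - 1 <= x ln x <= x^2. *)
Lemma rlnr_bound y : `|r y * ln (r y)| <= C ^+ 2 + 1.
Proof.
have := xlnx_tangent0 (r0 y) (@ltr01 R); rewrite ln1 mulr0 add0r => h1.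
have h2 : r y * ln (r y) <= r y * r y.
  have := r0 y; rewrite le_eqVlt => /predU1P[<-|h]; first by rewrite !mul0r.
  by rewrite ler_pM2l// ltW// ln_sublinear.
have /andP[h3 h4] := rC y.
rewrite ler_norml; apply/andP; split.
  by have := sqr_ge0 C; move: (r y * ln (r y)) h1 => x h1; lra.
apply: (le_trans h2); rewrite expr2; apply: (@le_trans _ _ (C * C)).
  exact: ler_pM.
by rewrite lerDl.
Qed.

Let mrln : measurable_fun setT (fun y => r y * ln (r y)).
Proof. by mfun. Qed.

Let pb_rln : pbound (@wt R) (fun y => r y * ln (r y)).
Proof.
exists (C ^+ 2 + 1), 0; split; first by rewrite addr_ge0// sqr_ge0.
by move=> y; rewrite expr0 mulr1 rlnr_bound.
Qed.

Let pb_r : pbound (@wt R) r.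
Proof.
exists C, 0; split => // y; rewrite expr0 mulr1 ger0_norm//.
by have /andP[] := rC y.
Qed.

Lemma Lam_change c z : Lam P1 c z = \int[P0]_y (kap (c * y) z * r y).
Proof.
have [_ E] := change_of_law (kap_int mP0 c z).
by rewrite /Lam E; apply: eq_Rint => y; rewrite mulrC.
Qed.

Definition output_relent c :=
  \int[gam R]_z (Lam P1 c z * ln (Lam P1 c z) - Lam P1 c z * ln (Lam P0 c z)).

Lemma output_relent_int c :
  intb (gam R) (fun z => Lam P1 c z * ln (Lam P1 c z) - Lam P1 c z * ln (Lam P0 c z)).
Proof.
apply: intbB; first exact: J_int.
by apply: Lam_int => //; [exact: measurable_lnLam|exact: pbound_lnLam].
Qed.

Lemma output_relentE c : output_relent c =
  J P1 c - \int[gam R]_z (Lam P1 c z * ln (Lam P0 c z)).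
Proof.
rewrite /output_relent RintB//; first exact: J_int.
by apply: Lam_int => //; [exact: measurable_lnLam|exact: pbound_lnLam].
Qed.

(** Data processing, as a log-sum inequality: at each z the tangent of x ln x at d = Lam P1 / Lam P0
    is applied to r y and integrated against [kap (c * y) z]. *)
Lemma output_relent_le c : output_relent c <= relent.
Proof.
rewrite /relent -(Lam_mean mP0 c mrln pb_rln).
apply: le_Rint.
- exact: output_relent_int.
- exact: (channel_int mP0 (mfun2_fst mrln) (pbound_fst pb_rln) c).
move=> z; have L0 := Lam_gt0 mP0 c z; have L1 := Lam_gt0 mP1 c z.
set d := Lam P1 c z / Lam P0 c z.
have d0 : 0 < d by rewrite divr_gt0.
have ik := kap_int mP0 c z.
have ir := P_tilt_int mP0 c z mr pb_r.
have irl := P_tilt_int mP0 c z mrln pb_rln.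
have -> : Lam P1 c z * ln (Lam P1 c z) - Lam P1 c z * ln (Lam P0 c z) =
  \int[P0]_y ((ln d + 1) * (kap (c * y) z * r y) - d * kap (c * y) z).
  rewrite RintB; [|exact: intbZ..]; rewrite (RintZ _ ir) (RintZ _ ik).
  rewrite -Lam_change -/(Lam P0 c z) ln_div ?posrE// /d divfK ?gt_eqF//; ring.
apply: le_Rint => //; first by apply: intbB; exact: intbZ.
move=> y; have := ler_wpM2l (kap_ge0 (c * y) z) (xlnx_tangent0 (r0 y) d0).
by move: (kap _ _) (r y * ln (r y)) (r y) (ln d) => k a b l; lra.
Qed.

Section test_function.
Variables (h : R -> R) (M : R).
Hypotheses (ch : continuous h) (hM : forall y, `|h y| <= M).

Let mh : measurable_fun setT h. Proof. exact: continuous_measurable_fun. Qed.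

(* A lower bound of the relative entropy of P1 with respect to P0, linearized from
   Donsker and Varadhan by ln x <= x - 1. *)
Definition DV := \int[P1]_y h y + 1 - \int[P0]_y expR (h y).

(** The Donsker-Varadhan bound for the two output laws, from the tangent of x ln x at Lam P0 times
    exp h. The test function is evaluated at z / c because (c Y + N) / c tends to Y. *)
Lemma output_DV_le c :
  \int[gam R]_z (Lam P1 c z * h (z / c)) + 1 -
  \int[gam R]_z (Lam P0 c z * expR (h (z / c))) <= output_relent c.
Proof.
have mhc : measurable_fun (setT : set R) (fun z => h (z / c)).
  by apply: (measurableT_comp mh); mfun.
have phc : pbound (@wt R) (fun z => h (z / c)).
  exists `|M|, 0; split => // z; rewrite expr0 mulr1; apply: le_trans (hM _) _.
  exact: ler_norm.
have mec : measurable_fun (setT : set R) (fun z => expR (h (z / c))) by mfun.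
have pec : pbound (@wt R) (fun z => expR (h (z / c))).
  exists (expR M), 0; split; first exact: expR_ge0.
  move=> z; rewrite expr0 mulr1 ger0_norm ?expR_ge0// ler_expR.
  exact: le_trans (ler_norm _) (hM _).
have i1 := Lam_int mP1 c mhc phc.
have i2 := Lam_int mP0 c mec pec.
have i3 := Lam_int1 mP1 c.
rewrite -(Rint_Lam mP1 c) -RintD// -RintB//; last exact: intbD.
apply: le_Rint; [by apply: intbB => //; exact: intbD|exact: output_relent_int|].
move=> z; have L0 := Lam_gt0 mP0 c z; have L1 := Lam_gt0 mP1 c z.
have e0 : 0 < expR (h (z / c)) by exact: expR_gt0.
have := xlnx_tangent L1 (mulr_gt0 L0 e0).
rewrite lnM ?posrE// expRK.
by move: (Lam P1 c z) (Lam P0 c z) (ln _) (ln _) (h _) (expR _) => a b l1 l2 k e; lra.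
Qed.

(** The left side is the mean of G(Y + N / s n). Dominated convergence is applied to the noise for
    fixed y, then to y, with the bound N both times. *)
Lemma cvg_output_test (P : probability RR R) (mP : moments P) (G : R -> R) N :
  continuous G -> (forall y, `|G y| <= N) ->
  \int[gam R]_z (Lam P (Num.sqrt n.+1%:R) z * G (z / Num.sqrt n.+1%:R)) @[n --> \oo] -->
  \int[P]_y G y.
Proof.
move=> cG hG; have mG : measurable_fun setT G by exact: continuous_measurable_fun.
pose s n : R := Num.sqrt n.+1%:R.
have s0 n : 0 < s n by rewrite sqrtr_gt0.
have mGs n : measurable_fun (setT : set R) (fun z => G (z / s n)).
  by apply: (measurableT_comp mG); mfun.
have pGs n : pbound (@wt R) (fun z => G (z / s n)).
  exists `|N|, 0; split => // z; rewrite expr0 mulr1; apply: le_trans (hG _) _.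
  exact: ler_norm.
have E n : \int[gam R]_z (Lam P (s n) z * G (z / s n)) =
    \int[P]_y \int[gam R]_v G (y + v / s n).
  have := channel_Fubini mP (mfun2_snd (mGs n)) (pbound_snd (pGs n)) (s n).
  rewrite (_ : \int[gam R]_v _ = \int[gam R]_z (Lam P (s n) z * G (z / s n))); last first.
    apply: eq_Rint => z; rewrite [RHS]mulrC -RintZ; last exact: kap_int.
    by apply: eq_Rint => y; rewrite mulrC.
  move=> ->; apply: eq_Rint => y; rewrite Rint_gam_shift//.
  by apply: eq_Rint => v; congr G; field; rewrite gt_eqF.
under eq_fun do rewrite E.
have mGy n : mfun2 (fun y v => G (y + v / s n)).
  by apply: (mfun2_comp mG); rewrite /mfun2; mfun.
have N0 : 0 <= N by apply: le_trans (hG 0); exact: normr_ge0.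
have iG n y : intb (gam R) (fun v => G (y + v / s n)).
  by apply: (intb_le _ _ (intb_cst _ N)) => //; exact: (mfun2_r y (mGy n)).
have bnd n y : `|\int[gam R]_v G (y + v / s n)| <= N.
  rewrite ler_norml; apply/andP; split.
    rewrite -(Rint_cst (gam R) (- N)); apply: le_Rint => //; first exact: intb_cst.
    by move=> v; have := hG (y + v / s n); rewrite ler_norml => /andP[].
  rewrite -(Rint_cst (gam R) N); apply: le_Rint => //; first exact: intb_cst.
  by move=> v; have := hG (y + v / s n); rewrite ler_norml => /andP[].
have cs : (s n)^-1 @[n --> \oo] --> (0 : R).
  have -> : (fun n => (s n)^-1) = (fun n => Num.sqrt (n.+1%:R^-1 : R)).
    by apply/funext => n; rewrite sqrtrV.
  rewrite -(sqrtr0 R); apply: (@cvg_comp _ _ _ (@harmonic R) (@Num.sqrt R) _ _ _ (@cvg_harmonic R)).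
  exact: sqrt_continuous.
have cin y : \int[gam R]_v G (y + v / s n) @[n --> \oo] --> G y.
  have cv v : G (y + v / s n) @[n --> \oo] --> G y.
    have cvi : y + v / s n @[n --> \oo] --> y.
      rewrite -[X in _ --> X]addr0; apply: cvgD; first exact: cvg_cst.
      by rewrite -[X in _ --> X](mulr0 v); apply: cvgMr.
    exact: (cvg_comp _ _ cvi (cG y)).
  have [_] := DCT_R (fun n => mfun2_r y (mGy n)) cv (intb_cst (gam R) N) (fun n v => hG _).
  by rewrite Rint_cst.
by have [] := DCT_R (fun n => measurable_Rint (gam R) (mGy n)) cin (intb_cst P N) bnd.
Qed.

Lemma relent_liminf e : 0 < e ->
  \forall n \near \oo, DV - e <= output_relent (Num.sqrt n.+1%:R).
Proof.
move=> e0.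
have c1 := cvg_output_test mP1 ch hM.
have ceh : continuous (fun y => expR (h y)).
  by move=> y; apply: continuous_comp; [exact: ch|exact: continuous_expR].
have beh y : `|expR (h y)| <= expR M.
  rewrite ger0_norm ?expR_ge0// ler_expR; exact: le_trans (ler_norm _) (hM _).
have c2 := cvg_output_test mP0 ceh beh.
have c3 : \int[gam R]_z (Lam P1 (Num.sqrt n.+1%:R) z * h (z / Num.sqrt n.+1%:R)) + 1 -
  \int[gam R]_z (Lam P0 (Num.sqrt n.+1%:R) z * expR (h (z / Num.sqrt n.+1%:R))) @[n --> \oo] --> DV.
  by apply: cvgB => //; apply: cvgD => //; exact: cvg_cst.
move/cvgrPdist_le : c3 => /(_ _ e0); apply: filterS => n hn.
apply: le_trans (output_DV_le _).
by move: hn; rewrite ler_norml => /andP[_]; rewrite lerBlDr => h1; rewrite lerBlDr [leRHS]addrC.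
Qed.

End test_function.

End relative_entropy.

Section bounded_continuous_density.
Variable R : realType.
Notation RR := (measurableTypeR R).
Variable P : probability RR R.

Definition bounded_continuous (f : R -> R) :=
  continuous f /\ exists M, forall y, `|f y| <= M.

Let A := bounded_continuous.

Let mA (f : R -> R) : A f -> measurable_fun setT f.
Proof. by move=> [cf _]; exact: continuous_measurable_fun. Qed.

Let A_D (f g : R -> R) : A f -> A g -> A (fun x => f x + g x).
Proof.
move=> [cf [M hM]] [cg [N hN]]; split; first by move=> x; apply: cvgD; [exact: cf|exact: cg].
by exists (M + N) => y; rewrite (le_trans (ler_normD _ _))// lerD.
Qed.

Let A_Z k (f : R -> R) : A f -> A (fun x => k * f x).
Proof.
move=> [cf [M hM]]; split; first by move=> x; apply: cvgMr; exact: cf.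
by exists (`|k| * M) => y; rewrite normrM ler_wpM2l.
Qed.

Let A_1 : A (fun=> 1).
Proof. by split; [move=> x; exact: cvg_cst|exists 1 => y; rewrite normr1]. Qed.

Definition clamp (a b x : R) := Num.max a (Num.min b x).

Lemma clamp_continuous a b (f : R -> R) : continuous f -> continuous (fun x => clamp a b (f x)).
Proof.
move=> cf x; apply: (@continuous_max R _ (fun=> a) (fun x => Num.min b (f x))).
  exact: cvg_cst.
apply: (@continuous_min R _ (fun=> b) f); first exact: cvg_cst.
exact: cf.
Qed.

Lemma clamp_itv a b x : a <= b -> a <= clamp a b x <= b.
Proof. by move=> ab; rewrite /clamp le_max lexx ge_max ab ge_min lexx. Qed.

Lemma clamp_dist a b x y : a <= y <= b -> `|y - clamp a b x| <= `|y - x|.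
Proof.
move=> /andP[ay yb]; rewrite /clamp.
have [xb|xb] := leP b x.
  have [] := leP a b => ab; last by lra.
  by rewrite !ler0_norm; lra.
have [ax|ax] := leP a x; first by [].
by rewrite !ger0_norm; lra.
Qed.

(** The ramps n (z - a) clamped to [0, 1] converge to the indicator of z > a at every point, and
    [L2cl_total] does the rest. *)
Lemma bounded_continuous_dense (f : R -> R) : measurable_fun setT f -> intb P (fun x => f x ^+ 2) ->
  L2cl P A f.
Proof.
apply: L2cl_total => // a.
apply: (L2cl_dominated mA (f_ := fun n z => clamp 0 1 (n%:R * (z - a))) (g := fun=> 1)).
- move=> n; apply: L2cl_sub => //; split.
    apply: clamp_continuous => x; apply: cvgMr; apply: cvgB; [exact: cvg_id|exact: cvg_cst].
  exists 1 => y; have /andP[h1 h2] := clamp_itv (n%:R * (y - a)) (@ler01 R).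
  by rewrite ger0_norm.
- move=> z; apply: cvg_near_cst; have [az|za] := ltP a z.
    near=> n; rewrite /clamp min_l ?max_r//.
    rewrite -ler_pdivrMr ?subr_gt0// mul1r.
    by near: n; exact: nbhs_infty_ger.
  near=> n; rewrite /clamp max_l// ge_min; apply/orP; right.
  by rewrite mulr_ge0_le0// subr_le0.
- exact: intb_cst.
- move=> n z; have /andP[h1 h2] := clamp_itv (n%:R * (z - a)) (@ler01 R).
  rewrite -(real_normK (num_real _)) expr_le1// ler_norml.
  by case: (a < z) => /=; apply/andP; split; lra.
Unshelve. all: by end_near. Qed.

End bounded_continuous_density.

Section relative_entropy_limit.
Variable R : realType.
Notation RR := (measurableTypeR R).
Variables (P0 P1 : probability RR R) (r : R -> R) (C : R).
Hypothesis mP0 : moments P0.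
Hypothesis mr : measurable_fun setT r.
Hypothesis rC : forall y, 0 <= r y <= C.
Hypothesis P1E : forall F : R -> \bar R, measurable_fun setT F ->
  (forall y, (0 <= F y)%E) ->
  (\int[P1]_y F y = \int[P0]_y ((r y)%:E * F y))%E.

Let r0 y : 0 <= r y. Proof. by have /andP[] := rC y. Qed.
Let r_le y : r y <= C. Proof. by have /andP[] := rC y. Qed.

Let C0 : 0 <= C. Proof. exact: le_trans (r0 0) (r_le 0). Qed.

Let ch F (iF : intb P0 F) := change_of_law mr rC P1E iF.

Lemma Rint_ratio : \int[P0]_y r y = 1.
Proof.
have [_] := ch (intb_cst P0 1); rewrite /cst Rint_cst => ->.
by apply: eq_Rint => y; rewrite mulr1.
Qed.

Let ir : intb P0 r.
Proof. by apply: (intb_le mr _ (intb_cst P0 C)) => y; rewrite ger0_norm. Qed.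

Let irl : intb P0 (fun y => r y * ln (r y)).
Proof.
apply: (intb_le _ _ (intb_cst P0 (C ^+ 2 + 1))); first by mfun.
exact: rlnr_bound.
Qed.

Section truncation.
Variable dl : R.
Hypothesis dl0 : 0 < dl.

(** The optimal test function ln r is unbounded where r is small. Raising r to at least [dl] bounds
    the logarithm and costs at most [dl]. *)
Let m y := Num.max (r y) dl.
Let h y := ln (m y).
Let M := `|ln dl| + `|ln (Num.max C dl)|.

Let m0 y : 0 < m y. Proof. by rewrite lt_max dl0 orbT. Qed.

Let mh : measurable_fun setT h.
Proof. by apply: measurableT_comp => //; apply: measurable_maxr. Qed.

Let hM y : - M <= h y <= M.
Proof.
have h1 : ln dl <= h y by rewrite ler_ln ?posrE// le_max lexx orbT.
have h2 : h y <= ln (Num.max C dl).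
  rewrite ler_ln ?posrE//; last by rewrite lt_max dl0 orbT.
  by rewrite ge_max !le_max r_le lexx orbT.
have := ler_norm (- ln dl); rewrite normrN; have := ler_norm (ln (Num.max C dl)).
have := normr_ge0 (ln dl); have := normr_ge0 (ln (Num.max C dl)).
move: h1 h2; rewrite /M; move: (h y) (ln dl) (ln (Num.max C dl)) => a b c.
by move: (`|b|) (`|c|) => *; apply/andP; split; lra.
Qed.

Let ih : intb P0 h.
Proof.
by apply: (intb_le mh _ (intb_cst P0 M)) => y; rewrite ler_norml.
Qed.

Let im : intb P0 (fun y => expR (h y)).
Proof.
apply: (intb_le _ _ (intb_cst P0 (expR M))); first by mfun.
by move=> y; rewrite ger0_norm ?expR_ge0// ler_expR; have /andP[] := hM y.
Qed.

Let trunc_ge : relent P0 r - dl <= \int[P0]_y (r y * h y) + 1 - \int[P0]_y expR (h y).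
Proof.
have e1 : relent P0 r <= \int[P0]_y (r y * h y).
  apply: le_Rint => //; first exact: rF_int.
  move=> y; have := r0 y; rewrite le_eqVlt => /predU1P[<-|ry]; first by rewrite !mul0r.
  by rewrite ler_pM2l// ler_ln ?posrE// le_max lexx.
have e2 : \int[P0]_y expR (h y) <= 1 + dl.
  rewrite -{1}Rint_ratio -[X in _ + X](Rint_cst P0 dl) -RintD//; last exact: intb_cst.
  apply: le_Rint => //; first by apply: intbD => //; exact: intb_cst.
  by move=> y; rewrite lnK ?posrE// ge_max lerDl (ltW dl0) lerDr r0.
by move: e1 e2; move: (relent _ _) (Rintegral _ _ _) (Rintegral _ _ _) => a b c; lra.
Qed.

Lemma test_function_approx e : 0 < e -> exists2 g, continuous g &
  (forall y, `|g y| <= M) /\ relent P0 r - dl - e <= DV P0 P1 g.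
Proof.
(* For test functions bounded by [M], the integral of r h - exp h changes by at most C + exp M times
   the L1 distance, so an L1 error [th] costs e. *)
move=> e0; pose th := e / (C + expR M).
have D0 : 0 < C + expR M by rewrite ltr_wpDl ?expR_gt0.
have th0 : 0 < th by rewrite divr_gt0.
have ih2 : intb P0 (fun y => h y ^+ 2).
  apply: (intb_le _ _ (intb_cst P0 (M ^+ 2))); first by mfun.
  move=> y; rewrite normrX; apply: lerXn2r; rewrite ?nnegrE// ?addr_ge0//.
  by rewrite ler_norml.
have [_ /(_ _ (exprn_gt0 2 th0))[g0 [cg0 _] hg0]] := bounded_continuous_dense mh ih2.
have MM : - M <= M by have /andP[] := hM 0; exact: le_trans.
(* The bound of [g0] is unrelated to [M]. Clamping to the range of h restores the bound [M] and does
   not increase the distance to h. *)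
pose g y := clamp (- M) M (g0 y).
have cg : continuous g by exact: clamp_continuous.
have gM y : `|g y| <= M by rewrite ler_norml clamp_itv.
have mg : measurable_fun setT g by exact: continuous_measurable_fun.
have mg0 : measurable_fun setT g0 by exact: continuous_measurable_fun.
exists g; [exact: cg|split; first exact: gM].
have ig : intb P0 g by apply: (intb_le mg _ (intb_cst P0 M)).
have ieg : intb P0 (fun y => expR (g y)).
  apply: (intb_le _ _ (intb_cst P0 (expR M))); first by mfun.
  by move=> y; rewrite ger0_norm ?expR_ge0// ler_expR (le_trans (ler_norm _)).
have id : intb P0 (fun y => `|h y - g y|) by exact: (integrable_norm (intbB ih ig)).
have id2 : intb P0 (fun y => (h y - g0 y) ^+ 2).
  apply: ge0_intb; [by mfun|by move=> y; exact: sqr_ge0|exact: lt_le_trans hg0 (leey _)].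
have dle : \int[P0]_y `|h y - g y| <= th.
  (* x <= th / 2 + x^2 / (2 th) stands in for Cauchy-Schwarz: a squared L2 distance th^2 gives an L1
     distance th. *)
  apply: (@le_trans _ _ (\int[P0]_y (th / 2 + (2 * th)^-1 * (h y - g0 y) ^+ 2))).
    apply: le_Rint => //; first by apply: intbD; [exact: intb_cst|exact: intbZ].
    move=> y; apply: (le_trans (clamp_dist _ (hM y))).
    rewrite -(real_normK (num_real (h y - g0 y))); move: (`|_|) => x.
    rewrite -subr_ge0 (_ : _ - x = (2 * th)^-1 * (x - th) ^+ 2).
      by rewrite mulr_ge0 ?sqr_ge0// invr_ge0 mulr_ge0// ltW.
    by field; rewrite gt_eqF.
  rewrite RintD; [|exact: intb_cst|exact: intbZ]; rewrite Rint_cst RintZ//.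
  have : \int[P0]_y (h y - g0 y) ^+ 2 <= th ^+ 2 by rewrite -lee_fin EFin_Rint// ltW.
  move: (\int[P0]_y _) => x xth.
  rewrite [leRHS](_ : th = th / 2 + (2 * th)^-1 * th ^+ 2); last by field; rewrite gt_eqF.
  by rewrite lerD2l ler_wpM2l// invr_ge0 mulr_ge0// ltW.
have [_ eg] := ch ig.
have : \int[P0]_y (r y * h y - expR (h y)) - (C + expR M) * th <=
    \int[P0]_y (r y * g y - expR (g y)).
  rewrite lerBlDr; apply: (@le_trans _ _ (\int[P0]_y ((r y * g y - expR (g y)) + (C + expR M) * `|h y - g y|))).
    apply: le_Rint.
    - by apply: intbB => //; exact: rF_int.
    - by apply: intbD; [apply: intbB => //; exact: rF_int|exact: intbZ].
    move=> y.
    have h1 : r y * (h y - g y) <= C * `|h y - g y|.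
      apply: (@le_trans _ _ (r y * `|h y - g y|)); first by rewrite ler_wpM2l// ler_norm.
      by rewrite ler_wpM2r.
    have h2 : expR (g y) - expR (h y) <= expR M * `|h y - g y|.
      apply: (@le_trans _ _ (expR (g y) * `|h y - g y|)).
        apply: (@le_trans _ _ (expR (g y) * (g y - h y))).
          have := expR_ge1Dx (h y - g y); rewrite -(ler_pM2l (expR_gt0 (g y))) -expRD.
          rewrite (addrC (g y)) subrK; move: (expR (g y)) (expR (h y)) => a b.
          by rewrite !mulrDr !mulrN mulr1; lra.
        by rewrite ler_wpM2l ?expR_ge0// -normrN opprB ler_norm.
      by rewrite ler_wpM2r// ler_expR (le_trans (ler_norm _)).
    move: h1 h2; rewrite mulrBr; move: (`|_|) (expR (g y)) (expR (h y)) (expR M) => *; lra.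
  rewrite RintD; [|by apply: intbB => //; exact: rF_int|exact: intbZ].
  by rewrite lerD2l RintZ// ler_wpM2l// ltW.
have -> : (C + expR M) * th = e by rewrite /th mulrC divfK// gt_eqF.
rewrite !RintB//; try exact: rF_int.
rewrite /DV eg; move: trunc_ge; move: (relent _ _) => k.
move: (\int[P0]_y (r y * h y)) (\int[P0]_y expR (h y)) => a b.
move: (\int[P0]_y (r y * g y)) (\int[P0]_y expR (g y)) => a' b' *; lra.
Qed.

End truncation.

Lemma cvg_output_relent :
  output_relent P0 P1 (Num.sqrt n.+1%:R) @[n --> \oo] --> relent P0 r.
Proof.
apply/cvgrPdist_le => e e0.
have e3 : 0 < e / 3 by rewrite divr_gt0.
(* One third of e for the truncation, one for the continuous approximation, one for the passage to
   the limit in n. *)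
have [g cg [gM hg]] := test_function_approx e3 e3.
have := relent_liminf mP0 mr rC P1E cg gM e3; apply: filterS => n hn.
have := output_relent_le mP0 mr rC P1E (Num.sqrt n.+1%:R).
move: hn hg; move: (output_relent _ _ _) (relent _ _) (DV _ _ _) => x y z h1 h2 h3.
by rewrite ger0_norm; lra.
Qed.

End relative_entropy_limit.

(** * Entropy of the output and finiteness of h(Y) *)

Section entropy_bound.
Variable R : realType.
Notation RR := (measurableTypeR R).
Notation mu := (@lebesgue_measure R).
Variables (q : R -> R) (hq : is_density q).
Let P : probability RR R := dens hq.
Hypothesis mP : moments P.
Hypothesis hent : diff_entropy_gt_ninfty q.

Let Qp y := Num.max (q y * ln (q y)) 0.

Let mq : measurable_fun setT q. Proof. by have [] := hq. Qed.
Let q0 y : 0 <= q y. Proof. by have [_ []] := hq. Qed.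

Let mQp : measurable_fun setT Qp.
Proof. by apply: measurable_maxr => //; mfun. Qed.

Let Qp0 y : 0 <= Qp y. Proof. by rewrite le_max lexx orbT. Qed.

Let iQp : intb mu Qp. Proof. exact: ge0_intb. Qed.

Definition pos_entropy := \int[mu]_y Num.max (q y * ln (q y)) 0.

Variable c : R.
Hypothesis c0 : 0 < c.

Let gauss_even (x : R) : gauss (- x) = gauss x.
Proof. by rewrite /gauss sqrrN. Qed.

Let kernel_gauss (y z : R) : kap (c * y) z * gauss z = gauss (c * y + - z).
Proof. by rewrite -gauss_shift -gauss_even; congr gauss; ring. Qed.

Let kap_leb_E z : (\int[mu]_y (kap (c * y) z)%:E = ((c * gauss z)^-1)%:E)%E.
Proof.
have g0 := gauss_gt0 z.
transitivity (\int[mu]_y ((gauss z)^-1%:E * (gauss (c * y + - z))%:E))%E.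
  apply: eq_integral => y _; rewrite -EFinM -kernel_gauss; congr EFin.
  by rewrite mulrCA mulVf ?mulr1// gt_eqF.
rewrite ge0_integralZl//.
- by rewrite integral_gauss_affine// -EFinM; congr EFin; field; rewrite !gt_eqF.
- by apply/measurable_EFinP; apply: (measurableT_comp (@measurable_gauss R)); mfun.
- by move=> y _; rewrite lee_fin gauss_ge0.
- by rewrite lee_fin invr_ge0 ltW.
Qed.

Let kap_leb_int z : intb mu (fun y => kap (c * y) z).
Proof.
apply: ge0_intb; [by rewrite /kap; mfun|by move=> y; exact: kap_ge0|].
by rewrite kap_leb_E ltry.
Qed.

Let kap_leb z : \int[mu]_y kap (c * y) z = (c * gauss z)^-1.
Proof. by rewrite /Rintegral kap_leb_E. Qed.

Let kapq z : intb mu (fun y => kap (c * y) z * q y) /\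
  \int[mu]_y (kap (c * y) z * q y) = Lam P c z.
Proof.
have mk : measurable_fun setT (fun y : R => kap (c * y) z) by rewrite /kap; mfun.
have ik := kap_int mP c z.
split; first by have /(integrable_dens hq mk) := ik.
by rewrite /Lam /P Rintegral_dens.
Qed.

Let kapQ_int z : intb mu (fun y => Qp y * kap (c * y) z).
Proof.
apply: (@intb_le _ _ _ (fun y => expR (z ^+ 2 / 2) * Qp y)).
- by apply: measurable_funM => //; rewrite /kap; mfun.
- move=> y; rewrite ger0_norm ?mulr_ge0 ?kap_ge0// mulrC ler_wpM2r//.
  exact: kap_le.
- exact: intbZ.
Qed.

(** [w] is the density of Y + N / c at z / c, an average of q with weights proportional to
    [kap (c * y) z]. The tangent of x ln x at w gives Jensen's inequality for this average, and q ln
    q is then bounded by its positive part. *)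
Let pointwise z : Lam P c z * (ln (Lam P c z) + ln c + ln (gauss z)) <=
  \int[mu]_y (Qp y * kap (c * y) z).
Proof.
have g0 := gauss_gt0 z; have L0 := Lam_gt0 mP c z.
set w := Lam P c z * (c * gauss z).
have w0 : 0 < w by apply: mulr_gt0 => //; exact: mulr_gt0.
have cg0 : 0 < c * gauss z by exact: mulr_gt0.
have lnw : ln w = ln (Lam P c z) + (ln c + ln (gauss z)).
  by rewrite /w (@lnM _ (Lam P c z)) ?posrE// (@lnM _ c) ?posrE.
have [i1 e1] := kapq z; have i2 := kap_leb_int z.
have -> : Lam P c z * (ln (Lam P c z) + ln c + ln (gauss z)) =
    \int[mu]_y ((ln w + 1) * (kap (c * y) z * q y) - w * kap (c * y) z).
  rewrite RintB; [|exact: intbZ..]; rewrite (RintZ _ i1) (RintZ _ i2) e1 kap_leb.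
  by rewrite lnw /w mulfK ?gt_eqF//; ring.
apply: le_Rint; [by apply: intbB; exact: intbZ|exact: kapQ_int|].
move=> y; have := q0 y; rewrite le_eqVlt => /predU1P[<-|qy].
  rewrite mulr0 mulr0 sub0r; apply: (@le_trans _ _ 0).
    by rewrite oppr_le0 mulr_ge0 ?kap_ge0// ltW.
  by rewrite mulr_ge0 ?kap_ge0.
have h : q y * ln w + q y - w <= Qp y.
  by apply: le_trans (xlnx_tangent qy w0) _; rewrite le_max lexx.
have := ler_wpM2l (kap_ge0 (c * y) z) h.
by move: (kap _ _) (Qp y) (q y) (ln w) => k a b l; lra.
Qed.

Let mkap : mfun2 (fun y z => Qp y * kap (c * y) z).
Proof.
apply: measurable_funM; first exact: (mfun2_fst mQp).
exact: mfun2_kap.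
Qed.

Let kapQ_int2 : int2 mu (gam R) (fun y z => Qp y * kap (c * y) z).
Proof.
apply/(@integrable12ltyP _ _ RR RR); first exact/measurable_EFinP.
rewrite (_ : (\int[mu]_x _)%E = (\int[mu]_y (Qp y)%:E)%E); first exact: intb_ltoo.
apply: eq_integral => y _ /=.
under eq_integral do rewrite normrM !ger0_norm ?kap_ge0// EFinM.
rewrite ge0_integralZl//.
- by rewrite integral_gam_kap mule1.
- by apply/measurable_EFinP; exact: measurable_kap.
- by move=> v _; rewrite lee_fin kap_ge0.
- by rewrite lee_fin.
Qed.

Let kapQ_int_gam y : intb (gam R) (fun z => Qp y * kap (c * y) z).
Proof. by apply: intbZ; exact: gam_kap_intb. Qed.

(** This is h(c Y + N) >= ln c - [pos_entropy], rewritten with J = - h(Z) + E[Z^2] / 2 + ln sqrt (2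
    pi) and E[Z^2] <= 1 + c^2 E[Y^2], where Z = c Y + N. It follows by integrating [pointwise] over
    z. *)
Lemma J_le_entropy : J P c <=
  pos_entropy - ln c + 2^-1 + c ^+ 2 / 2 * mom2 P + ln (Num.sqrt (2 * pi)).
Proof.
have mL := measurable_lnLam P c; have pL := pbound_lnLam mP c.
have m2 : measurable_fun (setT : set R) (fun z => z ^+ 2) by mfun.
have p2 : pbound (@wt R) (fun z => z ^+ 2) by pbd.
have i1 := J_int mP c; have i2 := Lam_int1 mP c; have i3 := Lam_int mP c m2 p2.
have lng (z : R) : ln (gauss z) = - z ^+ 2 / 2 - ln (Num.sqrt (2 * pi)).
  by rewrite /gauss ln_div ?posrE ?expR_gt0// ?expRK// sqrtr_gt0 mulr_gt0// pi_gt0.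
set l := ln (Num.sqrt _) in lng *.
have H : \int[gam R]_z (Lam P c z * ln (Lam P c z) + (ln c - l) * Lam P c z - 2^-1 * (Lam P c z * z ^+ 2))
    <= pos_entropy.
  have -> : pos_entropy = \int[gam R]_z \int[mu]_y (Qp y * kap (c * y) z).
    rewrite -(FubiniR kapQ_int2 kapQ_int_gam kapQ_int).
    apply: eq_Rint => y; rewrite RintZ; last exact: gam_kap_intb.
    by rewrite gam_int_kap mulr1.
  apply: le_Rint.
  - by apply: intbB; [apply: intbD => //; exact: intbZ|exact: intbZ].
  - exact: (int2_r kapQ_int2 kapQ_int).
  move=> z; apply: le_trans (pointwise z); rewrite lng.
  rewrite le_eqVlt; apply/orP; left; apply/eqP; by field.
move: H; rewrite RintB; [|by apply: intbD => //; exact: intbZ|exact: intbZ].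
rewrite RintD//; last exact: intbZ.
rewrite (RintZ _ i2) (RintZ _ i3) (Rint_Lam mP) -/(J P c).
have H2 : \int[gam R]_z (Lam P c z * z ^+ 2) <= 1 + c ^+ 2 * mom2 P.
  have E := channel_Fubini mP (mfun2_snd m2) (pbound_snd p2) c.
  rewrite (_ : \int[gam R]_z _ = \int[gam R]_z \int[P]_y (kap (c * y) z * z ^+ 2)); last first.
    apply: eq_Rint => z; rewrite mulrC -RintZ; last exact: kap_int.
    by apply: eq_Rint => y; rewrite mulrC.
  rewrite E.
  have iy2 := ysqr_int mP.
  have -> : 1 + c ^+ 2 * mom2 P = \int[P]_y (1 + c ^+ 2 * y ^+ 2).
    by rewrite RintD; [rewrite Rint_cst RintZ|exact: intb_cst|exact: intbZ].
  apply: le_Rint.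
  - exact: (channel_int_P mP (mfun2_snd m2) (pbound_snd p2) c).
  - by apply: intbD; [exact: intb_cst|exact: intbZ].
  move=> y; rewrite Rint_gam_shift//.
  have j1 : intb (gam R) (fun v => v ^+ 2) by exact: gam_intb.
  have j2 : intb (gam R) id by apply: gam_intb; [mfun|pbd].
  have -> : \int[gam R]_v (v + c * y) ^+ 2 =
      \int[gam R]_v (v ^+ 2 + (2 * (c * y)) * v + (c * y) ^+ 2).
    by apply: eq_Rint => v; ring.
  rewrite RintD; [|by apply: intbD => //; exact: intbZ|exact: intb_cst].
  rewrite RintD//; last exact: intbZ.
  by rewrite (RintZ _ j2) gam_mean Rint_cst mulr0 addr0 exprMn lerD2r gam_var_le.
by move: H2; move: (\int[gam R]_z _) (J P c) (ln c) (mom2 P) => x j k m h1 h2; lra.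
Qed.

End entropy_bound.

Section finite_sums.
Variable R : realType.
Notation RR := (measurableTypeR R).
Variable m : {sigma_finite_measure set RR -> \bar R}.

Lemma intb_sum (I : Type) (s : seq I) (F : I -> R -> R) :
  (forall i, intb m (F i)) -> intb m (fun x => \sum_(i <- s) F i x).
Proof.
move=> iF; elim: s => [|i s IH].
  by under eq_fun do rewrite big_nil; exact: integrable0.
by under eq_fun do rewrite big_cons; exact: intbD.
Qed.

Lemma Rint_sum (I : Type) (s : seq I) (F : I -> R -> R) :
  (forall i, intb m (F i)) ->
  \int[m]_x (\sum_(i <- s) F i x) = \sum_(i <- s) \int[m]_x F i x.
Proof.
move=> iF; elim: s => [|i s IH].
  rewrite big_nil; under eq_Rint do rewrite big_nil.
  by rewrite /Rintegral integral0.
rewrite big_cons -IH -RintD//; last exact: intb_sum.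
by apply: eq_Rint => x; rewrite big_cons.
Qed.

Lemma cvgn_sum (I : Type) (s : seq I) (F : I -> nat -> R) (l : I -> R) :
  (forall i, F i n @[n --> \oo] --> l i) ->
  \sum_(i <- s) F i n @[n --> \oo] --> \sum_(i <- s) l i.
Proof.
move=> h; elim: s => [|i s IH].
  by rewrite big_nil; under eq_fun do rewrite big_nil; exact: cvg_cst.
by rewrite big_cons; under eq_fun do rewrite big_cons; exact: cvgD.
Qed.

End finite_sums.

(** * Mixtures *)

Section mixture.
Variable R : realType.
Notation RR := (measurableTypeR R).
Notation mu := (@lebesgue_measure R).
Variables (K : finType) (p : K -> R) (f : K -> R -> R).
Hypothesis p0 : forall x, 0 < p x.
Hypothesis p1 : \sum_x p x = 1.
Hypothesis hf : forall x, is_density (f x).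

Let q := mix_density p f.

Let mf x : measurable_fun setT (f x). Proof. by have [] := hf x. Qed.
Let f0 x y : 0 <= f x y. Proof. by have [_ []] := hf x. Qed.

Lemma mix_is_density : is_density q.
Proof.
split.
  by apply: measurable_sum => x; have := mf x => ?; mfun.
split; first by move=> y; apply: sumr_ge0 => x _; rewrite mulr_ge0// ltW.
rewrite /q /mix_density; under eq_integral do rewrite -sumEFin.
rewrite ge0_integral_sum//.
- rewrite -[RHS](_ : (\sum_x p x)%:E = 1%E); last by rewrite p1.
  rewrite -sumEFin; apply: eq_bigr => x _; under eq_integral do rewrite EFinM.
  rewrite ge0_integralZl//.
  + by have [_ [_ ->]] := hf x; rewrite mule1.
  + by apply/measurable_EFinP; exact: mf.
  + by move=> y _; rewrite lee_fin; exact: f0.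
  + by rewrite lee_fin ltW.
- by move=> x; apply/measurable_EFinP; have := mf x => ?; mfun.
- by move=> x y _; rewrite lee_fin mulr_ge0// ltW.
Qed.

Let hq := mix_is_density.

Let P0 : probability RR R := dens hq.
Let Px x : probability RR R := dens (hf x).

Lemma mix_exp_moment : has_mgf q -> exp_moment P0.
Proof.
move=> [dl [dl0 h]]; exists (dl / 2); first by rewrite divr_gt0.
have [mq [q0 _]] := hq.
have d2 : `|dl / 2| < dl by rewrite gtr0_norm ?divr_gt0//; lra.
have d2N : `|- (dl / 2)| < dl by rewrite normrN.
rewrite ge0_integral_dens//; last by apply/measurable_EFinP; mfun.
apply: (@le_lt_trans _ _ (\int[mu]_y ((expR (dl / 2 * y) * q y)%:E + (expR (- (dl / 2) * y) * q y)%:E))%E).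
  apply: ge0_le_integral => //.
  - by move=> y _; rewrite -EFinM lee_fin mulr_ge0 ?expR_ge0.
  - by apply/measurable_EFinP; mfun.
  - by apply/measurable_EFinP; mfun.
  move=> y _; rewrite -EFinM -EFinD lee_fin -mulrDl ler_wpM2r//.
  case: (ger0P y) => _; first by rewrite lerDl expR_ge0.
  by rewrite mulrN -mulNr lerDr expR_ge0.
rewrite ge0_integralD//.
- by apply: lte_add_pinfty; exact: h.
- by move=> y _; rewrite lee_fin mulr_ge0 ?expR_ge0.
- by apply/measurable_EFinP; mfun.
- by move=> y _; rewrite lee_fin mulr_ge0 ?expR_ge0.
- by apply/measurable_EFinP; mfun.
Qed.

Definition density_ratio x y := f x y / q y.

Let pf_le x y : p x * f x y <= q y.
Proof.
rewrite /q /mix_density (bigD1 x)//= lerDl sumr_ge0// => i _.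
by rewrite mulr_ge0// ltW.
Qed.

Let q0 y : 0 <= q y. Proof. by have [_ []] := hq. Qed.

(** The mixture q is at least p x times f x. Where q vanishes the quotient is 0 by convention, which
    is harmless since f x vanishes there too ([ratioK]). This bound is the constant [C] of the
    previous part. *)
Lemma ratio_bound x y : 0 <= density_ratio x y <= (p x)^-1.
Proof.
rewrite divr_ge0//=; have := q0 y; rewrite le_eqVlt => /predU1P[q00|qy].
  by rewrite /density_ratio -q00 invr0 mulr0 invr_ge0 ltW.
by rewrite ler_pdivrMr// ler_pdivlMl.
Qed.

Lemma ratioK x y : density_ratio x y * q y = f x y.
Proof.
have := q0 y; rewrite le_eqVlt => /predU1P[q00|qy]; last first.
  by rewrite divfK// gt_eqF.
rewrite -q00 mulr0; apply/eqP; rewrite eq_le f0/=.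
by rewrite -(ler_pM2l (p0 x)) mulr0 q00 pf_le.
Qed.

Lemma measurable_ratio x : measurable_fun setT (density_ratio x).
Proof.
have [mq _] := hq; have mfx := mf x.
rewrite (_ : density_ratio x = fun y => f x y * expR (- ln (q y))); first by mfun.
apply/funext => y; have := q0 y; rewrite le_eqVlt => /predU1P[q00|qy].
  by rewrite -(ratioK x y) -q00 mulr0 mul0r /density_ratio -q00 invr0 mulr0.
by rewrite expRN lnK// posrE.
Qed.

Lemma Px_ratio x (F : R -> \bar R) : measurable_fun setT F ->
  (forall y, (0 <= F y)%E) ->
  (\int[Px x]_y F y = \int[P0]_y ((density_ratio x y)%:E * F y))%E.
Proof.
move=> mF F0; have /andP[r0 _] := ratio_bound x 0.
rewrite !ge0_integral_dens//.
- by apply: eq_integral => y _; rewrite muleAC -EFinM ratioK muleC.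
- by apply: emeasurable_funM => //; apply/measurable_EFinP; exact: measurable_ratio.
- by move=> y; rewrite mule_ge0// lee_fin; have /andP[] := ratio_bound x y.
Qed.

Lemma mix_intb x F : intb P0 F -> intb (Px x) F.
Proof.
by move=> iF; have [] := change_of_law (measurable_ratio x) (ratio_bound x) (@Px_ratio x) iF.
Qed.

Lemma mix_Rint F : intb P0 F -> \int[P0]_y F y = \sum_x p x * \int[Px x]_y F y.
Proof.
move=> iF; have mF := measurable_intb iF.
rewrite /P0 Rintegral_dens//.
have iFx x : intb mu (fun y => F y * f x y).
  by have /(integrable_dens (hf x) mF) := mix_intb x iF.
transitivity (\int[mu]_y \sum_x (p x * (F y * f x y))).
  apply: eq_Rint => y; rewrite /q /mix_density mulr_sumr.
  by apply: eq_bigr => x _; ring.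
rewrite Rint_sum; last by move=> x; exact: intbZ.
apply: eq_bigr => x _; rewrite RintZ// /Px Rintegral_dens//.
exact: mix_intb.
Qed.

Hypothesis eP0 : exp_moment P0.

Let mP0 : moments P0. Proof. exact: exp_moment_moments. Qed.

Lemma mix_exp_moment_x x : exp_moment (Px x).
Proof.
have [eta eta0 h] := eP0; exists eta => //.
by apply: intb_ltoo => //; apply: mix_intb; apply: ge0_intb => //; mfun.
Qed.

Let mPx x : moments (Px x). Proof. exact/exp_moment_moments/mix_exp_moment_x. Qed.

Lemma mix_Lam c z : Lam P0 c z = \sum_x p x * Lam (Px x) c z.
Proof. by apply: mix_Rint; exact: kap_int. Qed.

Lemma mix_mom2 : mom2 P0 = \sum_x p x * mom2 (Px x).
Proof. by apply: mix_Rint; exact: ysqr_int. Qed.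

Lemma mix_mse c phi : measurable_fun setT phi -> pbound (@wt R) phi ->
  mse P0 c phi = \sum_x p x * mse (Px x) c phi.
Proof.
move=> mphi pphi; apply: mix_Rint.
exact: (channel_int_P mP0 (mfun2_sqerr mphi) (pbound_sqerr pphi)).
Qed.

Lemma kl_div_relent x : kl_div (f x) q = (relent P0 (density_ratio x))%:E.
Proof.
have mr := measurable_ratio x.
have mrl : measurable_fun setT (fun y => density_ratio x y * ln (density_ratio x y)) by mfun.
have irl : intb P0 (fun y => density_ratio x y * ln (density_ratio x y)).
  apply: (intb_le mrl _ (intb_cst P0 ((p x)^-1 ^+ 2 + 1))).
  exact: rlnr_bound (ratio_bound x).
rewrite /relent /P0 Rintegral_dens// EFin_Rint; last first.
  exact/(integrable_dens hq mrl).
by apply: eq_integral => y _; rewrite mulrAC ratioK.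
Qed.

Lemma mutual_info_relent :
  mutual_info p f = (\sum_x p x * relent P0 (density_ratio x))%:E.
Proof.
rewrite /mutual_info -sumEFin; apply: eq_bigr => x _.
by rewrite kl_div_relent EFinM.
Qed.

(** I(X; c Y + N), written with relative entropies to N(0,1) because these are what the I-MMSE
    relation controls. *)
Definition output_info c := \sum_x p x * J (Px x) c - J P0 c.

(** The reference law N(0,1) cancels, since the output density under [P0] is the mixture of those
    under the [Px x]. *)
Lemma output_infoE c :
  output_info c = \sum_x p x * output_relent P0 (Px x) c.
Proof.
have iL x : intb (gam R) (fun z => p x * (Lam (Px x) c z * ln (Lam P0 c z))).
  by apply: intbZ; apply: Lam_int => //; [exact: measurable_lnLam|exact: pbound_lnLam].
rewrite /output_info.
have -> : J P0 c = \sum_x p x * \int[gam R]_z (Lam (Px x) c z * ln (Lam P0 c z)).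
  transitivity (\int[gam R]_z \sum_x p x * (Lam (Px x) c z * ln (Lam P0 c z))).
    apply: eq_Rint => z; rewrite {1}mix_Lam mulr_suml.
    by apply: eq_bigr => x _; rewrite mulrA.
  rewrite Rint_sum//; apply: eq_bigr => x _; rewrite RintZ//.
  by apply: Lam_int => //; [exact: measurable_lnLam|exact: pbound_lnLam].
rewrite -sumrB; apply: eq_bigr => x _.
by rewrite -mulrBr (output_relentE mP0 (measurable_ratio x) (ratio_bound x) (@Px_ratio x)).
Qed.

Lemma output_info_le c : output_info c <= \sum_x p x * relent P0 (density_ratio x).
Proof.
rewrite output_infoE; apply: ler_sum => x _; rewrite ler_wpM2l ?(ltW (p0 x))//.
exact: (output_relent_le mP0 (measurable_ratio x) (ratio_bound x) (@Px_ratio x)).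
Qed.

Lemma cvg_output_info :
  output_info (Num.sqrt n.+1%:R) @[n --> \oo] --> \sum_x p x * relent P0 (density_ratio x).
Proof.
under eq_fun do rewrite output_infoE.
apply: cvgn_sum => x; apply: cvgMr.
exact: (cvg_output_relent mP0 (measurable_ratio x) (ratio_bound x) (@Px_ratio x)).
Qed.

Lemma output_info_small c : `|output_info c| <= c ^+ 2 / 2 * mom2 P0.
Proof.
have h1 : \sum_x p x * J (Px x) c <= c ^+ 2 / 2 * mom2 P0.
  rewrite mix_mom2 mulr_sumr; apply: ler_sum => x _.
  by rewrite mulrCA ler_wpM2l ?(ltW (p0 x))// J_le.
have h2 : 0 <= \sum_x p x * J (Px x) c.
  by apply: sumr_ge0 => x _; rewrite mulr_ge0 ?(ltW (p0 x))// J_ge0.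
have h3 := J_le mP0 c; have h4 := J_ge0 mP0 c.
rewrite /output_info; move: h1 h2 h3 h4.
move: (\sum_x _) (J _ _) (_ * mom2 _) => a b d *.
by rewrite ler_norml; apply/andP; split; lra.
Qed.

End mixture.

(** * Limit of the integrated gap *)

Section integrals_on_a_domain.
Variable R : realType.
Notation RR := (measurableTypeR R).
Notation mu := (@lebesgue_measure R).
Variable D : set RR.
Hypothesis mD : measurable D.

Implicit Types f g : R -> R.

Lemma integrable_domB f g : mu.-integrable D (EFin \o f) -> mu.-integrable D (EFin \o g) ->
  mu.-integrable D (EFin \o (fun x => f x - g x)).
Proof. by move=> fi gi; exact: (integrableB mD fi gi). Qed.

Lemma integrable_domZ k f : mu.-integrable D (EFin \o f) ->
  mu.-integrable D (EFin \o (fun x => k * f x)).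
Proof. by move=> fi; exact: (integrableZl mD k fi). Qed.

Lemma Rintegral_domB f g : mu.-integrable D (EFin \o f) -> mu.-integrable D (EFin \o g) ->
  \int[mu]_(x in D) (f x - g x) = \int[mu]_(x in D) f x - \int[mu]_(x in D) g x.
Proof. by move=> fi gi; exact: (RintegralB mD fi gi). Qed.

Lemma Rintegral_domZ k f : mu.-integrable D (EFin \o f) ->
  \int[mu]_(x in D) (k * f x) = k * \int[mu]_(x in D) f x.
Proof. by move=> fi; rewrite RintegralZl. Qed.

Lemma integrable_sum_dom (I : Type) (s : seq I) (F : I -> R -> R) :
  (forall i, mu.-integrable D (EFin \o F i)) ->
  mu.-integrable D (EFin \o (fun x => \sum_(i <- s) F i x)).
Proof.
move=> iF; elim: s => [|i s IH].
  by under eq_fun do rewrite big_nil; exact: integrable0.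
under eq_fun do rewrite big_cons.
exact: (integrableD mD (iF i) IH).
Qed.

Lemma Rintegral_sum_dom (I : Type) (s : seq I) (F : I -> R -> R) :
  (forall i, mu.-integrable D (EFin \o F i)) ->
  \int[mu]_(x in D) (\sum_(i <- s) F i x) = \sum_(i <- s) \int[mu]_(x in D) F i x.
Proof.
move=> iF; elim: s => [|i s IH].
  rewrite big_nil; under eq_Rintegral do rewrite big_nil.
  by rewrite /Rintegral integral0.
under eq_Rintegral do rewrite big_cons.
by rewrite big_cons -IH RintegralD//; exact: integrable_sum_dom.
Qed.

Lemma EFin_Rintegral f : mu.-integrable D (EFin \o f) ->
  (\int[mu]_(x in D) (f x)%:E = (\int[mu]_(x in D) f x)%:E)%E.
Proof. by move=> fi; rewrite /Rintegral fineK// integrable_fin_num. Qed.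

End integrals_on_a_domain.

Section integral_inverse.
Variable R : realType.
Notation mu := (@lebesgue_measure R).

Let ln_div_le (s t : R) : 0 < s -> s < t -> ln t - ln s <= (t - s) / s.
Proof.
move=> s0 st; have t0 : 0 < t by exact: lt_trans st.
rewrite -ln_div ?posrE//.
have : ln (1 + (t / s - 1)) <= t / s - 1.
  apply: le_ln1Dx; rewrite ltrBrDr addrC subrr; exact: divr_gt0.
by rewrite [1 + _]addrC subrK mulrBl divff ?gt_eqF.
Qed.

Let ln_div_ge (s t : R) : 0 < s -> s < t -> (t - s) / t <= ln t - ln s.
Proof.
move=> s0 st; have t0 : 0 < t by exact: lt_trans st.
rewrite -[leRHS]opprB -ln_div ?posrE// lerNr.
have : ln (1 + (s / t - 1)) <= s / t - 1.
  apply: le_ln1Dx; rewrite ltrBrDr addrC subrr; exact: divr_gt0.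
by rewrite [1 + _]addrC subrK => /le_trans; apply; rewrite mulrBl divff ?gt_eqF// opprB.
Qed.

(** [integral_of_increments] once more, with the nondecreasing function - 1/t and j = - ln t / 2;
    its hypotheses are the elementary bounds on ln t - ln s. *)
Lemma integral_inv (T : R) : 1 < T ->
  mu.-integrable `[1, T] (EFin \o (fun t : R => t^-1)) /\
  \int[mu]_(t in `[1, T]) t^-1 = ln T.
Proof.
move=> T1.
have h1 (s t : R) : 1 <= s -> s < t -> (t - s) / 2 * (- s^-1) <= - (ln t / 2) - - (ln s / 2).
  move=> s1 st; have s0 : 0 < s by exact: lt_le_trans s1.
  by have := ln_div_le s0 st; move: (t - s) (s^-1) (ln t) (ln s) => *; lra.
have h2 (s t : R) : 1 <= s -> s < t ->
    - (ln t / 2) - - (ln s / 2) <= (t - s) * (- t^-1) - (t - s) / 2 * (- s^-1).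
  move=> s1 st; have s0 : 0 < s by exact: lt_le_trans s1.
  have t0 : 0 < t by exact: lt_trans st.
  have := ln_div_ge s0 st.
  have : (t - s) * t^-1 <= (t - s) * s^-1.
    by rewrite ler_wpM2l ?subr_ge0 ?(ltW st)// lef_pV2 ?posrE// ltW.
  by move: (t - s) (s^-1) (t^-1) (ln t) (ln s) => *; lra.
have E := integral_of_increments T1 h1 h2.
have I := integrable_of_increments T h1 h2.
have I' : mu.-integrable `[1, T] (EFin \o (fun t : R => t^-1)).
  have := integrableN I; rewrite (_ : (_ \o _) = EFin \o (fun t : R => t^-1))//.
  by apply/funext => t /=; rewrite opprK.
split=> //.
have : \int[mu]_(t in `[1, T]) (-1 * - t^-1) = - (2 * (- (ln T / 2) - - (ln 1 / 2))).
  by rewrite RintegralZl// E mulN1r.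
under eq_Rintegral do rewrite mulN1r opprK.
by move=> ->; rewrite ln1; field.
Qed.

End integral_inverse.

Section pmmse_gap.
Variables (R : realType) (K : finType) (p : K -> R) (f : K -> R -> R).
Notation RR := (measurableTypeR R).
Notation mu := (@lebesgue_measure R).
Hypothesis p0 : forall x, 0 < p x.
Hypothesis p1 : \sum_x p x = 1.
Hypothesis hf : forall x, is_density (f x).
Hypothesis hmgf : has_mgf (mix_density p f).
Hypothesis hent : diff_entropy_gt_ninfty (mix_density p f).

Let q := mix_density p f.
Let hq : is_density q := mix_is_density p0 p1 hf.
Let P0 : probability RR R := dens hq.
Let Px x : probability RR R := dens (hf x).
Let eP0 : exp_moment P0 := mix_exp_moment p0 p1 hf hmgf.
Let ePx x : exp_moment (Px x) := mix_exp_moment_x eP0 x.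
Let mP0 : moments P0 := exp_moment_moments eP0.
Let mPx x : moments (Px x) := exp_moment_moments (ePx x).
Let info := output_info p0 p1 hf.

Let Dn n t := fine (pmmse q n t) - \sum_x p x * fine (pmmse (f x) n t).

Let Dinf t := mmse P0 (Num.sqrt t) - \sum_x p x * mmse (Px x) (Num.sqrt t).

Let DnE n t : 0 < t ->
  (pmmse q n t - \sum_x (p x)%:E * pmmse (f x) n t = (Dn n t)%:E)%E.
Proof.
move=> t0; rewrite /Dn EFinB -sumEFin fineK; last exact: (pmmse_fin eP0).
congr (_ - _)%E; apply: eq_bigr => x _; rewrite EFinM fineK//.
exact: (pmmse_fin (ePx x)).
Qed.

Let pmmse_fine_le x n t (c : 'I_n.+1 -> R) : 0 < t ->
  fine (pmmse (f x) n t) <= mse (Px x) (Num.sqrt t) (coef_fun c).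
Proof.
move=> t0; rewrite -lee_fin fineK; last exact: (pmmse_fin (ePx x)).
by rewrite -(poly_mseE (ePx x))//; apply: ereal_inf_lbound; exists c.
Qed.

(** A polynomial used for Y can be used for every Y^(x), and its error for Y is the mean of its
    errors for the Y^(x). *)
Let Dn_ge0 n t : 0 < t -> 0 <= Dn n t.
Proof.
move=> t0; rewrite subr_ge0 -lee_fin fineK; last exact: (pmmse_fin eP0).
apply: le_ereal_inf_tmp => _ [c _ <-].
rewrite (poly_mseE eP0)// lee_fin mix_mse//.
- by apply: ler_sum => x _; rewrite ler_wpM2l ?(ltW (p0 x))// pmmse_fine_le.
- exact: measurable_coef_fun.
- exact: pbound_coef_fun.
Qed.

Let pmmse_x_ge0 x n t : 0 < t -> 0 <= fine (pmmse (f x) n t).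
Proof.
move=> t0; apply: fine_ge0; apply: le_ereal_inf_tmp => _ [c _ <-].
have [_ [f0 _]] := hf x.
apply: integral_ge0 => y _; rewrite mule_ge0 ?lee_fin//.
by apply: integral_ge0 => z _; rewrite lee_fin mulr_ge0 ?gauss_ge0 ?sqr_ge0.
Qed.

Let g2 t := t^-1 - \sum_x p x * mmse (Px x) (Num.sqrt t).

(** The dominating function. The term 1/t of [g2] is not integrable at 0, so E[Y^2] replaces it on
    (0, 1]. *)
Let G t := if t <= 1 then mom2 P0 else g2 t.

Let Dn_le_g2 n t : 0 < t -> Dn n.+1 t <= g2 t.
Proof.
move=> t0; apply: lerB.
  rewrite -lee_fin fineK; last exact: (pmmse_fin eP0).
  exact: (pmmse_le_inv eP0).
apply: ler_sum => x _; rewrite ler_wpM2l ?(ltW (p0 x))//.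
rewrite -lee_fin fineK; last exact: (pmmse_fin (ePx x)).
exact: (pmmse_ge (ePx x)).
Qed.

Let Dn_le n t : 0 < t -> Dn n.+1 t <= G t.
Proof.
move=> t0; rewrite /G; case: ifPn => _; last exact: Dn_le_g2.
rewrite lerBlDr; apply: (@le_trans _ _ (mom2 P0)).
  rewrite -lee_fin fineK; last exact: (pmmse_fin eP0).
  exact: (pmmse_le_mom2 eP0).
by rewrite lerDl; apply: sumr_ge0 => x _; rewrite mulr_ge0 ?(ltW (p0 x))// pmmse_x_ge0.
Qed.

Let cvg_Dn t : 0 < t -> Dn n t @[n --> \oo] --> Dinf t.
Proof.
move=> t0; apply: cvgB; first exact: (cvg_pmmse eP0).
by apply: cvgn_sum => x; apply: cvgMr; exact: (cvg_pmmse (ePx x)).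
Qed.

Let Rpos : set R := `]0, +oo[%classic.

Let RposE t : Rpos t -> 0 < t.
Proof. by rewrite /Rpos/= in_itv/= andbT. Qed.

Let mRpos : measurable Rpos. Proof. exact: measurable_itv. Qed.

Let mmse_measurable x : measurable_fun Rpos (fun t => mmse (Px x) (Num.sqrt t)).
Proof.
apply: (measurable_fun_cvg (h := fun n t => fine (pmmse (f x) n t))).
  move=> n; apply: measurableT_comp; first exact: (@fine_measurable R setT measurableT).
  exact: (measurable_pmmse (ePx x)).
by move=> t /RposE t0; exact: (cvg_pmmse (ePx x)).
Qed.

Let Dn_measurable n : measurable_fun Rpos (Dn n).
Proof.
apply: measurable_funB.
  apply: measurableT_comp; first exact: (@fine_measurable R setT measurableT).
  exact: (measurable_pmmse eP0).
apply: measurable_sum => x; apply: measurable_funM => //.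
apply: measurableT_comp; first exact: (@fine_measurable R setT measurableT).
exact: (measurable_pmmse (ePx x)).
Qed.

Let Dinf_measurable : measurable_fun Rpos Dinf.
Proof.
apply: (measurable_fun_cvg (h := Dn)) => //.
by move=> t /RposE; exact: cvg_Dn.
Qed.

Let Dinf_ge0 t : 0 < t -> 0 <= Dinf t.
Proof.
move=> t0; rewrite -(cvg_lim _ (cvg_Dn t0))//; apply: limr_ge.
  by apply/cvg_ex; exists (Dinf t); exact: cvg_Dn.
by apply: nearW => n; exact: Dn_ge0.
Qed.

Let DinfE t : Dinf t = \sum_x p x * Mn2 (Px x) (Num.sqrt t) - Mn2 P0 (Num.sqrt t).
Proof.
rewrite /Dinf /mmse (mix_mom2 eP0); under [X in _ - X]eq_bigr do rewrite mulrBr.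
by rewrite sumrB; ring.
Qed.

Let double_subACA (a b c d : R) : 2 * (a - b) - 2 * (c - d) = 2 * (a - c - (b - d)).
Proof. by ring. Qed.

Let integral_Dinf (al be : R) : 0 < al -> al < be ->
  mu.-integrable `[al, be] (EFin \o Dinf) /\
  \int[mu]_(t in `[al, be]) Dinf t = 2 * (info (Num.sqrt be) - info (Num.sqrt al)).
Proof.
move=> a0 ab.
have mI : measurable (`[al, be]%classic : set R) by exact: measurable_itv.
have i0 : mu.-integrable `[al, be] (EFin \o (fun t => Mn2 P0 (Num.sqrt t))) := integrable_Mn2 mP0 a0 ab.
have ix x : mu.-integrable `[al, be] (EFin \o (fun t => p x * Mn2 (Px x) (Num.sqrt t))).
  exact: (integrable_domZ mI (p x) (integrable_Mn2 (mPx x) a0 ab)).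
have isum := integrable_sum_dom mI (index_enum K) ix.
have E : Dinf = fun t => \sum_x p x * Mn2 (Px x) (Num.sqrt t) - Mn2 P0 (Num.sqrt t).
  by apply/funext => t; exact: DinfE.
split; first by rewrite E; exact: (integrable_domB mI isum i0).
rewrite E (Rintegral_domB mI isum i0) (Rintegral_sum_dom mI _ ix).
under eq_bigr do rewrite (Rintegral_domZ mI _ (integrable_Mn2 (mPx _) a0 ab)) (integral_Mn2 (mPx _) a0 ab).
rewrite (integral_Mn2 mP0 a0 ab) /info /output_info.
under eq_bigr do rewrite mulrCA mulrBr.
rewrite -mulr_sumr sumrB.
exact: double_subACA.
Qed.

(** By I-MMSE the integral of [g2] over [1, T] is ln T - (T - 1) E[Y^2] plus twice the mean of the
    increments of J. Writing this mean at sqrt T as [info] + J of Y, [output_info_le] and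
    [J_le_entropy] cancel ln T and all multiples of T; B is what is left. *)
Let B := mom2 P0 + 2 * pos_entropy q + 1 + 2 * ln (Num.sqrt (2 * pi)) +
  2 * \sum_x p x * relent P0 (density_ratio p f x).

Let sum_affine (k : R) (m a b : K -> R) :
  \sum_x p x * (k * m x - 2 * (a x - b x)) =
  k * (\sum_x p x * m x) - 2 * (\sum_x p x * a x) + 2 * \sum_x p x * b x.
Proof.
by rewrite !mulr_sumr -sumrB -big_split/=; apply: eq_bigr => x _; ring.
Qed.

(** In use, with c = sqrt T: a = I(X; c Y + N), b = J of Y at c, l = ln c, l' = ln sqrt (2 pi), e
    the positive entropy, m = E[Y^2], u the mean of the J of the Y^(x) at 1, s = I(X; Y). *)
Let g2_arith (a b l l' e m u s T : R) : a <= s -> b <= e - l + 2^-1 + T / 2 * m + l' ->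
  0 <= u -> 2 * l - ((T - 1) * m - 2 * (a + b) + 2 * u) <= m + 2 * e + 1 + 2 * l' + 2 * s.
Proof. by lra. Qed.

Let integral_g2 (T : R) : 1 < T ->
  mu.-integrable `[1, T] (EFin \o g2) /\ \int[mu]_(t in `[1, T]) g2 t <= B.
Proof.
move=> T1.
have T0 : 0 < T by exact: lt_trans T1.
have mI : measurable (`[1, T]%classic : set R) by exact: measurable_itv.
have [ii ei] := integral_inv T1.
have icst k : mu.-integrable (`[1, T]%classic : set R) (EFin \o (fun=> k)).
  apply: measurable_bounded_integrable => //.
    by rewrite /= lebesgue_measure_itv/=; case: ifPn => _; rewrite -?EFinB ltry.
  by exists `|k|; split => // M hM x _ /=; exact: ltW.
have im x : mu.-integrable `[1, T] (EFin \o (fun t => mmse (Px x) (Num.sqrt t))).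
  exact: (integrable_domB mI (icst (mom2 (Px x))) (integrable_Mn2 (mPx x) ltr01 T1)).
have ipm x : mu.-integrable `[1, T] (EFin \o (fun t => p x * mmse (Px x) (Num.sqrt t))).
  exact: (integrable_domZ mI (p x) (im x)).
have isum := integrable_sum_dom mI (index_enum K) ipm.
split; first exact: (integrable_domB mI ii isum).
rewrite /g2 (Rintegral_domB mI ii isum) ei (Rintegral_sum_dom mI _ ipm).
have muI : fine (mu `[1, T]) = T - 1 by rewrite /= lebesgue_measure_itv/= lte_fin T1.
have Em x : \int[mu]_(t in `[1, T]) (p x * mmse (Px x) (Num.sqrt t)) =
    p x * ((T - 1) * mom2 (Px x) - 2 * (J (Px x) (Num.sqrt T) - J (Px x) (Num.sqrt 1))).
  rewrite (Rintegral_domZ mI _ (im x)); congr (_ * _).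
  rewrite /mmse (Rintegral_domB mI (icst _) (integrable_Mn2 (mPx x) ltr01 T1)).
  by rewrite Rintegral_cst// muI (integral_Mn2 (mPx x) ltr01 T1) mulrC.
under eq_bigr do rewrite Em.
have infoJ : \sum_x p x * J (Px x) (Num.sqrt T) = info (Num.sqrt T) + J P0 (Num.sqrt T).
  by rewrite /info /output_info subrK.
pose U := \sum_x p x * J (Px x) (Num.sqrt 1).
have -> := etrans
  (sum_affine (T - 1) (fun x => mom2 (Px x)) (fun x => J (Px x) (Num.sqrt T)) (fun x => J (Px x) (Num.sqrt 1)))
  (congr2 (fun u v => (T - 1) * u - 2 * v + 2 * U) (esym (mix_mom2 eP0)) infoJ).
have h1 := output_info_le eP0 (Num.sqrt T).
have sT : 0 < Num.sqrt T by rewrite sqrtr_gt0.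
have h2 := J_le_entropy mP0 hent sT.
have h3 : 0 <= U.
  by apply: sumr_ge0 => x _; rewrite mulr_ge0 ?(ltW (p0 x))// J_ge0.
have lnT : ln T = 2 * ln (Num.sqrt T).
  by rewrite -[in LHS](sqr_sqrtr (ltW T0)) lnXn// mulr_natl.
have E : Num.sqrt T ^+ 2 = T by rewrite sqr_sqrtr ?ltW.
move: h1 h2 h3; rewrite E lnT /B -/info.
exact: g2_arith.
Qed.

Let g2_ge0 t : 0 < t -> 0 <= g2 t.
Proof. by move=> t0; exact: le_trans (Dn_ge0 1 t0) (Dn_le_g2 0 t0). Qed.

Let G_ge0 t : 0 < t -> 0 <= G t.
Proof. by move=> t0; exact: le_trans (Dn_ge0 1 t0) (Dn_le 0 t0). Qed.

Let g2_measurable : measurable_fun Rpos g2.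
Proof.
apply: measurable_funB.
  apply: open_continuous_measurable_fun; first exact: interval_open.
  by move=> t /set_mem/RposE t0; apply: inv_continuous; rewrite gt_eqF.
by apply: measurable_sum => x; apply: measurable_funM => //; exact: mmse_measurable.
Qed.

Let lo : set R := `]0, 1]%classic.
Let hi : set R := `]1, +oo[%classic.

Let RposU : Rpos = lo `|` hi.
Proof.
apply/seteqP; split => t; rewrite /Rpos /lo /hi/= !in_itv/= !andbT.
  by move=> ->/=; have [t1|t1] := leP t 1; [left|right].
by move=> [/andP[]//|]; exact: lt_trans.
Qed.

Let G_measurable : measurable_fun Rpos G.
Proof.
rewrite RposU; apply/measurable_funU; [exact: measurable_itv..|split].
  apply: (@eq_measurable_fun _ _ _ _ _ (cst (mom2 P0))) => // t.
  by rewrite inE /lo/= in_itv/= /G => /andP[_ ->].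
apply: (@eq_measurable_fun _ _ _ _ _ g2) => // [t|].
  by rewrite inE /hi/= in_itv/= andbT /G leNgt => ->.
by apply: (measurable_funS mRpos) g2_measurable; rewrite RposU; exact: subsetUr.
Qed.

Let G_int : (\int[mu]_(t in Rpos) (G t)%:E < +oo)%E.
Proof.
have mlo : measurable (lo : set RR) by exact: measurable_itv.
have mhi : measurable (hi : set RR) by exact: measurable_itv.
have mG : measurable_fun (lo `|` hi : set RR) (EFin \o G).
  by rewrite -RposU; apply/measurable_EFinP; exact: G_measurable.
have g0 t : hi t -> 0 < t.
  by rewrite /hi/= in_itv/= andbT; exact: lt_trans.
have mg : measurable_fun (hi : set RR) (EFin \o g2).
  apply/measurable_EFinP; apply: (measurable_funS mRpos) g2_measurable.
  by rewrite RposU; exact: subsetUr.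
rewrite RposU (ge0_integral_setU mu mlo mhi mG); first last.
- rewrite disj_set2E; apply/eqP/seteqP; split => // t [].
  by rewrite /lo /hi/= !in_itv/= andbT => /andP[_ t1]; rewrite ltNge t1.
- by move=> t; rewrite -RposU => /RposE t0; rewrite lee_fin G_ge0.
apply: lte_add_pinfty.
  under eq_integral => t do [rewrite inE /lo/= in_itv/= => /andP[_ t1]; rewrite /G t1].
  by rewrite integral_cst//= lebesgue_measure_itv/= lte01 -EFinB -EFinM ltry.
have -> : (\int[mu]_(t in hi) (G t)%:E = \int[mu]_(t in hi) (g2 t)%:E)%E.
  apply: eq_integral => t; rewrite inE /hi/= in_itv/= andbT => t1.
  by rewrite /G leNgt t1.
(* Monotone convergence along these intervals turns the bound B, uniform in T = 1 + n, into
   integrability up to infinity. *)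
pose F n : set RR := `]1, 1 + n%:R]%classic.
have hiE : hi = \bigcup_n F n by rewrite /hi itv_bndy_bigcup_BRight.
have ndF : nondecreasing_seq F.
  move=> m n mn; apply/subsetPset => t; rewrite /F/= !in_itv/= => /andP[->/=] h.
  by apply: (le_trans h); rewrite lerD2l ler_nat.
have mF n : measurable (F n) by exact: measurable_itv.
have Fhi n : F n `<=` hi by rewrite hiE; exact: bigcup_sup.
have mgF n : measurable_fun (F n) (EFin \o g2) by exact: measurable_funS (Fhi n) mg.
have gF n t : F n t -> (0 <= (EFin \o g2) t)%E.
  by move=> /Fhi/g0 t0; rewrite lee_fin g2_ge0.
have cF := ge0_nondecreasing_set_cvg_integral (mu := mu) ndF mF mgF gF.
have key n : (0 < n)%N -> (\int[mu]_(t in F n) (g2 t)%:E <= B%:E)%E.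
  move=> n1.
  have T1 : 1 < 1 + n%:R :> R by rewrite ltrDl ltr0n.
  have [i h] := integral_g2 T1.
  have mI : measurable (`[1, 1 + n%:R]%classic : set RR) by exact: measurable_itv.
  have E := EFin_Rintegral mI i.
  apply: (@le_trans _ _ (\int[mu]_(t in `[1%R, (1 + n%:R)%R]) (g2 t)%:E)%E); last first.
    by rewrite E lee_fin.
  apply: ge0_subset_integral => //.
  - exact: (measurable_int mu i).
  - move=> t /=; rewrite in_itv/= => /andP[t1 _]; rewrite lee_fin g2_ge0//.
    exact: lt_le_trans t1.
  - by apply: subset_itvr; rewrite bnd_simp.
rewrite hiE -(cvg_lim _ cF)//; apply: (@le_lt_trans _ _ B%:E); last exact: ltry.
apply: lime_le; first by apply/cvg_ex; eexists; exact: cF.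
by exists 1%N => // n; exact: key.
Qed.

(** The bounds start at 2 so that the interval is nondegenerate for every n, as [integral_Dinf]
    requires. *)
Let F (n : nat) : set RR := `[n.+2%:R^-1, n.+2%:R]%classic.

Let cvg_Dinf : (\int[mu]_(t in F n) (Dinf t)%:E @[n --> \oo] --> \int[mu]_(t in Rpos) (Dinf t)%:E)%E.
Proof.
have FE : Rpos = \bigcup_n F n.
  apply/seteqP; split => t; rewrite /Rpos/= in_itv/= andbT.
    move=> t0; exists (Num.truncn (Num.max t t^-1)) => //.
    set m := Num.max _ _; have h : m < (Num.truncn m).+1%:R by exact: truncnS_gt.
    have [h1 h2] : t <= m /\ t^-1 <= m by rewrite /m !le_max !lexx orbT.
    have h3 : m <= (Num.truncn m).+2%:R.
      by apply: (le_trans (ltW h)); rewrite ler_nat.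
    rewrite /F/= in_itv/= (le_trans h1 h3) andbT.
    by rewrite -[leRHS]invrK lef_pV2 ?posrE ?invr_gt0//; exact: le_trans h3.
  move=> [n _]; rewrite /F/= in_itv/= => /andP[h _].
  by apply: lt_le_trans h; rewrite invr_gt0.
have FR n : F n `<=` Rpos by rewrite FE; exact: bigcup_sup.
have ndF : nondecreasing_seq F.
  move=> m n mn; apply/subsetPset => t; rewrite /F/= !in_itv/= => /andP[h1 h2].
  apply/andP; split; last by apply: (le_trans h2); rewrite ler_nat.
  by apply: le_trans h1; rewrite lef_pV2 ?posrE// ler_nat.
have mF n : measurable (F n) by exact: measurable_itv.
have mD : measurable_fun (Rpos : set RR) (EFin \o Dinf).
  by apply/measurable_EFinP; exact: Dinf_measurable.
have mDF n : measurable_fun (F n) (EFin \o Dinf) by exact: measurable_funS (FR n) mD.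
have DF n t : F n t -> (0 <= (EFin \o Dinf) t)%E.
  by move=> /FR/RposE t0; rewrite lee_fin Dinf_ge0.
rewrite FE; exact: (ge0_nondecreasing_set_cvg_integral (mu := mu) ndF mF mDF DF).
Qed.

(** On F n the integral is twice the difference of [info] at the two ends. The upper end tends to
    I(X; Y), the lower one to 0 because [info] at c is at most c^2 E[Y^2] / 2 in absolute value. *)
Let integral_DinfE :
  (\int[mu]_(t in Rpos) (Dinf t)%:E = (2 * \sum_x p x * relent P0 (density_ratio p f x))%:E)%E.
Proof.
have E n : (\int[mu]_(t in F n) (Dinf t)%:E =
    (2 * (info (Num.sqrt n.+2%:R) - info (Num.sqrt n.+2%:R^-1)))%:E)%E.
  have n0 : 0 < n.+2%:R^-1 :> R by rewrite invr_gt0.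
  have n1 : n.+2%:R^-1 < n.+2%:R :> R.
    by apply: (@lt_trans _ _ 1); rewrite ?invf_lt1 ?ltr1n.
  have [i <-] := integral_Dinf n0 n1.
  by apply: EFin_Rintegral => //; exact: measurable_itv.
have c : ((2 * (info (Num.sqrt n.+2%:R) - info (Num.sqrt n.+2%:R^-1)))%:E @[n --> \oo] -->
    \int[mu]_(t in Rpos) (Dinf t)%:E)%E.
  by apply: cvg_trans cvg_Dinf; apply: near_eq_cvg; apply: nearW => n; rewrite E.
apply: (cvg_unique _ c); first exact: ereal_hausdorff.
apply: cvg_EFin; first by apply: nearW.
apply: cvgMr; rewrite -[X in _ --> X]subr0; apply: cvgB.
  have c1 : info (Num.sqrt n.+1%:R) @[n --> \oo] --> \sum_x p x * relent P0 (density_ratio p f x).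
    exact: (cvg_output_info eP0).
  rewrite -(cvg_shiftS (fun n => info (Num.sqrt n.+1%:R))) in c1.
  exact: c1.
apply/cvgr0Pnorm_le => e e0.
exists (Num.truncn (mom2 P0 / e)) => // n /= hn.
have h : mom2 P0 / e <= n.+2%:R.
  apply: (le_trans (ltW (truncnS_gt _))); rewrite ler_nat; exact: leqW.
apply: (le_trans (output_info_small eP0 _)).
have m0 : 0 <= mom2 P0 by apply: Rintegral_ge0 => y _; exact: sqr_ge0.
rewrite sqr_sqrtr ?invr_ge0// -mulrA ler_pdivrMl//.
apply: (@le_trans _ _ (mom2 P0)); first by rewrite ler_piMl// invf_le1// ler1n.
by rewrite mulrC -ler_pdivrMl// mulrC.
Qed.

Let cvg_integral_Dn :
  (\int[mu]_(t in Rpos) (Dn n t)%:E @[n --> \oo] --> \int[mu]_(t in Rpos) (Dinf t)%:E)%E.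
Proof.
(* The domination by G starts at degree 1, where the linear estimator becomes available. *)
rewrite -cvg_shiftS.
have m1 n : measurable_fun (Rpos : set RR) (EFin \o Dn n.+1).
  by apply/measurable_EFinP; exact: Dn_measurable.
have m2 : measurable_fun (Rpos : set RR) (EFin \o Dinf).
  by apply/measurable_EFinP; exact: Dinf_measurable.
have c1 : {ae mu, forall t : RR, Rpos t -> (EFin \o Dn n.+1) t @[n --> \oo] --> (EFin \o Dinf) t}.
  apply/aeW => t /RposE t0; apply: cvg_EFin; first by apply: nearW.
  have := cvg_Dn t0; rewrite -cvg_shiftS; exact.
have iG : mu.-integrable (Rpos : set RR) (EFin \o G).
  apply/integrableP; split; first by apply/measurable_EFinP; exact: G_measurable.
  apply: le_lt_trans G_int; rewrite le_eqVlt; apply/orP; left; apply/eqP.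
  apply: eq_integral.
  by move=> t; rewrite inE => /RposE t0 /=; rewrite ger0_norm// G_ge0.
have le1 : {ae mu, forall (t : RR) n, Rpos t -> (`|(EFin \o Dn n.+1) t| <= (EFin \o G) t)%E}.
  apply/aeW => t n /RposE t0 /=.
  by rewrite lee_fin ger0_norm ?Dn_ge0// Dn_le.
have mR : measurable (Rpos : set RR) by exact: measurable_itv.
by have [] := dominated_convergence mR m1 m2 c1 iG le1.
Qed.

Lemma cvg_integral_pmmse_gap : (
  (fun n => \int[mu]_(t in `[0%R, +oo[)
        (pmmse q n t - \sum_x (p x)%:E * pmmse (f x) n t))
    @ \oo --> 2%:E * mutual_info p f)%E.
Proof.
rewrite (mutual_info_relent p0 p1 hf) -EFinM -integral_DinfE.
have E n : (\int[mu]_(t in `[0%R, +oo[) (pmmse q n t - \sum_x (p x)%:E * pmmse (f x) n t) =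
    \int[mu]_(t in Rpos) (Dn n t)%:E)%E.
  (* The point 0 is a null set; finiteness of [pmmse], and with it the real form [Dn] of the gap, is
     established for t > 0. *)
  rewrite -integral_itv_obnd_cbnd.
    by apply: eq_integral => t; rewrite inE => /RposE t0; rewrite DnE.
  apply: (@eq_measurable_fun _ _ _ _ _ (EFin \o Dn n)).
    by move=> t; rewrite inE => /RposE t0; rewrite DnE.
  by apply/measurable_EFinP; exact: Dn_measurable.
under eq_fun do rewrite E.
exact: cvg_integral_Dn.
Qed.

End pmmse_gap.

Unset Implicit Arguments.
Local Open Scope ereal_scope.

Theorem theorem9p1 (R : realType) (K : finType) (p : K -> R) (f : K -> R -> R) :
  (forall x : K, (0 < p x)%R) ->
  (\sum_(x : K) p x)%R = 1%R ->
  (forall x : K, is_density (f x)) ->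
  has_mgf (mix_density p f) ->
  diff_entropy_gt_ninfty (mix_density p f) ->
  (fun n : nat =>
     \int[@lebesgue_measure R]_(t in `[0%R, +oo[)
        (pmmse (mix_density p f) n t
         - \sum_(x : K) (p x)%:E * pmmse (f x) n t))
    @ \oo --> 2%:E * mutual_info p f.
Proof.
by move=> p0 p1 hf hmgf hent; exact: (cvg_integral_pmmse_gap p0 p1 hf hmgf hent).
Qed.
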